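(* Let $(X,T)$ and $(Y,S)$ be dynamical systems, let $\pi:(X,T)\to(Y,S)$ be a factor map, and let $f:X\to\mathbb{R}$ be a continuous function. Then for every real number $w$ with $0\le w\le1$, \[ P^w(\pi,T,f)=\sup_{\mu\in\mathscr{M}^T(X)}\left(w\,h_\mu(T)+(1-w)\,h_{\pi_*\mu}(S)+w\int_Xf\,d\mu\right), \] where $P^w(\pi,T,f)$ is the $w$-weighted topological pressure.
   Context: A dynamical system $(X,T)$ is a (nonempty) compact metrizable space $X$ together with a continuous map $T:X\to X$. A factor map $\pi:(X,T)\to(Y,S)$ is a continuous surjection $\pi:X\to Y$ with $\pi\circ T=S\circ\pi$. $\mathscr{M}^T(X)$ is the set of $T$-invariant Borel probability measures on $X$; $\pi_*\mu$ is the push-forward of $\mu$ under $\pi$; $h_\mu(T)\in[0,\infty]$ is the Kolmogorov–Sinai entropy (natural logarithm). The convention $0\cdot\infty=0$ is used. Definition of $P^w(\pi,T,f)$. Let $d$ and $d'$ be metrics (compatible with the topologies) on $X$ and $Y$. For a natural number $N\ge1$ set \[ d_N(x_1,x_2)=\max_{0\le n<N}d(T^nx_1,T^nx_2),\qquad d'_N(y_1,y_2)=\max_{0\le n<N}d'(S^ny_1,S^ny_2), \] and $\mathbb{S}_Nf(x)=f(x)+f(Tx)+\dots+f(T^{N-1}x)$. For $\varepsilon>0$ and nonempty $\Omega\subset X$ set \[ P(\Omega,f,N,\varepsilon)=\inf\left\{\sum_{k=1}^n\exp\left(\sup_{U_k}\mathbb{S}_Nf\right)\right\}, \] the infimum being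 over all finite families of open subsets $U_1,\dots,U_n$ of $X$ with $\Omega\subset U_1\cup\dots\cup U_n$ and $\mathrm{diam}(U_k,d_N)<\varepsilon$ for all $k$ (the term for an empty $U_k$ is $0$); set $P(\emptyset,f,N,\varepsilon)=0$. For $0\le w\le1$ set \[ P^w(\pi,f,N,\varepsilon)=\inf\left\{\sum_{k=1}^n\bigl(P(\pi^{-1}(V_k),f,N,\varepsilon)\bigr)^w\right\}, \] the infimum being over all finite open covers $Y=V_1\cup\dots\cup V_n$ with $\mathrm{diam}(V_k,d'_N)<\varepsilon$ for all $k$ (the convention for $0^0$, arising only from empty $V_k$ when $w=0$, does not affect the value). This is sub-multiplicative in $N$ and monotone in $\varepsilon$, and \[ P^w(\pi,T,f)=\lim_{\varepsilon\to0}\left(\lim_{N\to\infty}\frac{\log P^w(\pi,f,N,\varepsilon)}{N}\right)\in(-\infty,\infty]. \] Its value does not depend on the choice of $d,d'$. *)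

(* Defs.v *)
From HB Require Import structures.
From mathcomp Require Import all_boot all_order all_algebra.
From mathcomp Require Import all_classical all_reals all_analysis.

Set Implicit Arguments.
Unset Strict Implicit.
Unset Printing Implicit Defensive.

Import Order.TTheory GRing.Theory Num.Theory.
Import numFieldNormedType.Exports.

Local Open Scope classical_set_scope.
Local Open Scope ring_scope.

(* The library has no join of metric and pointed types, and its measurable
   types are pointed; the point only records nonemptiness. *)
#[short(type="pmetricType")]
HB.structure Definition PointedMetric (K : numDomainType) :=
  {M of Metric K M & Pointed M}.

Notation borel X := (g_sigma_algebraType (@open X)).

Section dynamics.
Context {R : realType}.

Definition dynamical_system (X : pmetricType R) (T : X -> X) : Prop :=
  compact [set: X] /\ continuous T.

Definition factor_map (X Y : pmetricType R) (T : X -> X) (S : Y -> Y)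
    (pi : X -> Y) : Prop :=
  [/\ continuous pi, set_surj [set: X] [set: Y] pi & pi \o T = S \o pi].

End dynamics.

Section kolmogorov_sinai_entropy.
Context {d : measure_display} {T : measurableType d} {R : realType}.
(* As for [pushforward], [mu] is a bare set function, so that these
   definitions apply directly to an image measure; they are meant for
   probability measures. *)
Implicit Types (mu : set T -> \bar R) (f : T -> T).

Definition invariant_measure f mu : Prop :=
  forall A, measurable A -> pushforward mu f A = mu A.

(* Some of the cells may be empty. *)
Definition measurable_partition (k : nat) (A : 'I_k -> set T) : Prop :=
  [/\ forall i, measurable (A i), trivIset [set: 'I_k] A
    & \bigcup_i A i = [set: T]].

(* The library's [ln 0 = 0] gives the convention 0 log 0 = 0. *)
Definition partition_entropy mu (I : finType) (A : I -> set T) : R :=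
  - \sum_(i : I) fine (mu (A i)) * ln (fine (mu (A i))).

(* The join of the preimages of [A] under f^0, ..., f^(n-1). *)
Definition iterated_join f (n k : nat) (A : 'I_k -> set T)
    (a : {ffun 'I_n -> 'I_k}) : set T :=
  [set x | forall i : 'I_n, A (a i) (iter i f x)].

Definition entropy_wrt mu f (k : nat) (A : 'I_k -> set T) : R :=
  limn (fun n => partition_entropy mu (@iterated_join f n k A) / n%:R).

Definition ks_entropy mu f : \bar R :=
  ereal_sup [set h | exists (k : nat) (A : 'I_k -> set T),
    measurable_partition A /\ h = (entropy_wrt mu f A)%:E].

End kolmogorov_sinai_entropy.

Section weighted_pressure.
Context {R : realType}.
Local Open Scope ereal_scope.

Definition bowen_dist (X : pmetricType R) (T : X -> X) (N : nat)
    (x1 x2 : X) : R :=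
  \big[Num.max/0%R]_(n < N) mdist (iter n T x1) (iter n T x2).

(* The diameter for [bowen_dist T N]; it is -oo for the empty set. *)
Definition bowen_diam (X : pmetricType R) (T : X -> X) (N : nat)
    (U : set X) : \bar R :=
  ereal_sup [set r | exists x1 x2, [/\ U x1, U x2
                                     & r = (bowen_dist T N x1 x2)%:E]].

Definition birkhoff_sum (X : pmetricType R) (T : X -> X) (f : X -> R)
    (N : nat) (x : X) : R :=
  (\sum_(n < N) f (iter n T x))%R.

Definition small_open_cover (X : pmetricType R) (T : X -> X) (N : nat)
    (e : R) (Omega : set X) (n : nat) (U : 'I_n -> set X) : Prop :=
  [/\ forall k, open (U k), Omega `<=` \bigcup_k U k
    & forall k, bowen_diam T N (U k) < e%:E].

(* An empty member contributes [expeR -oo = 0], and the empty family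
   (n = 0) gives the value 0 when [Omega] is empty. *)
Definition cover_pressure (X : pmetricType R) (T : X -> X) (Omega : set X)
    (f : X -> R) (N : nat) (e : R) : \bar R :=
  ereal_inf [set s | exists (n : nat) (U : 'I_n -> set X),
    small_open_cover T N e Omega U /\
    s = \sum_(k < n) expeR (ereal_sup [set (birkhoff_sum T f N x)%:E
                                      | x in U k])].

Definition weighted_cover_pressure (w : R) (X Y : pmetricType R)
    (pi : X -> Y) (T : X -> X) (S : Y -> Y) (f : X -> R) (N : nat) (e : R)
    : \bar R :=
  ereal_inf [set s | exists (n : nat) (V : 'I_n -> set Y),
    small_open_cover S N e [set: Y] V /\
    s = \sum_(k < n) (cover_pressure T (pi @^-1` V k) f N e) `^ w].

Definition weighted_pressure (w : R) (X Y : pmetricType R)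
    (pi : X -> Y) (T : X -> X) (S : Y -> Y) (f : X -> R) : \bar R :=
  lim ((limn (fun N : nat =>
      lne (weighted_cover_pressure w pi T S f N e) * (N%:R^-1)%:E))
    @[e --> 0^'+]).

End weighted_pressure.

(* Main.v *)
(* The inequality ">=". If the cells of the partitions b of X and c of Y are
   such that small sets meet boundedly many of them, the weighted Gibbs
   inequality over the N-itineraries of (b, c o pi) bounds the right-hand side
   by log P^w(N, e) / N up to an additive constant. Every pair of partitions is
   approximated by such a pair at bounded entropy cost, and passing to
   (T^n, S^n, S_n f) and letting n -> oo removes the constants.

   The inequality "<=". Cover Y by Bowen balls whose radius, chosen at each
   centre among J scales, is such that shrinking it eight times costs at most a
   factor e^(dN) in the pressure of the fibre; one scale carries 1/J of the sum.
   Put on separated points x over the separated centres y the weights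
   proportional to Z_y^(w-1) e^(S_N f(x)), where Z_y is the sum of e^(S_N f) over
   y: these realize equality in the weighted Gibbs inequality. The orbit averages
   of these measures have a limit along an ultrafilter, which is only finitely
   additive but is dominated on open sets by an invariant Borel probability;
   both agree on sets with null boundary, and partitions into small such sets
   carry the entropy estimates to the limit. *)

Require Import Defs.
From HB Require Import structures.
From mathcomp Require Import all_boot all_order all_algebra.
From mathcomp Require Import all_classical all_reals all_analysis.
From mathcomp Require Import ring lra zify.
Import Order.TTheory GRing.Theory Num.Theory.
Import numFieldNormedType.Exports.
Local Open Scope classical_set_scope.
Local Open Scope ereal_scope.

(** For [<=] the entropy of the image charge must dominate that of the labels y, so y has to be
    readable off the itinerary of pi x, and the balls that carry the atoms must be well separated.
    Separated balls do not cover Y, while the enlarged balls that do may have a much larger fibre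
    pressure. Hence the choice of a radius at which enlarging is cheap: fibre pressures lie between
    e^(-NC) and e^(NK), so once J >= (C + K) / d one of J successive shrinkings costs at most
    e^(dN). Since J does not depend on N, the loss ln J disappears after division by N.

    For [>=] the power w is harmless, because t^w is subadditive; the loss comes from counting
    cells, and passing to iterates removes it only because the number of cells met by a small set is
    bounded independently of the partitions.

    The ultrafilter limit plays the part of weak compactness. Partitions with null boundaries can be
    chosen only once the limit is known, so the finite-time estimates are stated for all
    sufficiently fine partitions, with a fineness independent of N. *)

(** * Gibbs inequalities and subadditive sequences *)

Section finite_distributions.
Set Implicit Arguments.
Unset Strict Implicit.
Context {R : realType}.
Local Open Scope ring_scope.
Implicit Types (I J : finType) (x y z : R).

(** This is [ln t <= t - 1] at [t = y / x], multiplied by [x]; summed over a distribution it gives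
    the nonnegativity of relative entropy. The implication [y = 0 -> x = 0] is absolute continuity:
    as [ln 0 = 0], the bound fails for y = 0 and small x > 0. *)
Lemma mul_ln_ge (x y : R) : 0 <= x -> 0 <= y -> (y = 0 -> x = 0) ->
  x * (ln y - ln x) <= y - x.
Proof.
move=> x0 y0 xy; have [->|xn0] := eqVneq x 0; first by rewrite mul0r subr0.
have xgt0 : 0 < x by rewrite lt_neqAle eq_sym xn0.
have ygt0 : 0 < y.
  by rewrite lt_neqAle eq_sym y0 andbT; apply: contraNN xn0 => /eqP/xy ->.
have -> : y - x = x * (y / x - 1) by field.
rewrite -ln_div ?posrE// ler_wpM2l//.
have := @le_ln1Dx R (y / x - 1).
rewrite addrCA subrr addr0 => -> //.
by rewrite ltrBrDr addrC subrr divr_gt0.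
Qed.

(** Nonnegativity of the entropy of [p] relative to the Gibbs distribution [expR (c i) / Z] on
    [Q]. *)
Lemma gibbs_inequality I (Q : pred I) (p c : I -> R) :
  (forall i, 0 <= p i) -> \sum_i p i = 1 -> (forall i, p i != 0 -> Q i) ->
  \sum_i p i * (c i - ln (p i)) <= ln (\sum_(i | Q i) expR (c i)).
Proof.
move=> p0 p1 pQ; set Z := \sum_(i | Q i) _.
have Zgt0 : 0 < Z.
  have : \sum_i p i != 0 by rewrite p1 oner_eq0.
  rewrite psumr_neq0// => /hasP[i _ /= /lt0r_neq0/pQ Qi].
  rewrite /Z (bigD1 i)//= ltr_pwDl// ?expR_gt0//.
  by apply: sumr_ge0 => j _; exact: expR_ge0.
rewrite -subr_le0 -[X in _ - X]mul1r -p1 big_distrl/= -sumrB.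
have -> : \sum_i (p i * (c i - ln (p i)) - p i * ln Z) =
    \sum_(i | Q i) p i * (ln (expR (c i) / Z) - ln (p i)).
  rewrite [RHS]big_mkcond/=; apply: eq_bigr => i _; case: ifPn => Qi.
    by rewrite ln_div ?posrE ?expR_gt0// expRK; ring.
  have -> : p i = 0 by apply/eqP; apply: contraNT Qi => /pQ.
  by rewrite !mul0r subr0.
apply: (@le_trans _ _ (\sum_(i | Q i) (expR (c i) / Z - p i))).
  apply: ler_sum => i Qi; apply: mul_ln_ge => //.
  - by rewrite divr_ge0 ?expR_ge0// ltW.
  - by move/eqP; rewrite mulf_eq0 expR_eq0 invr_eq0 (gt_eqF Zgt0).
rewrite sumrB -big_distrl/= divff ?gt_eqF// -p1 subr_le0.
rewrite [leRHS]big_mkcond/= ; apply: ler_sum => i _.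
by case: ifPn => // Qi; have [->//|/pQ] := eqVneq (p i) 0; rewrite (negbTE Qi).
Qed.

(** Write w H(p) + (1 - w) H(q) as w (H(p) - H(q)) + H(q). The conditional entropy H(p) - H(q) is
    bounded by the Gibbs inequality inside the fibres of [phi], which produces the energy
    [ln (Z j)]; then the Gibbs inequality on [J] is applied to the potential [w * ln (Z j)]. *)
Lemma weighted_gibbs_inequality I J (phi : I -> J) (P : pred I) (Q : pred J)
    (w : R) (p c : I -> R) (q Z : J -> R) :
  0 <= w -> (forall i, 0 <= p i) -> \sum_i p i = 1 ->
  (forall i, p i != 0 -> P i) -> (forall j, q j != 0 -> Q j) ->
  (forall j, q j = \sum_(i | phi i == j) p i) ->
  (forall j, Z j = \sum_(i | (phi i == j) && P i) expR (c i)) ->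
  w * (- \sum_i p i * ln (p i)) + (1 - w) * (- \sum_j q j * ln (q j)) +
    w * \sum_i p i * c i <= ln (\sum_(j | Q j) (Z j) `^ w).
Proof.
move=> w0 p0 p1 pP qQ qE ZE.
have q0 j : 0 <= q j by rewrite qE sumr_ge0.
have qp i : q (phi i) = 0 -> p i = 0.
  rewrite qE => /eqP; rewrite psumr_eq0// => /allP /(_ i); rewrite mem_index_enum.
  by move=> /(_ isT); rewrite eqxx => /eqP.
have Z0 j : 0 <= Z j by rewrite ZE sumr_ge0// => i _; exact: expR_ge0.
have Zp i : P i -> 0 < Z (phi i).
  move=> Pi; rewrite ZE (bigD1 i) ?eqxx//= ltr_pwDl ?expR_gt0//.
  by apply: sumr_ge0 => k _; exact: expR_ge0.
have sumphi (F : J -> R) : \sum_j q j * F j = \sum_i p i * F (phi i).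
  rewrite [RHS](partition_big phi xpredT)//=; apply: eq_bigr => j _.
  by rewrite qE big_distrl/=; apply: eq_bigr => i /eqP ->.
have q1 : \sum_j q j = 1.
  rewrite -p1; transitivity (\sum_j q j * 1); first by apply: eq_bigr => j; rewrite mulr1.
  by rewrite (sumphi (fun=> 1)); apply: eq_bigr => j; rewrite mulr1.
have Zq j : q j != 0 -> 0 < Z j.
  rewrite qE psumr_neq0// => /hasP[i _ /= /andP[/eqP <- pi]].
  by apply: Zp; apply: pP; rewrite gt_eqF.
(* In each fibre [p] is compared with the Gibbs law [expR (c i) / Z j], weighted by [q j]. *)
have inner : - \sum_i p i * ln (p i) + \sum_j q j * ln (q j) + \sum_i p i * c i
    <= \sum_j q j * ln (Z j).
  rewrite -subr_le0 (sumphi (fun j => ln (q j))) (sumphi (fun j => ln (Z j))) -sumrN -!big_split/= -sumrB.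
  apply: (@le_trans _ _ (\sum_i (if P i then expR (c i) * q (phi i) / Z (phi i) - p i
      else 0))).
    apply: ler_sum => i _; case: ifPn => Pi; last first.
      have -> : p i = 0 by apply/eqP; apply: contraNT Pi => /pP.
      by rewrite !mul0r !addr0 subr0 oppr0.
    have [pi0|pin0] := eqVneq (p i) 0.
      rewrite pi0 !mul0r !addr0 !subr0 oppr0.
      by rewrite divr_ge0// mulr_ge0// expR_ge0.
    have qgt0 : 0 < q (phi i).
      by rewrite lt_neqAle q0 andbT eq_sym; apply: contraNN pin0 => /eqP/qp ->.
    apply: le_trans (@mul_ln_ge (p i) (expR (c i) * q (phi i) / Z (phi i)) _ _ _) => //.
    - rewrite ln_div ?posrE ?Zp// ?mulr_gt0 ?expR_gt0//.
      by rewrite lnM ?posrE ?expR_gt0// expRK le_eqVlt; apply/orP; left; apply/eqP; ring.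
    - by rewrite divr_ge0// mulr_ge0// expR_ge0.
    - by move/eqP; rewrite !mulf_eq0 expR_eq0 invr_eq0 !gt_eqF ?Zp.
  rewrite -big_mkcond/= sumrB subr_le0.
  have -> : \sum_(i | P i) p i = 1.
    rewrite -p1 [LHS]big_mkcond/=; apply: eq_bigr => i _; case: ifPn => // Pi.
    by apply/esym/eqP; apply: contraNT Pi => /pP.
  rewrite (partition_big phi xpredT)//= -q1; apply: ler_sum => j _.
  have [qj0|qj0] := eqVneq (q j) 0.
    by rewrite qj0 big1// => i /andP[_ /eqP ->]; rewrite qj0 mulr0 mul0r.
  rewrite (eq_bigr (fun i => expR (c i) * (q j / Z j))); last first.
    by move=> i /andP[_ /eqP ->]; rewrite mulrA.
  rewrite -big_distrl/= (eq_bigl (fun i => (phi i == j) && P i)) -?ZE; last first.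
    by move=> i; rewrite andbC.
  by rewrite mulrCA divff ?mulr1// gt_eqF// Zq.
(* [expR (cc j)] is the power of [Z j] only where [Z j] is positive, since [ln 0 = 0]; hence the
   restriction to [0 < Z j] in the next application. *)
pose cc j := w * ln (Z j).
have := @gibbs_inequality J (fun j => Q j && (0 < Z j)) q cc q0 q1.
have QZ j : q j != 0 -> Q j && (0 < Z j) by move=> qj; rewrite qQ// Zq.
move=> /(_ QZ) H.
have H2 : ln (\sum_(j | Q j && (0 < Z j)) expR (cc j)) <= ln (\sum_(j | Q j) Z j `^ w).
  have le : \sum_(j | Q j && (0 < Z j)) expR (cc j) <= \sum_(j | Q j) Z j `^ w.
    rewrite big_mkcondr/=; apply: ler_sum => j _; case: ifPn => [Zj|_].
      by rewrite /cc -ln_powR lnK// posrE powR_gt0.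
    exact: powR_ge0.
  have gt0 : 0 < \sum_(j | Q j && (0 < Z j)) expR (cc j).
    have : \sum_j q j != 0 by rewrite q1 oner_eq0.
    rewrite psumr_neq0// => /hasP[j _ /= /lt0r_neq0 qj].
    rewrite (bigD1 j) ?(qQ _ qj) ?(Zq _ qj)//= ltr_pwDl ?expR_gt0//.
    by apply: sumr_ge0 => k _; exact: expR_ge0.
  by rewrite ler_ln ?posrE// (lt_le_trans gt0).
apply: le_trans H2; apply: le_trans H.
rewrite [leRHS](eq_bigr (fun j => w * (q j * ln (Z j)) - q j * ln (q j))); last first.
  by move=> j _; rewrite /cc; ring.
rewrite sumrB -big_distrr/=.
have := ler_wpM2l w0 inner; lra.
Qed.

Lemma entropy_term_ge0 x : 0 <= x <= 1 -> 0 <= - (x * ln x).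
Proof. by move=> /andP[x0 x1]; rewrite -mulrN mulr_ge0// oppr_ge0 ln_le0. Qed.

Lemma entropy_term_small (e : R) : 0 < e ->
  exists2 d : R, 0 < d & forall x, 0 <= x <= d -> - (x * ln x) <= e.
Proof.
(* With s the square root of x, ln(1/s) < 1/s gives -(x ln x) = 2 s (s ln(1/s)) <= 2 s, so s <= e /
   2 suffices. *)
move=> e0; exists ((e / 2) ^+ 2); first by rewrite exprn_gt0// divr_gt0.
move=> x /andP[x0 xd]; have [->|xn0] := eqVneq x 0; first by rewrite mul0r oppr0 ltW.
have xgt0 : 0 < x by rewrite lt_neqAle eq_sym xn0.
pose s := Num.sqrt x; have s0 : 0 < s by rewrite sqrtr_gt0.
have xs : x = s ^+ 2 by rewrite sqr_sqrtr.
have se : s <= e / 2.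
  by rewrite -(@ler_pXn2r _ 2)// ?nnegrE -?xs// ltW// divr_gt0.
have l : ln s^-1 < s^-1 by rewrite ln_sublinear// invr_gt0.
rewrite lnV ?posrE// in l.
rewrite xs lnXn// mulr2n.
have l2 : s * - ln s <= 1 by rewrite -(@mulfV _ s) ?gt_eqF// ler_pM2l// ltW.
have -> : - (s ^+ 2 * (ln s + ln s)) = 2 * (s * (s * - ln s)) by ring.
have : s * (s * - ln s) <= s * 1 by rewrite ler_pM2l.
lra.
Qed.

Lemma subadditive_affine_bound (a : nat -> R) (m : nat) : (0 < m)%N ->
  (forall i j, a (i + j)%N <= a i + a j) ->
  exists B, forall n, a n <= n%:R * (a m / m%:R) + B.
Proof.
(* The three terms bound [a] at the remainder of n modulo m, the fraction of [a m] lost in rounding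
   n / m down, and [a 0], which subadditivity does not force to vanish. *)
move=> m0 suba; exists (\sum_(r < m) `|a r| + `|a m| + `|a 0%N|) => n.
have mulle q : a (q * m)%N <= q%:R * a m + `|a 0%N|.
  elim: q => [|q IH]; first by rewrite mul0n mul0r add0r ler_norm.
  by rewrite mulSn (le_trans (suba _ _))// -natr1; lra.
have h : a (n %% m)%N <= \sum_(r < m) `|a r|.
  rewrite (bigD1 (Ordinal (ltn_pmod n m0)))//= (le_trans (ler_norm _))//.
  by rewrite lerDl sumr_ge0.
have := suba (n %/ m * m)%N (n %% m)%N; rewrite -divn_eq => H.
have := mulle (n %/ m)%N => H1.
have mR : 0 < m%:R :> R by rewrite ltr0n.
have nE : n%:R * (a m / m%:R) = (n %/ m)%:R * a m + (n %% m)%:R / m%:R * a m.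
  rewrite {1}(divn_eq n m) natrD natrM; field; exact: lt0r_neq0.
have : - `|a m| <= (n %% m)%:R / m%:R * a m.
  rewrite lerNl (le_trans (ler_norm _))// normrN normrM ler_piMl// ger0_norm.
    by rewrite ler_pdivrMr// mul1r ler_nat ltnW// ltn_pmod.
  by rewrite divr_ge0.
lra.
Qed.

(** The linear lower bound makes the infimum of a n / n finite. The affine bound, taken at an index
    that nearly attains it, controls the upper limit. *)
Lemma fekete (a : nat -> R) (C : R) :
  (forall i j, a (i + j)%N <= a i + a j) -> (forall n, - (n%:R * C) <= a n) ->
  exists2 l : R, a n / n%:R @[n --> \oo] --> l &
    forall n, (0 < n)%N -> l <= a n / n%:R.
Proof.
move=> suba lb.
pose E := [set a n / n%:R | n in [set n : nat | (0 < n)%N]].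
have lbE : lbound E (- C).
  move=> _ [n /= n0 <-]; rewrite ler_pdivlMr ?ltr0n// mulNr mulrC.
  exact: lb.
have infE : has_inf E.
  by split; [exists (a 1%N / 1%:R); exists 1%N | exists (- C)].
have infle n : (0 < n)%N -> inf E <= a n / n%:R.
  by move=> n0; apply: ge_inf; [case: infE | exists n].
exists (inf E) => //.
apply/cvgrPdist_le => e e0.
have e2 : 0 < e / 2 by rewrite divr_gt0.
have [_ [m /= m0 <-] am] := inf_adherent e2 infE.
have [B HB] := subadditive_affine_bound m0 suba.
have : \forall n \near \oo, `|B| / (e / 2) <= n%:R by exact: nbhs_infty_ger.
move=> H; near=> n.
have n0 : (0 < n)%N by near: n; exact: nbhs_infty_gt.
have nR : 0 < n%:R :> R by rewrite ltr0n.
have Bn : B / n%:R <= e / 2.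
  rewrite ler_pdivrMr// mulrC -ler_pdivrMr// (le_trans _ (near H n _))//.
  by rewrite ler_pM2r ?invr_gt0// ler_norm.
have : a n / n%:R <= a m / m%:R + B / n%:R.
  rewrite ler_pdivrMr// mulrDl divfK ?gt_eqF//.
  by rewrite mulrC; exact: HB.
have := infle n n0; rewrite ler_norml; lra.
Unshelve. all: by end_near. Qed.

End finite_distributions.

(** * Entropy of finitely additive set functions *)

Section finitely_additive.
Set Implicit Arguments.
Unset Strict Implicit.
Context {d : measure_display} {T : measurableType d} {R : realType}.
Local Open Scope ring_scope.
Implicit Types (I J K : finType) (m : set T -> R).

(* Entropy is set up for finitely additive functions defined on all sets, to
   cover Borel probabilities, averages of atomic measures and their ultrafilter
   limits alike. Partitions are represented by maps to finite types. *)
Definition finitely_additive_probability m : Prop :=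
  [/\ forall A, measurable A -> 0 <= m A, m [set: T] = 1 &
      forall A B, measurable A -> measurable B -> A `&` B = set0 ->
        m (A `|` B) = m A + m B].

Definition cell (I : Type) (g : T -> I) (i : I) : set T := [set x | g x = i].

Definition finite_measurable (I : Type) (g : T -> I) : Prop :=
  forall i, measurable (cell g i).

Definition map_entropy m I (g : T -> I) : R :=
  - \sum_i m (cell g i) * ln (m (cell g i)).

Lemma finite_measurable_preimage I (g : T -> I) (P : pred I) :
  finite_measurable g -> measurable [set x | P (g x)].
Proof.
move=> mg; have -> : [set x | P (g x)] = \bigcup_(i in [set i | P i]) cell g i.
  apply/seteqP; split=> [x Px|x [i Pi]]; first by exists (g x).
  by rewrite /cell/= => gx; rewrite gx.
by apply: fin_bigcup_measurable => //; exact: finite_finset.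
Qed.

Lemma finite_measurable_pair I J (g : T -> I) (h : T -> J) :
  finite_measurable g -> finite_measurable h ->
  finite_measurable (fun x => (g x, h x)).
Proof.
move=> mg mh [i j]; have -> : cell (fun x => (g x, h x)) (i, j) = cell g i `&` cell h j.
  by apply/seteqP; rewrite /cell; split=> x /= [-> ->].
exact: measurableI.
Qed.

Lemma finite_measurable_comp I J (phi : I -> J) (g : T -> I) :
  finite_measurable g -> finite_measurable (phi \o g).
Proof.
move=> mg j; rewrite (_ : cell _ _ = [set x | phi (g x) == j]).
  exact: (@finite_measurable_preimage _ g (fun i => phi i == j)).
by apply/seteqP; split=> x /= /eqP.
Qed.

Section fixed_additive.
Context (m : set T -> R) (hm : finitely_additive_probability m).

Let m_ge0 A : measurable A -> 0 <= m A. Proof. by case: hm => + _ _; exact. Qed.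

Let mU A B : measurable A -> measurable B -> A `&` B = set0 ->
  m (A `|` B) = m A + m B.
Proof. by case: hm => _ _; exact. Qed.

Lemma fap_set0 : m set0 = 0.
Proof.
have := @mU set0 set0 measurable0 measurable0 (setI0 _).
by rewrite setU0 => /eqP; rewrite -subr_eq0 opprD addrA subrr sub0r oppr_eq0 => /eqP.
Qed.

Lemma fap_le A B : measurable A -> measurable B -> A `<=` B -> m A <= m B.
Proof.
move=> mA mB AB; rewrite -(setDUK AB) mU ?lerDl ?m_ge0//.
- exact: measurableD.
- exact: measurableD.
- by rewrite setDE setICA setICr setI0.
Qed.

Lemma fap_le1 A : measurable A -> m A <= 1.
Proof. by move=> mA; case: (hm) => _ <- _; apply: fap_le. Qed.

Lemma fap_decomposition I (g : T -> I) (A : set T) (P : pred I) :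
  measurable A -> finite_measurable g ->
  m (A `&` [set x | P (g x)]) = \sum_(i | P i) m (A `&` cell g i).
Proof.
move=> mA mg.
have H (s : seq I) : uniq s ->
    m (A `&` [set x | g x \in s]) = \sum_(i <- s) m (A `&` cell g i).
  elim: s => [_|i s IH /= /andP[si us]].
    rewrite big_nil (_ : [set x | _] = set0) ?setI0 ?fap_set0//.
    by apply/seteqP; split.
  rewrite big_cons -IH// -mU.
  - congr (m _); rewrite -setIUr; congr (_ `&` _).
    apply/seteqP; split=> x /=; rewrite inE.
      by case/orP => [/eqP|]; [left|right].
    by case=> [->|->]; rewrite ?eqxx ?orbT.
  - exact: measurableI.
  - by apply: measurableI => //; exact: (@finite_measurable_preimage _ g (fun i => i \in s)).
  - apply/seteqP; split => x //= [[_ gi] [_ gs]].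
    by move: si; rewrite -gi gs.
rewrite -big_filter -H ?filter_uniq ?index_enum_uniq//.
congr (m (_ `&` _)); apply/seteqP; split=> x /=; rewrite mem_filter mem_index_enum andbT//.
Qed.

Lemma fap_marginal I J (g : T -> I) (h : T -> J) (i : I) :
  finite_measurable g -> finite_measurable h ->
  m (cell g i) = \sum_j m (cell (fun x => (g x, h x)) (i, j)).
Proof.
move=> mg mh; have := fap_decomposition xpredT (mg i) mh.
rewrite (_ : _ `&` _ = cell g i); last by apply/seteqP; split=> [x []|x] /=.
move=> ->; apply: eq_bigr => j _; congr (m _).
by apply/seteqP; rewrite /cell; split=> x /= [-> ->].
Qed.

Lemma fap_marginal_r I J (g : T -> I) (h : T -> J) (j : J) :
  finite_measurable g -> finite_measurable h ->
  m (cell h j) = \sum_i m (cell (fun x => (g x, h x)) (i, j)).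
Proof.
move=> mg mh; rewrite (fap_marginal _ mh mg); apply: eq_bigr => i _.
by congr (m _); apply/seteqP; rewrite /cell; split=> x /= [-> ->].
Qed.

Lemma fap_image I J (g : T -> I) (phi : I -> J) (j : J) : finite_measurable g ->
  m (cell (phi \o g) j) = \sum_(i | phi i == j) m (cell g i).
Proof.
move=> mg; rewrite (eq_bigr (fun i => m (setT `&` cell g i))) => [|i _]; last by rewrite setTI.
rewrite -(fap_decomposition (fun i => phi i == j))// setTI.
by congr (m _); apply/seteqP; split=> x /= /eqP.
Qed.

Lemma fap_sum1 I (g : T -> I) : finite_measurable g -> \sum_i m (cell g i) = 1.
Proof.
move=> mg; have := fap_decomposition xpredT (@measurableT _ T) mg.
rewrite setTI (_ : [set x | _] = setT); last by apply/seteqP.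
case: (hm) => _ -> _ ->; by apply: eq_bigr => i _; rewrite setTI.
Qed.

Lemma map_entropy_ge0 I (g : T -> I) : finite_measurable g -> 0 <= map_entropy m g.
Proof.
move=> mg; rewrite /map_entropy -sumrN; apply: sumr_ge0 => i _.
by apply: entropy_term_ge0; rewrite m_ge0//= fap_le1.
Qed.

Lemma map_entropy_le_card I (g : T -> I) : finite_measurable g ->
  map_entropy m g <= ln #|I|%:R.
Proof.
move=> mg; have := @gibbs_inequality R I xpredT (fun i => m (cell g i)) (fun=> 0)
  (fun i => m_ge0 (mg i)) (fap_sum1 mg) (fun _ _ => isT).
rewrite expR0 sumr_const => H; apply: le_trans H.
by rewrite /map_entropy -sumrN; apply: ler_sum => i _; rewrite sub0r mulrN.
Qed.

Lemma map_entropy_comp_le I J (g : T -> I) (phi : I -> J) : finite_measurable g ->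
  map_entropy m (phi \o g) <= map_entropy m g.
Proof.
move=> mg; rewrite /map_entropy lerN2.
have -> : \sum_j m (cell (phi \o g) j) * ln (m (cell (phi \o g) j)) =
    \sum_i m (cell g i) * ln (m (cell (phi \o g) (phi i))).
  rewrite [RHS](partition_big phi xpredT)//=; apply: eq_bigr => j _.
  by rewrite {1}(fap_image _ _ mg) big_distrl/=; apply: eq_bigr => i /eqP ->.
apply: ler_sum => i _.
have [->|gi0] := eqVneq (m (cell g i)) 0; first by rewrite !mul0r.
have gi : 0 < m (cell g i) by rewrite lt_neqAle eq_sym gi0 m_ge0.
have le : m (cell g i) <= m (cell (phi \o g) (phi i)).
  apply: fap_le => //; first exact: finite_measurable_comp.
  by move=> x; rewrite /cell/= => ->.
by rewrite ler_wpM2l ?m_ge0// ler_ln ?posrE// (lt_le_trans gi).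
Qed.

(** Being constant on the cells of [g], [h] factors through [g]. Comparisons of joins take this form
    throughout, so that no map between index types has to be named. *)
Lemma map_entropy_le I J (g : T -> I) (h : T -> J) : finite_measurable g ->
  (forall x y, g x = g y -> h x = h y) -> map_entropy m h <= map_entropy m g.
Proof.
move=> mg gh.
pose phi i := h (xget point (cell g i)).
have -> : h = phi \o g.
  apply/funext => x /=; rewrite /phi; case: xgetP => [y _ gy|/(_ x)]; last by case.
  exact/gh.
exact: map_entropy_comp_le.
Qed.

Lemma map_entropy_eq I J (g : T -> I) (h : T -> J) :
  finite_measurable g -> finite_measurable h ->
  (forall x y, g x = g y <-> h x = h y) -> map_entropy m g = map_entropy m h.
Proof.
move=> mg mh gh; apply/eqP; rewrite eq_le.
by apply/andP; split; apply: map_entropy_le => // x y /gh.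
Qed.

(** Strong subadditivity, that is H(g, h | k) <= H(g | k) + H(h | k). It is the nonnegativity of the
    entropy of the joint law relative to the law that makes [g] and [h] independent given [k]. *)
Lemma map_entropy_submodular I J K (g : T -> I) (h : T -> J) (k : T -> K) :
  finite_measurable g -> finite_measurable h -> finite_measurable k ->
  map_entropy m (fun x => ((g x, h x), k x)) + map_entropy m k <=
  map_entropy m (fun x => (g x, k x)) + map_entropy m (fun x => (h x, k x)).
Proof.
move=> mg mh mk.
set f := (fun x => ((g x, h x), k x)); set gk := (fun x => (g x, k x)).
set hk := (fun x => (h x, k x)).
have mgk : finite_measurable gk by exact: finite_measurable_pair.
have mhk : finite_measurable hk by exact: finite_measurable_pair.
have mf : finite_measurable f.
  by apply: finite_measurable_pair => //; exact: finite_measurable_pair.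
pose p t := m (cell f t); pose pk c := m (cell k c).
pose pgk t := m (cell gk t); pose phk t := m (cell hk t).
have p0 t : 0 <= p t by exact: m_ge0.
have pk0 t : 0 <= pk t by exact: m_ge0.
have pgk0 t : 0 <= pgk t by exact: m_ge0.
have phk0 t : 0 <= phk t by exact: m_ge0.
pose u (t : I * J * K) := (t.1.1, t.2); pose v (t : I * J * K) := (t.1.2, t.2).
(* All four entropies become averages over the cells of the joint map, so that they can be compared
   term by term. *)
have E (L : finType) (phi : I * J * K -> L) (l : T -> L) : l = phi \o f ->
    map_entropy m l = - \sum_t p t * ln (m (cell l (phi t))).
  move=> le; rewrite /map_entropy; congr (- _).
  rewrite [RHS](partition_big phi xpredT)//=; apply: eq_bigr => j _.
  rewrite {1}le {1}(fap_image _ _ mf) big_distrl/=; by apply: eq_bigr => i /eqP ->.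
rewrite (E _ id f)// (E _ snd k)// (E _ u gk)// (E _ v hk)//.
rewrite -!sumrN -!big_split/= -subr_le0 -sumrB.
(* The conditionally independent law. Its total mass is at most 1: terms with [pk c = 0] vanish
   because division by 0 gives 0. *)
apply: (@le_trans _ _ (\sum_t (pgk (u t) * phk (v t) / pk t.2 - p t))).
  apply: ler_sum => t _.
  have [pt0|ptn0] := eqVneq (p t) 0.
    by rewrite pt0 !mul0r !subr0 !oppr0 addr0 divr_ge0// mulr_ge0.
  have pt : 0 < p t by rewrite lt_neqAle eq_sym ptn0 p0.
  have gt (L : finType) (phi : I * J * K -> L) (l : T -> L) : l = phi \o f ->
      finite_measurable l -> 0 < m (cell l (phi t)).
    by move=> le ml; rewrite (lt_le_trans pt)// fap_le// => x /= xt; rewrite le /cell/= xt.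
  have g1 : 0 < pgk (u t) by exact: gt.
  have g2 : 0 < phk (v t) by exact: gt.
  have g3 : 0 < pk t.2 by apply: gt.
  apply: le_trans (@mul_ln_ge _ (p t) (pgk (u t) * phk (v t) / pk t.2) _ _ _) => //.
  - rewrite ln_div ?posrE ?mulr_gt0// lnM ?posrE// -/(p t) -/(pk t.2) -/(pgk (u t)) -/(phk (v t)).
    by rewrite le_eqVlt; apply/orP; left; apply/eqP; ring.
  - by rewrite divr_ge0// mulr_ge0.
  - by move/eqP; rewrite !mulf_eq0 invr_eq0 !gt_eqF.
rewrite sumrB subr_le0 [leRHS](_ : _ = 1); last exact: fap_sum1.
rewrite -(pair_big xpredT xpredT (fun ij c => pgk (ij.1, c) * phk (ij.2, c) / pk c))/=.
rewrite exchange_big/= -(fap_sum1 mk); apply: ler_sum => c _.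
rewrite -(pair_big xpredT xpredT (fun i j => pgk (i, c) * phk (j, c) / pk c))/=.
rewrite (eq_bigr (fun i => pgk (i, c) * (pk c / pk c))); last first.
  move=> i _; rewrite -big_distrl/= -big_distrr/= -mulrA; congr (_ * (_ / _)).
  by rewrite /pk (fap_marginal_r _ mh mk).
rewrite -big_distrl/= -(fap_marginal_r _ mg mk) -/(pk c).
by have [->|c0] := eqVneq (pk c) 0; [rewrite mul0r|rewrite divff// mulr1].
Qed.

Lemma map_entropy_pair_le I J (g : T -> I) (h : T -> J) :
  finite_measurable g -> finite_measurable h ->
  map_entropy m (fun x => (g x, h x)) <= map_entropy m g + map_entropy m h.
Proof.
(* Submodularity over the one-cell partition. *)
move=> mg mh; have mu : finite_measurable (fun _ : T => tt).
  by case; rewrite (_ : cell _ _ = setT)//; apply/seteqP.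
have := map_entropy_submodular mg mh mu.
have -> : map_entropy m (fun=> tt) = 0.
  apply/eqP; rewrite eq_le map_entropy_ge0// andbT.
  by rewrite (le_trans (map_entropy_le_card mu))// card_unit ln1.
rewrite addr0 => /le_trans; rewrite -[leLHS]/(map_entropy m (fun x => (g x, h x))).
have e1 : map_entropy m (fun x => (g x, h x)) <= map_entropy m (fun x => (g x, h x, tt)).
  apply: map_entropy_le; last by move=> x y [-> ->].
  by apply: finite_measurable_pair => //; exact: finite_measurable_pair.
have e2 : map_entropy m (fun x => (g x, tt)) <= map_entropy m g.
  by apply: map_entropy_le => // x y ->.
have e3 : map_entropy m (fun x => (h x, tt)) <= map_entropy m h.
  by apply: map_entropy_le => // x y ->.
by move=> H; apply: (le_trans e1); apply: H; exact: lerD.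
Qed.

End fixed_additive.
End finitely_additive.

(** * Itineraries and the entropy rate of a partition *)

Section entropy_rate.
Set Implicit Arguments.
Unset Strict Implicit.
Context {d : measure_display} {T : measurableType d} {R : realType}.
Local Open Scope ring_scope.
Implicit Types (I J K : finType) (m : set T -> R).

(** The cells of this map form the n-fold join of the partition under [f]. As it again takes values
    in a finite type, all entropy lemmas apply to it. *)
Definition itinerary (I : Type) (f : T -> T) (g : T -> I) (n : nat) (x : T)
    : {ffun 'I_n -> I} := [ffun i : 'I_n => g (iter i f x)].

Definition entropy_rate m (f : T -> T) I (g : T -> I) : R :=
  limn (fun n => map_entropy m (itinerary f g n) / n%:R).

Lemma itinerary_eq (I : Type) (f : T -> T) (g : T -> I) n x y :
  itinerary f g n x = itinerary f g n y <->
  (forall i, (i < n)%N -> g (iter i f x) = g (iter i f y)).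
Proof.
split=> [/ffunP H i ni|H]; first by have := H (Ordinal ni); rewrite !ffunE.
by apply/ffunP => i; rewrite !ffunE H.
Qed.

Context (f : T -> T) (mf : forall A, measurable A -> measurable (f @^-1` A)).

Lemma measurable_preimage_iter n A : measurable A -> measurable (iter n f @^-1` A).
Proof.
elim: n A => [|n IH] A mA //.
have -> : iter n.+1 f @^-1` A = iter n f @^-1` (f @^-1` A) by [].
exact/IH/mf.
Qed.

Lemma finite_measurable_iter I (g : T -> I) n : finite_measurable g ->
  finite_measurable (g \o iter n f).
Proof. by move=> mg i; exact: (measurable_preimage_iter n (mg i)). Qed.

Lemma finite_measurable_itinerary I (g : T -> I) n : finite_measurable g ->
  finite_measurable (itinerary f g n).
Proof.
move=> mg a; rewrite (_ : cell _ _ =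
    \bigcap_(i in [set: 'I_n]) cell (g \o iter i f) (a i)).
  apply: fin_bigcap_measurable => // i _; exact: finite_measurable_iter.
apply/seteqP; rewrite /cell; split=> x /=.
  by move=> <- i _ /=; rewrite ffunE.
by move=> H; apply/ffunP => i; rewrite ffunE; exact: H.
Qed.

Local Ltac solve_measurable := repeat first [by []
  | exact: finite_measurable_itinerary | apply: finite_measurable_iter
  | apply: finite_measurable_pair].

Lemma cell_comp (I : Type) (g : T -> I) (h : T -> T) i : cell (g \o h) i = h @^-1` cell g i.
Proof. by []. Qed.

Section fixed_additive.
Context (m : set T -> R) (hm : finitely_additive_probability m).

Lemma map_entropy_split (I : finType) (g : T -> I) a b :
  finite_measurable g ->
  map_entropy m (itinerary f g (a + b)) <=
  map_entropy m (itinerary f g a) + map_entropy m (itinerary f g b \o iter a f).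
Proof.
move=> mg; apply: le_trans (map_entropy_pair_le hm _ _); try solve_measurable.
apply: map_entropy_le => //; first by solve_measurable.
move=> x y [/itinerary_eq H1 /itinerary_eq H2]; apply/itinerary_eq => i iab.
case: (ltnP i a) => ia; first exact: H1.
have := H2 (i - a)%N; rewrite ltn_subLR// -!iterD subnK//.
by apply.
Qed.

Lemma map_entropy_itinerary_le I (g : T -> I) n : finite_measurable g ->
  map_entropy m (itinerary f g n) <= n%:R * ln #|I|%:R.
Proof.
move=> mg; apply: (le_trans (map_entropy_le_card hm _)); first by solve_measurable.
rewrite card_ffun card_ord.
case: n => [|n]; first by rewrite expn0 ln1 mul0r.
have I0 : (0 < #|I|)%N by apply/card_gt0P; exists (g point).
by rewrite natrX lnXn ?ltr0n// mulr_natl.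
Qed.

(* Misiurewicz's argument: for each r < M cut [0, N) at r, r + M, r + 2M, ... and
   sum over r. *)
Lemma map_entropy_block I (g : T -> I) M N : finite_measurable g -> (0 < M)%N ->
  M%:R * map_entropy m (itinerary f g N) <=
  \sum_(n < N) map_entropy m (itinerary f g M \o iter n f) +
  M%:R * (M%:R * ln #|I|%:R).
Proof.
move=> mg M0.
(* [A s] is the entropy of the word read from time s to time N; truncated subtraction makes it 0 for
   [N <= s]. [F s] sums it over M consecutive starting times, so cutting a block of length M off
   [A s] bounds [F s] by [h s + F s.+1], and the bounds telescope. *)
pose A s := map_entropy m (itinerary f g (N - s) \o iter s f).
pose h s := map_entropy m (itinerary f g M \o iter s f).
pose F s := \sum_(r < M) A (s + r)%N.
have A0 s : 0 <= A s.
  by apply: map_entropy_ge0 => //; solve_measurable.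
have AN s : (N <= s)%N -> A s = 0.
  move=> Ns; apply/eqP; rewrite eq_le A0 andbT.
  have mz : finite_measurable (itinerary f g (N - s) \o iter s f).
    by solve_measurable.
  apply: (le_trans (map_entropy_le_card hm mz)).
  move/eqP : Ns => ->; by rewrite card_ffun card_ord expn0 ln1.
have AM s : A s <= h s + A (s + M)%N.
  have mz k t : finite_measurable (itinerary f g k \o iter t f).
    by solve_measurable.
  apply: le_trans (map_entropy_pair_le hm _ _); try solve_measurable.
  apply: map_entropy_le => //; first by solve_measurable.
  move=> x y [/itinerary_eq H1 /itinerary_eq H2]; apply/itinerary_eq => i iab.
  case: (ltnP i M) => ia; first exact: H1.
  have := H2 (i - M)%N; rewrite -!iterD subnDA ltn_sub2r ?(leq_ltn_trans ia)//.
  rewrite (_ : (i - M + (s + M) = i + s)%N); last by lia.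
  by apply.
have FS s : F s <= h s + F s.+1.
  have : F s + A (s + M)%N = A s + F s.+1.
    rewrite /F -(big_ord_recr M (fun r => A (s + r)%N)) big_ord_recl addn0/=.
    by congr (_ + _); apply: eq_bigr => i _; rewrite /bump /= add1n addSnnS.
  have := AM s; lra.
have F0 n : F 0%N <= \sum_(i < n) h i + F n.
  elim: n => [|n IH]; first by rewrite big_ord0 add0r.
  by rewrite big_ord_recr/=; have := FS n; lra.
have FN : F N = 0 by rewrite /F big1// => r _; rewrite AN// leq_addr.
have A0r r : (r < M)%N -> A 0%N <= A r + M%:R * ln #|I|%:R.
  move=> rM; have lnI : 0 <= ln #|I|%:R :> R.
    have I0 : (0 < #|I|)%N by apply/card_gt0P; exists (g point).
    by rewrite ln_ge0// ler1n.
  have rl : r%:R * ln #|I|%:R <= M%:R * ln #|I|%:R :> R.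
    by rewrite ler_wpM2r// ler_nat ltnW.
  have [Nr|rN] := leqP N r.
    rewrite (AN r)// add0r /A subn0.
    apply: (le_trans (map_entropy_itinerary_le N mg)).
    by rewrite ler_wpM2r// ler_nat (leq_trans Nr)// ltnW.
  have := map_entropy_split r (N - r) mg; rewrite subnKC ?(ltnW rN)// => sp.
  rewrite /A subn0; apply: (le_trans sp).
  by have := map_entropy_itinerary_le r mg; lra.
have : \sum_(r < M) A 0%N <= \sum_(r < M) (A r + M%:R * ln #|I|%:R).
  by apply: ler_sum => r _; exact: A0r.
rewrite big_split/= !sumr_const !card_ord -[A _ *+ _]mulr_natl -[(_ * _) *+ _]mulr_natl.
have -> : A 0%N = map_entropy m (itinerary f g N) by rewrite /A subn0.
move=> H; apply: (le_trans H); rewrite lerD2r.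
by have := F0 N; rewrite FN addr0.
Qed.

(** Concavity of -(x ln x), cell by cell: each [mn n] is compared with the average [m], and the
    errors [m - mn n] sum to 0 over n. *)
Lemma map_entropy_concave I (g : T -> I) (N : nat) (mn : 'I_N -> set T -> R) :
  (0 < N)%N -> (forall n A, measurable A -> 0 <= mn n A) ->
  (forall A, measurable A -> m A = (\sum_n mn n A) / N%:R) -> finite_measurable g ->
  \sum_n map_entropy (mn n) g <= N%:R * map_entropy m g.
Proof.
move=> N0 mn0 mE mg; rewrite /map_entropy sumrN mulrN lerN2.
rewrite exchange_big/= big_distrr/=; apply: ler_sum => i _.
have NR : N%:R != 0 :> R by rewrite pnatr_eq0 -lt0n.
have s : \sum_n mn n (cell g i) = N%:R * m (cell g i).
  by rewrite mE// mulrCA divff// mulr1.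
rewrite mulrA -s big_distrl/= -subr_le0 -sumrB.
apply: (@le_trans _ _ (\sum_n (m (cell g i) - mn n (cell g i)))).
  apply: ler_sum => n _; rewrite -mulrBr; apply: mul_ln_ge.
  - exact: mn0.
  - by case: hm => + _ _; apply.
  - rewrite mE// => /eqP; rewrite mulf_eq0 invr_eq0 (negbTE NR) orbF.
    rewrite psumr_eq0; last by move=> k _; exact: mn0.
    by move=> /allP /(_ n); rewrite mem_index_enum => /(_ isT) /eqP.
by rewrite sumrB sumr_const card_ord s mulr_natl subrr.
Qed.

Section invariant.
Context (im : forall A, measurable A -> m (f @^-1` A) = m A).

Lemma invariant_iter n A : measurable A -> m (iter n f @^-1` A) = m A.
Proof.
elim: n A => [|n IH] A mA //.
have -> : iter n.+1 f @^-1` A = iter n f @^-1` (f @^-1` A) by [].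
by rewrite IH ?im//; exact: mf.
Qed.

Lemma map_entropy_invariant I (g : T -> I) n : finite_measurable g ->
  map_entropy m (g \o iter n f) = map_entropy m g.
Proof.
move=> mg; rewrite /map_entropy; congr (- _); apply: eq_bigr => i _.
by rewrite cell_comp invariant_iter.
Qed.

Lemma entropy_rate_cvg I (g : T -> I) : finite_measurable g ->
  map_entropy m (itinerary f g n) / n%:R @[n --> \oo] --> entropy_rate m f g.
Proof.
move=> mg.
have [| |l cl _] := @fekete R (fun n => map_entropy m (itinerary f g n)) 0.
- move=> a b; apply: (le_trans (map_entropy_split a b mg)).
  by rewrite map_entropy_invariant//; solve_measurable.
- by move=> n; rewrite mulr0 oppr0; apply: map_entropy_ge0 => //; solve_measurable.
by rewrite /entropy_rate (cvg_lim _ cl).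
Qed.

Lemma entropy_rate_le I J (g : T -> I) (h : T -> J) (c : R) :
  finite_measurable g -> finite_measurable h ->
  (forall n, map_entropy m (itinerary f g n) <=
             map_entropy m (itinerary f h n) + n%:R * c) ->
  entropy_rate m f g <= entropy_rate m f h + c.
Proof.
move=> mg mh H.
have c1 := entropy_rate_cvg mg.
have c2 : map_entropy m (itinerary f h n) / n%:R + c @[n --> \oo] -->
    entropy_rate m f h + c.
  by apply: cvgD; [exact: entropy_rate_cvg | exact: cvg_cst].
apply: (ler_cvg_to c1 c2); near=> n.
have n0 : (0 < n)%N by near: n; exact: nbhs_infty_gt.
have nR : 0 < n%:R :> R by rewrite ltr0n.
rewrite -(@ler_pM2r _ n%:R)// divfK ?gt_eqF// mulrDl divfK ?gt_eqF//.
by rewrite [c * _]mulrC.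
Unshelve. all: by end_near. Qed.

(** The classical bound h(b) <= h(c) + H(b | c), with H(b | c) written as H(b, c) - H(c). By
    induction the conditional entropy of the n-word of [b] given that of [c] is at most n H(b |
    c). *)
Lemma entropy_rate_le_cond I J (b : T -> I) (c : T -> J) :
  finite_measurable b -> finite_measurable c ->
  entropy_rate m f b <= entropy_rate m f c +
    (map_entropy m (fun x => (b x, c x)) - map_entropy m c).
Proof.
move=> mb mc; apply: entropy_rate_le => // n.
pose B := itinerary f b; pose C := itinerary f c.
set D := map_entropy m (fun x => (b x, c x)) - map_entropy m c.
have mB k : finite_measurable (B k) by exact: finite_measurable_itinerary.
have mC k : finite_measurable (C k) by exact: finite_measurable_itinerary.
apply: (@le_trans _ _ (map_entropy m (fun x => (B n x, C n x)))).
  apply: map_entropy_le => //; first by solve_measurable.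
  by move=> x y [].
elim: n => [|n IH].
  rewrite mul0r addr0; apply: map_entropy_le => //; first exact: mC.
  move=> x y _.
  by congr (_, _); apply/itinerary_eq.
pose b' := b \o iter n f; pose c' := c \o iter n f.
have mb' : finite_measurable b' by exact: finite_measurable_iter.
have mc' : finite_measurable c' by exact: finite_measurable_iter.
have mCc : finite_measurable (fun x => (C n x, c' x)) by solve_measurable.
pose h1 := map_entropy m (fun x => (B n x, b' x, (C n x, c' x))).
pose h2 := map_entropy m (fun x => (C n x, c' x)).
pose h3 := map_entropy m (fun x => (B n x, (C n x, c' x))).
pose h4 := map_entropy m (fun x => (b' x, (C n x, c' x))).
pose h5 := map_entropy m (fun x => (B n x, c' x, C n x)).
pose h6 := map_entropy m (fun x => (B n x, C n x)).
pose h7 := map_entropy m (fun x => (c' x, C n x)).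
pose h8 := map_entropy m (fun x => (b' x, C n x, c' x)).
pose h9 := map_entropy m (fun x => (b' x, c' x)).
pose g0 := map_entropy m (C n); pose g1 := map_entropy m (C n.+1).
pose g2 := map_entropy m c'.
(* [s1] separates the old word of [b] from its new symbol, given the word of [c] of length n + 1;
   [s2] and [s3] then drop from the conditions the new symbol of [c] for the former and the old word
   of [c] for the latter. *)
have s1 : h1 + h2 <= h3 + h4 := map_entropy_submodular hm (mB n) mb' mCc.
have s2 : h5 + g0 <= h6 + h7 := map_entropy_submodular hm (mB n) mc' (mC n).
have s3 : h8 + g2 <= h9 + h2 := map_entropy_submodular hm mb' (mC n) mc'.
have e1 : map_entropy m (fun x => (B n.+1 x, C n.+1 x)) <= h1.
  apply: map_entropy_le => //; first by solve_measurable.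
  move=> x y [/itinerary_eq Bn bb /itinerary_eq Cn cc].
  congr (_, _); apply/itinerary_eq => i; rewrite ltnS leq_eqVlt => /orP[/eqP ->//|].
    exact: Bn.
  exact: Cn.
have e2 : h2 <= g1.
  apply: map_entropy_le => //; first exact: mC.
  move=> x y /itinerary_eq H; congr (_, _); last exact: H.
  by apply/itinerary_eq => i ni; apply: H; exact: ltnW.
have e3 : h3 <= h5.
  apply: map_entropy_le => //; last by move=> x y [-> -> ->].
  by solve_measurable.
have e4 : h4 <= h8.
  apply: map_entropy_le => //; last by move=> x y [-> -> ->].
  by solve_measurable.
have e5 : h7 <= h2.
  by apply: map_entropy_le => // x y [-> ->].
have e6 : h9 = map_entropy m (fun x => (b x, c x)).
  by apply: (@map_entropy_invariant _ (fun x => (b x, c x))); solve_measurable.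
have e7 : g2 = map_entropy m c by exact: map_entropy_invariant.
have IH' : h6 <= g0 + n%:R * (h9 - g2) by rewrite e6 e7; exact: IH.
rewrite /D -e6 -e7 -/(C n.+1) -/g1; apply: (le_trans e1).
have -> : n.+1%:R * (h9 - g2) = n%:R * (h9 - g2) + (h9 - g2) by rewrite -natr1; ring.
have e3' : h3 + h4 <= h5 + h8 by exact: lerD.
clearbody h1 h2 h3 h4 h5 h6 h7 h8 h9 g0 g1 g2.
clear -s1 s2 s3 e2 e3 e4 e5 IH' e3'.
move: (n%:R * _) IH' => z IH'; lra.
Qed.

End invariant.
End fixed_additive.
End entropy_rate.

Section entropy_rate_iter.
Set Implicit Arguments.
Unset Strict Implicit.
Context {d : measure_display} {T : measurableType d} {R : realType}.
Local Open Scope ring_scope.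
Context (f : T -> T) (mf : forall A, measurable A -> measurable (f @^-1` A)).
Context (m : set T -> R) (hm : finitely_additive_probability m).
Context (im : forall A, measurable A -> m (f @^-1` A) = m A).

(** A word of length N in the alphabet of n-words is a word of length N n, so the rate under the
    n-th iterate is n times a limit along multiples of n. *)
Lemma entropy_rate_iter (I : finType) (g : T -> I) (n : nat) : (0 < n)%N ->
  finite_measurable g ->
  entropy_rate m (iter n f) (itinerary f g n) = n%:R * entropy_rate m f g.
Proof.
move=> n0 mg.
have nR : n%:R != 0 :> R by rewrite pnatr_eq0 -lt0n.
have mfn A : measurable A -> measurable (iter n f @^-1` A) by exact: measurable_preimage_iter.
have c1 := entropy_rate_cvg mf hm im mg.
have c2 : map_entropy m (itinerary f g (N * n)) / (N * n)%:R @[N --> \oo] -->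
    entropy_rate m f g.
  apply: (cvg_comp _ _ _ c1) => A [k _ kA]; exists k => // N /= kN; apply: kA => /=.
  by rewrite (leq_trans kN)// leq_pmulr.
apply/cvg_lim => //.
have cn : n%:R @[_ --> \oo] --> (n%:R : R) by exact: cvg_cst.
have c3 := cvgM cn c2.
apply: cvg_trans (c3 _).
apply: near_eq_cvg; apply: nearW => N /=.
have -> : map_entropy m (itinerary (iter n f) (itinerary f g n) N) =
    map_entropy m (itinerary f g (N * n)).
  apply: map_entropy_eq => //.
  - by apply: finite_measurable_itinerary => //; exact: finite_measurable_itinerary.
  - exact: finite_measurable_itinerary.
  move=> x y; split.
    move=> /itinerary_eq H; apply/itinerary_eq => i iNn.
    have := H (i %/ n)%N; rewrite ltn_divLR// => /(_ iNn)/itinerary_eq/(_ (i %% n)%N).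
    rewrite ltn_pmod// => /(_ isT).
    by rewrite -!iterM -!iterD addnC -divn_eq.
  move=> /itinerary_eq H; apply/itinerary_eq => j jN; apply/itinerary_eq => i i_n.
  rewrite -!iterM -!iterD; apply: H.
  by rewrite (@leq_trans (j.+1 * n)%N) ?leq_mul2r ?jN ?orbT// mulSn ltn_add2r.
have [->|N0] := eqVneq N 0%N; first by rewrite mul0n !invr0 !mulr0.
rewrite natrM; field.
by rewrite nR pnatr_eq0 N0.
Qed.

End entropy_rate_iter.

(** * Kolmogorov-Sinai entropy in terms of maps to finite types *)

Section kolmogorov_sinai.
Set Implicit Arguments.
Unset Strict Implicit.
Context {d : measure_display} {T : measurableType d} {R : realType}.
Local Open Scope ring_scope.
Context (f : T -> T) (mf : forall A, measurable A -> measurable (f @^-1` A)).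
Context (mu : set T -> \bar R) (hm : finitely_additive_probability (fine \o mu)).
Context (im : forall A, measurable A -> fine (mu (f @^-1` A)) = fine (mu A)).

Lemma entropy_wrt_cell k (g : T -> 'I_k) :
  entropy_wrt mu f (cell g) = entropy_rate (fine \o mu) f g.
Proof.
rewrite /entropy_wrt /entropy_rate; f_equal; f_equal; apply/funext => n.
congr (_ / _); rewrite /partition_entropy /map_entropy; congr (- _).
apply: eq_bigr => a _.
have -> : iterated_join f (cell g) a = cell (itinerary f g n) a; last by [].
apply/seteqP; rewrite /cell /iterated_join; split=> x /= H.
  by apply/ffunP => i; rewrite ffunE.
by move=> i; rewrite -H ffunE.
Qed.

Lemma measurable_partition_cell k (A : 'I_k -> set T) : measurable_partition A ->
  exists2 g : T -> 'I_k, finite_measurable g & A = cell g.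
Proof.
move=> [mA tA cA].
have H x : exists i, A i x.
  have : [set: T] x by []. rewrite -cA => -[i _ Ai]; by exists i.
have [g Hg] := choice H.
have E : A = cell g.
  apply/funext => i; apply/seteqP; rewrite /cell; split=> x /= => [Ai|<-//].
  by apply: (tA (g x) i) => //; exists x; split.
by exists g => // i; rewrite -E.
Qed.

Lemma measurable_partition_of_map k (g : T -> 'I_k) : finite_measurable g ->
  measurable_partition (cell g).
Proof.
move=> mg; split => //.
  by move=> i j _ _ [x []]; rewrite /cell/= => -> ->.
by apply/seteqP; split=> // x _; exists (g x).
Qed.

Lemma entropy_rate_le_ks_entropy (I : finType) (g : T -> I) : finite_measurable g ->
  ((entropy_rate (fine \o mu) f g)%:E <= ks_entropy mu f)%E.
Proof.
(* [ks_entropy] ranges over partitions indexed by ordinals; renaming the cells does not change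
   entropies. *)
move=> mg; pose g' := @enum_rank I \o g.
have mg' : finite_measurable g' by exact: finite_measurable_comp.
have -> : entropy_rate (fine \o mu) f g = entropy_rate (fine \o mu) f g'.
  rewrite /entropy_rate; f_equal; f_equal; apply/funext => n; congr (_ / _).
  apply: map_entropy_eq => //; try exact: finite_measurable_itinerary.
  move=> x y; split=> /itinerary_eq H; apply/itinerary_eq => i i_n.
    by rewrite /g'/= H.
  exact: (enum_rank_inj (H i i_n)).
rewrite -entropy_wrt_cell; apply: ereal_sup_ubound.
by exists #|I|, (cell g'); split => //; exact: measurable_partition_of_map.
Qed.

Lemma ks_entropy_le (c : \bar R) :
  (forall k (g : T -> 'I_k), finite_measurable g ->
     ((entropy_rate (fine \o mu) f g)%:E <= c)%E) -> (ks_entropy mu f <= c)%E.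
Proof.
move=> H; apply: ub_ereal_sup => _ [k [A [pA ->]]].
have [g mg ->] := measurable_partition_cell pA.
by rewrite entropy_wrt_cell; exact: H.
Qed.

End kolmogorov_sinai.

(** * Borel measures on compact metric spaces *)

Section metric_topology.
Set Implicit Arguments.
Unset Strict Implicit.
Context {R : realType}.
Local Open Scope ring_scope.

Lemma mdist_dist_le (X : metricType R) (y x x' : X) :
  `|mdist y x - mdist y x'| <= mdist x x'.
Proof.
rewrite ler_norml; apply/andP; split.
  have := metric_triangle y x x'; lra.
have := metric_triangle y x' x; rewrite (metric_sym x' x); lra.
Qed.

Lemma mdist_continuous (X : metricType R) (y : X) : continuous (mdist y).
Proof.
move=> x; apply/cvgrPdist_lt => e e0.
have : nbhs x (ball x e) by exact: nbhsx_ballx.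
apply: filterS => z; rewrite ballEmdist/= => xz.
exact: le_lt_trans (mdist_dist_le _ _ _) xz.
Qed.

Lemma open_mdist_lt (X : metricType R) (y : X) e : open [set x | mdist y x < e].
Proof.
have -> : [set x | mdist y x < e] = mdist y @^-1` [set r | r < e] by [].
apply: open_comp => [x _|]; [exact: mdist_continuous | exact: open_lt].
Qed.

Lemma closed_mdist_le (X : metricType R) (y : X) e : closed [set x | mdist y x <= e].
Proof.
have -> : [set x | mdist y x <= e] = mdist y @^-1` [set r | r <= e] by [].
apply: closed_comp => [x _|]; [exact: mdist_continuous | exact: closed_le].
Qed.

End metric_topology.

Section borel_measurability.
Set Implicit Arguments.
Unset Strict Implicit.
Context {R : realType}.
Local Open Scope ring_scope.

Lemma measurable_open (X : pmetricType R) (U : set (borel X)) :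
  @open X U -> measurable U.
Proof. exact: sub_sigma_algebra. Qed.

Lemma measurable_closed (X : pmetricType R) (K : set (borel X)) :
  @closed X K -> measurable K.
Proof.
move=> cK; rewrite -[K]setCK; apply: measurableC; apply: measurable_open.
exact: closed_openC.
Qed.

Lemma borel_preimage (X Y : pmetricType R) (p : X -> Y) (A : set (borel Y)) :
  continuous p -> measurable A -> measurable (p @^-1` A : set (borel X)).
Proof.
move=> cp mA.
have : <<s @open Y >> `<=` [set B | measurable (p @^-1` B : set (borel X))].
  apply: smallest_sub.
    split.
    - by rewrite /= preimage_set0; exact: measurable0.
    - move=> B /= mB; rewrite setTD preimage_setC; exact: measurableC.
    - move=> F mF /=; rewrite preimage_bigcup; exact: bigcupT_measurable.
  move=> U oU /=; apply: measurable_open; exact: open_comp.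
exact.
Qed.

Lemma borel_measurable_fun (X : pmetricType R) (f : X -> R) : continuous f ->
  measurable_fun [set: borel X] (f : borel X -> R).
Proof.
move=> cf; apply: (measurability (@measurable_realfun.RGenOpens.G R)).
  exact: measurable_realfun.RGenOpens.measurableE.
move=> _ [_ [a [b ->]] <-]; rewrite setTI; apply: measurable_open.
by apply: open_comp => [x _|]; [exact: cf | exact: interval_open].
Qed.

End borel_measurability.

(** * Inner regularity by closed sets *)

Section closed_regularity.
Set Implicit Arguments.
Unset Strict Implicit.
Context {R : realType} (X : pmetricType R) (mu : probability (borel X) R).
Local Open Scope ring_scope.

Lemma open_bigcup_closed (U : set X) : open U -> exists K : (set X)^nat,
  [/\ forall n, closed (K n), {homo K : n m / (n <= m)%N >-> n `<=` m} &
      \bigcup_n K n = U].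
Proof.
(* The points at distance at least 1/(n+1) from the complement of [U]. *)
move=> oU; pose K n := ~` (\bigcup_(y in ~` U) ball y (n.+1%:R^-1 : R)).
exists K; split.
- move=> n; apply: open_closedC; apply: bigcup_open => y _.
  by rewrite ballEmdist; exact: open_mdist_lt.
- move=> n m nm; apply: subsetC => x [y Uy xy]; exists y => //.
  apply: le_ball xy; by rewrite lef_pV2 ?posrE// ler_nat.
- apply/seteqP; split=> [x [n _ Kx]|x Ux].
    apply: contrapT => nUx; apply: Kx; exists x => //.
    exact: ballxx.
  have : nbhs x U by move: oU; rewrite openE => /(_ x Ux).
  rewrite -nbhs_ballE => -[e /= e0 xeU].
  have [n ne] : exists n, n.+1%:R^-1 < e.
    by have := ltr_add_invr e0 => -[n]; rewrite add0r; exists n.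
  exists n => // -[y nUy /ball_sym xy]; apply: nUy; apply: xeU.
  by apply: le_ball xy; exact: ltW.
Qed.

(** Approximation from both sides is preserved by complements, so these sets form a sigma-algebra;
    approximation by closed sets alone would not visibly do so. *)
Let approximable (A : set (borel X)) := forall e, 0 < e ->
  exists K U : set X, [/\ closed K, open U, K `<=` A, A `<=` U &
    (mu (U `\` K) <= e%:E)%E].

Let approximable_open (U : set X) : open U -> approximable U.
Proof.
move=> oU e e0; have [K [cK ndK KU]] := open_bigcup_closed oU.
have mK n : measurable (K n : set (borel X)) by exact: measurable_closed.
have mU : measurable (U : set (borel X)) by exact: measurable_open.
have c : (mu \o (fun n => U `\` K n : set (borel X))) @ \oo -->
    mu (\bigcap_n (U `\` K n : set (borel X))).
  apply: nonincreasing_cvg_mu.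
  - by rewrite (le_lt_trans (probability_le1 _ _))// ?ltry//; exact: measurableD.
  - by move=> n; exact: measurableD.
  - by apply: bigcapT_measurable => n; exact: measurableD.
  - by move=> n m nm; apply/subsetPset; apply: setDS; exact: ndK.
have b0 : \bigcap_n (U `\` K n) = set0.
  apply/seteqP; split=> // x H; have [] := H 0%N I; rewrite -{1}KU => -[n _ Kn] _.
  by have [] := H n I.
rewrite b0 measure0 in c.
have : \forall n \near \oo, (mu (U `\` K n) < e%:E)%E.
  have e0' : (0 < e%:E)%E by rewrite lte_fin.
  exact: (c [set y | (y < e%:E)%E] (open_ereal_lt' e0')).
move=> [n _ /(_ n (leqnn n)) /= H].
by exists (K n), U; split=> //; [rewrite -KU; exact: bigcup_sup | exact: ltW].
Qed.

Let approximable_sigma : sigma_algebra setT approximable.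
Proof.
split.
- move=> e e0; exists set0, set0; split=> //; first exact: closed0.
    exact: open0.
  by rewrite setD0 measure0 lee_fin ltW.
- move=> A aA e e0; have [K [U [cK oU KA AU H]]] := aA e e0.
  exists (~` U), (~` K); split.
  + exact: open_closedC.
  + exact: closed_openC.
  + by rewrite setTD; exact: subsetC.
  + by rewrite setTD; exact: subsetC.
  + by rewrite setDE setCK setIC -setDE.
- move=> F aF e e0.
  (* One half of [e] pays for all the separate errors; the other half pays for cutting the union of
     the closed sets down to a finite one, which is again closed. *)
  have en n : 0 < (e / 2) / (2 ^ n.+1)%:R :> R by rewrite !divr_gt0// ltr0n expn_gt0.
  have H n := aF n _ (en n).
  have [K HK] := choice H; have {H} [U HU] := choice HK.
  have cK n : closed (K n) by case: (HU n).
  have oU n : open (U n) by case: (HU n).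
  have mK n : measurable (K n : set (borel X)) by exact: measurable_closed.
  have mU n : measurable (U n : set (borel X)) by exact: measurable_open.
  pose V : set (borel X) := \bigcup_n U n.
  pose L n : set (borel X) := \big[setU/set0]_(i < n) K i.
  have mV : measurable V by exact: bigcupT_measurable.
  have mL n : measurable (L n) by exact: bigsetU_measurable.
  have c : (mu \o (fun n => V `\` L n)) @ \oo --> mu (\bigcap_n (V `\` L n)).
    apply: nonincreasing_cvg_mu.
    - by rewrite (le_lt_trans (probability_le1 _ _))// ?ltry//; exact: measurableD.
    - by move=> n; exact: measurableD.
    - by apply: bigcapT_measurable => n; exact: measurableD.
    - move=> n m nm; apply/subsetPset; apply: setDS; exact: subset_bigsetU.
  have le : (mu (\bigcap_n (V `\` L n)) <= (e / 2)%:E)%E.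
    apply: (@le_trans _ _ (\sum_(0 <= n <oo) mu (U n `\` K n))%E).
      apply: measure_sigma_subadditive.
      - by move=> n; exact: measurableD.
      - by apply: bigcapT_measurable => n; exact: measurableD.
      - move=> x Hx; have [[n _ Un] _] := Hx 0%N I.
        exists n => //; split => // Kn; have [_] := Hx n.+1 I; apply.
        by rewrite /L big_ord_recr/=; right.
    apply: (@le_trans _ _ (\sum_(0 <= n <oo) (e / 2 / (2 ^ n.+1)%:R)%:E)%E).
      by apply: lee_nneseries => n *//; case: (HU n).
    by apply: epsilon_trick0; rewrite divr_ge0// ltW.
  have : \forall n \near \oo, (mu (V `\` L n) < e%:E)%E.
    suff e0' : (mu (\bigcap_n (V `\` L n)) < e%:E)%E.
      exact: (c [set y | (y < e%:E)%E] (open_ereal_lt' e0')).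
    apply: (le_lt_trans le); rewrite lte_fin.
    by rewrite ltr_pdivrMr// ltr_pMr// ltr1n.
  move=> [n _ /(_ n (leqnn n)) /= Hn].
  exists (L n), V; split=> //; last exact: ltW.
  + by apply: closed_bigsetU => i _; exact: cK.
  + exact: bigcup_open.
  + rewrite /L -bigcup_mkord => x [i _ Ki]; exists i => //.
    by case: (HU i) => _ _ + _ _; apply.
  + by move=> x [i _ Fi]; exists i => //; case: (HU i) => _ _ _ + _; apply.
Qed.

Lemma closed_inner_regularity (A : set (borel X)) (e : R) : measurable A -> 0 < e ->
  exists K : set X, [/\ closed K, K `<=` A & (mu (A `\` K) <= e%:E)%E].
Proof.
move=> mA e0; have : approximable A.
  by apply: (smallest_sub approximable_sigma _ mA) => U; exact: approximable_open.
move=> /(_ e e0) [K [U [cK oU KA AU H]]]; exists K; split => //.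
apply: (le_trans _ H); apply: le_measure; rewrite ?inE.
- by apply: measurableD => //; exact: measurable_closed.
- by apply: measurableD; [exact: measurable_open|exact: measurable_closed].
- exact: setSD.
Qed.

End closed_regularity.

(** * From a finitely additive charge to a Borel probability *)

Section regular_borel_extension.
Set Implicit Arguments.
Unset Strict Implicit.
Context {R : realType} (X : pmetricType R) (cX : compact [set: X]).
Local Open Scope ring_scope.
Context (nu : set X -> R) (nu0 : forall A, 0 <= nu A) (nuT : nu setT = 1).
Context (nuU : forall A B, A `&` B = set0 -> nu (A `|` B) = nu A + nu B).
Local Open Scope ereal_scope.

Let nu_le A B : A `<=` B -> (nu A <= nu B)%R.
Proof.
move=> AB; rewrite -(setDUK AB) nuU ?lerDl//.
by rewrite setDE setICA setICr setI0.
Qed.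

Let nu_set0 : nu set0 = 0%R.
Proof.
have := @nuU set0 set0 (setI0 _).
by rewrite setU0 => /eqP; rewrite -subr_eq0 opprD addrA subrr sub0r oppr_eq0 => /eqP.
Qed.

Let nuU_le A B : (nu (A `|` B) <= nu A + nu B)%R.
Proof.
have -> : A `|` B = A `|` (B `\` A).
  by apply/seteqP; split=> x [Ax|]; [by left|by case: (pselect (A x)); [left|right]
    |by left|by case; right].
rewrite nuU; last by rewrite setDE setICA setICr setI0.
by rewrite lerD2l nu_le//; exact: subIsetl.
Qed.

(* On open sets the measure is the inner content by closed sets; it is extended
   to all Borel sets by the Caratheodory construction. *)
Let inner (U : set X) : \bar R :=
  ereal_sup [set (nu K)%:E | K in [set K | closed K /\ K `<=` U]].

Let outer (A : set X) : \bar R :=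
  ereal_inf [set inner U | U in [set U | open U /\ A `<=` U]].

Let inner_ub K U : closed K -> K `<=` U -> (nu K)%:E <= inner U.
Proof. by move=> cK KU; apply: ereal_sup_ubound; exists K. Qed.

Let inner_le U V : U `<=` V -> inner U <= inner V.
Proof.
by move=> UV; apply: ge_ereal_sup => _ [K [cK KU] <-]; apply: inner_ub => // x /KU/UV.
Qed.

Let inner_ge0 U : 0 <= inner U.
Proof. apply: (@le_trans _ _ (nu set0)%:E); first by rewrite nu_set0.
by apply: inner_ub => //; exact: closed0. Qed.

Let inner_nu U : inner U <= (nu U)%:E.
Proof. by apply: ge_ereal_sup => _ [K [cK KU] <-]; rewrite lee_fin nu_le. Qed.

Let outer_lb A U : open U -> A `<=` U -> outer A <= inner U.
Proof. by move=> oU AU; apply: ereal_inf_lbound; exists U. Qed.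

Let outer_open U : open U -> outer U = inner U.
Proof.
move=> oU; apply/eqP; rewrite eq_le outer_lb//=.
by apply: le_ereal_inf_tmp => _ [V [oV UV] <-]; exact: inner_le.
Qed.

Let outer_ge0 A : 0 <= outer A.
Proof. by apply: le_ereal_inf_tmp => _ [U _ <-]; exact: inner_ge0. Qed.

Let outer_le : {homo outer : A B / A `<=` B >-> A <= B}.
Proof.
move=> A B AB; apply: le_ereal_inf_tmp => _ [U [oU BU] <-].
by apply: outer_lb => // x /AB/BU.
Qed.

Let outer_fin A : outer A \is a fin_num.
Proof.
rewrite ge0_fin_numE//; apply: (le_lt_trans (y := inner setT)).
  by apply: outer_lb => //; exact: openT.
by rewrite (le_lt_trans (inner_nu _))// ltry.
Qed.

(** [K] minus [U] and [K] minus [V] are disjoint closed sets. Normality gives them disjoint open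
    neighbourhoods, and removing one or the other from [K] leaves the two pieces. *)
Let closed_split (K U V : set X) : closed K -> open U -> open V -> K `<=` U `|` V ->
  exists K1 K2, [/\ closed K1, closed K2, K1 `<=` U, K2 `<=` V & K = K1 `|` K2].
Proof.
move=> cK oU oV KUV.
have nX := compact_normal (@metric_hausdorff _ X) cX.
have := (@normal_openP R X).1 nX (K `\` U) (K `\` V).
have cD W : open W -> closed (K `\` W).
  by move=> oW; rewrite setDE; apply: closedI => //; exact: open_closedC.
case => //; [exact: cD|exact: cD| |].
  apply/seteqP; split=> // x [[Kx nU] [_ nV]].
  by case: (KUV x Kx).
move=> W1 [W2 [oW1 oW2 KW1 KW2 W12]].
exists (K `\` W1), (K `\` W2); split; [exact: cD|exact: cD|..].
- by move=> x [Kx nW]; apply: contrapT => nU; apply: nW; apply: KW1.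
- by move=> x [Kx nW]; apply: contrapT => nU; apply: nW; apply: KW2.
- apply/seteqP; split=> [x Kx|x [[]|[]]//].
  case: (pselect (W1 x)) => W1x; last by left.
  right; split=> // W2x; suff : set0 x by []. by rewrite -W12.
Qed.

Let innerU U V : open U -> open V -> inner (U `|` V) <= inner U + inner V.
Proof.
move=> oU oV; apply: ge_ereal_sup => _ [K [cK KUV] <-].
have [K1 [K2 [c1 c2 K1U K2V ->]]] := closed_split cK oU oV KUV.
apply: (@le_trans _ _ ((nu K1)%:E + (nu K2)%:E)).
  by rewrite -EFinD lee_fin nuU_le.
by apply: leeD; apply: inner_ub.
Qed.

(** Here compactness turns finite into countable subadditivity: a closed set inside the union is
    compact, hence inside a finite subunion. *)
Let inner_bigcup (U : (set X)^nat) : (forall n, open (U n)) ->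
  inner (\bigcup_n U n) <= \sum_(0 <= n <oo) inner (U n).
Proof.
move=> oU; apply: ge_ereal_sup => _ [K [cK KU] <-].
have : compact K by apply: (subclosed_compact cK cX).
rewrite compact_cover => /(_ nat setT U).
case=> [n _|//|D _ KD]; first exact: oU.
pose m := (\max_(i <- finmap.enum_fset D) i).+1.
have KM : K `<=` \big[setU/set0]_(i < m) U i.
  move=> x /KD [i iD Ux]; rewrite -bigcup_mkord; exists i => //=.
  by rewrite ltnS; apply: (@leq_bigmax_seq _ (finmap.enum_fset D) xpredT id).
apply: (@le_trans _ _ (inner (\big[setU/set0]_(i < m) U i))); first exact: inner_ub.
apply: (@le_trans _ _ (\sum_(i < m) inner (U i))); last first.
  rewrite -(big_mkord xpredT (fun i => inner (U i))).
  by apply: nneseries_lim_ge.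
elim: m {KM} => [|m IH].
  by rewrite !big_ord0 (le_trans (inner_nu _))// nu_set0.
rewrite !big_ord_recr/=; apply: le_trans (innerU _ _) _ => //.
- by rewrite -bigcup_mkord; apply: bigcup_open => i _; exact: oU.
- exact: leeD.
Qed.

Let outer0 : outer set0 = 0.
Proof.
apply/eqP; rewrite eq_le outer_ge0 andbT.
by rewrite outer_open ?(le_trans (inner_nu _)) ?nu_set0//; exact: open0.
Qed.

Let outer_sigma_subadditive : sigma_subadditive outer.
Proof.
move=> F; apply/lee_addgt0Pr => e e0.
apply: (le_trans _ (epsilon_trick xpredT _ (ltW e0))) => //.
have H n : exists U, [/\ open U, F n `<=` U &
    inner U <= outer (F n) + (e / (2 ^ n.+1)%:R)%:E].
  have en : (0 < e / (2 ^ n.+1)%:R :> R)%R by rewrite !divr_gt0// ltr0n expn_gt0.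
  have [_ [U [oU FU] <-] H] := lb_ereal_inf_adherent en (outer_fin (F n)).
  by exists U; split => //; exact: ltW.
have [U HU] := choice H.
apply: (@le_trans _ _ (inner (\bigcup_n U n))).
  apply: outer_lb; first by apply: bigcup_open => n _; case: (HU n).
  by move=> x [n _ Fx]; exists n => //; case: (HU n) => _ + _; apply.
apply: (le_trans (inner_bigcup _)); first by move=> n; case: (HU n).
by apply: lee_nneseries => n *//; case: (HU n).
Qed.

Let outer_measure_outer : {outer_measure set X -> \bar R} :=
  HB.pack_for {outer_measure set X -> \bar R} outer
    (@isOuterMeasure.Build R X outer outer0 outer_ge0 outer_le outer_sigma_subadditive).

(** For open [W] containing [A], take a closed [K1] in [W] meet [U], then a closed [K2] in [W] minus
    [K1]; the latter contains the part of [A] outside [U]. The two are disjoint, so [nu K1 + nu K2]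
    is the charge of a closed subset of [W]. *)
Let caratheodory_open U : open U -> outer_measure_outer.-caratheodory U.
Proof.
move=> oU; apply: le_caratheodory_measurable => A /=.
change (outer (A `&` U) + outer (A `&` ~` U) <= outer A).
apply: le_ereal_inf_tmp => _ [W [oW AW] <-].
have oWU : open (W `&` U) by exact: openI.
apply: (@le_trans _ _ (inner (W `&` U) + outer (A `&` ~` U))).
  by apply: leeD => //; apply: outer_lb => //; exact: setSI.
rewrite -leeBrDr//.
apply: ge_ereal_sup => _ [K1 [cK1 K1W] <-].
rewrite leeBrDr// addeC -leeBrDr//.
have oD : open (W `\` K1) by rewrite setDE; apply: openI => //; exact: closed_openC.
apply: (@le_trans _ _ (inner (W `\` K1))).
  apply: outer_lb => // x [Ax nUx]; split; first exact: AW.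
  by move=> /K1W [].
apply: ge_ereal_sup => _ [K2 [cK2 K2W] <-].
rewrite leeBrDr// -EFinD addrC -nuU.
  by apply: inner_ub; [exact: closedU | move=> x [/K1W[]//|/K2W[]]].
by apply/seteqP; split=> // x [K1x /K2W [_]].
Qed.

Let caratheodory_borel : <<s @open X >> `<=` outer_measure_outer.-caratheodory.
Proof.
apply: smallest_sub; last exact: caratheodory_open.
split.
- exact: caratheodory_measurable_set0.
- by move=> A cA; rewrite setTD; exact: caratheodory_measurable_setC.
- exact: caratheodory_measurable_bigcup.
Qed.

Let borel_outer : set (borel X) -> \bar R := outer.

Let borel_outer_sigma_additive : semi_sigma_additive borel_outer.
Proof.
move=> F mF tF mbF.
apply: (@caratheodory_measure_sigma_additive R X outer_measure_outer) => //.
- by move=> n; exact: caratheodory_borel (mF n).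
- exact: caratheodory_borel mbF.
Qed.

(** The opposite inequalities on closed and on open sets determine the charge of a set with null
    boundary. The last clause recovers [mu] on open sets from [nu], which is how invariance is
    transferred. *)
Lemma regular_borel_extension : exists mu : probability (borel X) R,
  [/\ forall K : set X, closed K -> (nu K)%:E <= mu K,
      forall U : set X, open U -> mu U <= (nu U)%:E &
      forall U : set X, open U ->
        mu U = ereal_sup [set (nu K)%:E | K in [set K | closed K /\ K `<=` U]]].
Proof.
have oT : borel_outer setT = 1.
  rewrite /borel_outer outer_open; last exact: openT.
  apply/eqP; rewrite eq_le (le_trans (inner_nu _)) ?nuT//=.
  by rewrite -nuT; apply: inner_ub => //; exact: closedT.
pose M := HB.pack_for (measure (borel X) R) borel_outer
  (@isMeasure.Build _ (borel X) R borel_outer outer0 outer_ge0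
    borel_outer_sigma_additive).
pose P := HB.pack_for (probability (borel X) R) (Measure.sort M)
  (@Measure_isProbability.Build _ (borel X) R M oT).
exists P; split.
- move=> K cK; change ((nu K)%:E <= outer K).
  by apply: le_ereal_inf_tmp => _ [U [oU KU] <-]; exact: inner_ub.
- move=> U oU; change (outer U <= (nu U)%:E); by rewrite outer_open.
- by move=> U oU; change (outer U = inner U); rewrite outer_open.
Qed.

End regular_borel_extension.

(** * Limits along ultrafilters and sets with null boundary *)

Section ultrafilter_limits.
Set Implicit Arguments.
Unset Strict Implicit.
Context {R : realType} {T : Type} (F : set_system T) (uF : UltraFilter F).
Local Open Scope ring_scope.

(** Compactness of the segment gives the image ultrafilter a cluster point, and an ultrafilter
    converges to its cluster points. *)
Lemma ultrafilter_bounded_cvg (u : T -> R) (a b : R) :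
  (forall t, a <= u t <= b) -> exists l : R, u @ F --> l.
Proof.
move=> uab.
have pF : ProperFilter (u @ F) by exact: fmap_proper_filter.
have Fab : (u @ F) `[a, b]%classic.
  by apply: (@filterS _ F _ setT) => [t _|]; [rewrite /= in_itv/= uab | exact: filterT].
have [l [_ cl]] := segment_compact pF Fab.
exists l => V Vl.
have [//|FV] := in_ultra_setVsetC (u @^-1` V) uF.
have [x [nV Vx]] := cl (~` V) V FV Vl; by [].
Qed.

End ultrafilter_limits.

Section entropy_limit.
Set Implicit Arguments.
Unset Strict Implicit.
Context {R : realType} {T : Type} (F : set_system T) {pF : ProperFilter F}.
Local Open Scope ring_scope.

(** The case at stake is the limit 0, where [ln] is discontinuous but x ln x still tends to 0. *)
Lemma cvg_mul_ln (u : T -> R) (l : R) : (forall t, 0 <= u t) -> u @ F --> l ->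
  u t * ln (u t) @[t --> F] --> l * ln l.
Proof.
move=> u0 ul.
have l0 : 0 <= l.
  have /cvgP cu := ul; rewrite -(cvg_lim _ ul)//; apply: limr_ge => //.
  exact: nearW.
have [l00|ln0] := eqVneq l 0; last first.
  have lgt0 : 0 < l by rewrite lt_neqAle eq_sym ln0.
  by apply: cvgM => //; apply: continuous_cvg => //; exact: continuous_ln.
rewrite l00 mul0r; apply/cvgr0Pnorm_le => e e0.
have [d d0 Hd] := entropy_term_small e0.
have dm : 0 < Num.min d 1 by rewrite lt_min d0 ltr01.
rewrite l00 in ul; move/cvgr0Pnorm_le : ul => /(_ _ dm).
apply: filterS => t; rewrite ger0_norm// le_min => /andP[ud u1].
rewrite ler0_norm; first by apply: Hd; rewrite u0.
by rewrite -oppr_ge0 entropy_term_ge0// u0.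
Qed.

Lemma cvg_bigsum (I : Type) (s : seq I) (f : I -> T -> R) (l : I -> R) :
  (forall i, f i t @[t --> F] --> l i) ->
  \sum_(i <- s) f i t @[t --> F] --> \sum_(i <- s) l i.
Proof.
move=> fl; elim: s => [|i s IH].
  by under eq_fun do rewrite big_nil; rewrite big_nil; exact: cvg_cst.
by under eq_fun do rewrite big_cons; rewrite big_cons; exact: cvgD.
Qed.

Lemma cvg_map_entropy (d : measure_display) (X : measurableType d) (I : finType)
    (g : X -> I) (mn : T -> set X -> R) (m : set X -> R) :
  (forall t i, 0 <= mn t (cell g i)) ->
  (forall i, mn t (cell g i) @[t --> F] --> m (cell g i)) ->
  map_entropy (mn t) g @[t --> F] --> map_entropy m g.
Proof.
move=> m0 cm; apply: cvgN.
apply: (cvg_bigsum (f := fun i t => mn t (cell g i) * ln (mn t (cell g i)))) => i.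
exact: cvg_mul_ln.
Qed.

End entropy_limit.

Section continuity_sets.
Set Implicit Arguments.
Unset Strict Implicit.
Context {R : realType} (X : pmetricType R) (mu : probability (borel X) R).
Local Open Scope ereal_scope.

(* Equivalently, the boundary of A is mu-null. *)
Definition continuity_set (A : set X) := exists K U : set X,
  [/\ closed K, open U, U `<=` A, A `<=` K & mu (K `\` U) = 0].

Let mnull (K U : set X) : closed K -> open U -> measurable (K `\` U : set (borel X)).
Proof. by move=> cK oU; apply: measurableD; [exact: measurable_closed|exact: measurable_open]. Qed.

Lemma continuity_setC A : continuity_set A -> continuity_set (~` A).
Proof.
move=> [K [U [cK oU UA AK m0]]]; exists (~` U), (~` K); split.
- exact: open_closedC.
- exact: closed_openC.
- exact: subsetC.
- exact: subsetC.
- by rewrite setDE setCK setIC -setDE.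
Qed.

Lemma continuity_setT : continuity_set setT.
Proof.
exists setT, setT; split; [exact: closedT|exact: openT|by []|by []|].
by rewrite setDv measure0.
Qed.

Lemma continuity_setI A B : continuity_set A -> continuity_set B ->
  continuity_set (A `&` B).
Proof.
move=> [K [U [cK oU UA AK m0]]] [K' [U' [cK' oU' UA' AK' m0']]].
exists (K `&` K'), (U `&` U'); split.
- exact: closedI.
- exact: openI.
- exact: setISS.
- exact: setISS.
- apply/eqP; rewrite -measure_le0.
  apply: (@le_trans _ _ (mu ((K `\` U) `|` (K' `\` U')))).
    apply: le_measure; rewrite ?inE.
    + by apply: mnull; [exact: closedI|exact: openI].
    + by apply: measurableU; exact: mnull.
    + move=> x [[Kx K'x] nUU']; case: (pselect (U x)) => Ux; last by left.
      by right; split=> // U'x; apply: nUU'.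
  apply: le_trans (measureU2 mu (mnull cK oU) (mnull cK' oU')) _.
  rewrite -[leRHS]adde0; apply: leeD; first exact: (eq_ind_r (fun z => z <= 0) (lexx 0) m0).
  exact: (eq_ind_r (fun z => z <= 0) (lexx 0) m0').
Qed.

Lemma continuity_set_bigsetI (n : nat) (A : 'I_n -> set X) :
  (forall i, continuity_set (A i)) -> continuity_set (\big[setI/setT]_i A i).
Proof.
by move=> H; apply: big_ind => //; [exact: continuity_setT|exact: continuity_setI].
Qed.

(** Both values are squeezed: [nu A <= nu K <= mu K <= mu U <= nu U <= nu A], and [mu A] lies
    between [mu U] and [mu K]. *)
Lemma continuity_set_eq (nu : set X -> R) (A : set (borel X)) :
  (forall A B, A `<=` B -> (nu A <= nu B)%R) ->
  (forall K : set X, closed K -> (nu K)%:E <= mu K) ->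
  (forall U : set X, open U -> mu U <= (nu U)%:E) ->
  measurable A -> continuity_set A -> nu A = fine (mu A).
Proof.
move=> nule nuK nuU mA [K [U [cK oU UA AK m0]]].
have mK : measurable (K : set (borel X)) by exact: measurable_closed.
have mU : measurable (U : set (borel X)) by exact: measurable_open.
have KU : mu K <= mu U.
  have -> : K = U `|` (K `\` U) by rewrite setDUK//; exact: subset_trans UA AK.
  apply: le_trans (measureU2 mu mU (mnull cK oU)) _.
  rewrite -[leRHS]adde0; apply: leeD => //.
  exact: (eq_ind_r (fun z => z <= 0) (lexx 0) m0).
have E : (nu A)%:E = mu A.
  apply/eqP; rewrite eq_le; apply/andP; split.
    apply: (@le_trans _ _ (nu K)%:E); first by rewrite lee_fin nule.
    apply: (le_trans (nuK _ cK)); apply: (le_trans KU).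
    by apply: le_measure; rewrite ?inE.
  apply: (@le_trans _ _ (mu K)); first by apply: le_measure; rewrite ?inE.
  apply: (le_trans KU); apply: (le_trans (nuU _ oU)).
  by rewrite lee_fin nule.
by rewrite -E.
Qed.

Section invariant.
Context (T : X -> X) (cT : continuous T).
Context (iT : forall A : set (borel X), measurable A -> mu (T @^-1` A) = mu A).

Lemma continuity_set_preimage A : continuity_set A -> continuity_set (T @^-1` A).
Proof.
move=> [K [U [cK oU UA AK m0]]]; exists (T @^-1` K), (T @^-1` U); split.
- by apply: closed_comp => // x _; exact: cT.
- by apply: open_comp => // x _; exact: cT.
- exact: preimage_subset.
- exact: preimage_subset.
- by rewrite -[_ `\` _]/(T @^-1` (K `\` U)) iT//; exact: mnull.
Qed.

Lemma continuity_set_iter n A : continuity_set A -> continuity_set (iter n T @^-1` A).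
Proof.
elim: n A => [|n IH] A cA //.
have -> : iter n.+1 T @^-1` A = iter n T @^-1` (T @^-1` A) by [].
exact/IH/continuity_set_preimage.
Qed.

Lemma continuity_set_itinerary (I : finType) (g : borel X -> I) n a :
  (forall i, continuity_set (cell g i)) ->
  continuity_set (cell (itinerary (T : borel X -> borel X) g n) a).
Proof.
move=> cg; rewrite (_ : cell _ _ = \big[setI/setT]_(i < n) 
    (iter i T @^-1` cell g (a i) : set (borel X))).
  apply: (@continuity_set_bigsetI n (fun i => iter i T @^-1` cell g (a i))) => i.
  exact: continuity_set_iter.
rewrite -bigcap_seq; apply/seteqP; rewrite /cell; split=> x /=.
  by move=> <- i _ /=; rewrite ffunE.
move=> H; apply/ffunP => i; rewrite ffunE; apply: H => /=.
by rewrite mem_index_enum.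
Qed.

End invariant.
End continuity_sets.

(** * Fine partitions into sets with null boundary *)

Section null_levels.
Set Implicit Arguments.
Unset Strict Implicit.
Local Open Scope ring_scope.

(** Only countably many values of [h] carry positive mass, whereas the interval from 0 to [e] is not
    Lebesgue-null. *)
Lemma null_level {R : realType} (d : measure_display) (T : measurableType d)
    (P : probability T R) (h : T -> R) (e : R) : measurable_fun setT h -> 0 < e ->
  exists r, [/\ 0 < r, r < e & P (h @^-1` [set r]) = 0%E].
Proof.
move=> mh e0.
pose H := HB.pack_for {mfun T >-> R} h (@isMeasurableFun.Build _ _ T R h mh).
have cH := pmf_gt0_countable (P := P) H.
apply: contrapT => nr.
have sub : `]0, e[%classic `<=` [set r | 0 < pmf (P := P) H r].
  move=> r; rewrite /= in_itv/= => /andP[r0 re]; rewrite lt_neqAle fine_ge0// andbT.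
  apply/negP => /eqP p0; apply: nr; exists r; split=> //.
  have mr : measurable (h @^-1` [set r]) by rewrite -[X in measurable X]setTI; exact: (mh).
  by rewrite -(fineK (fin_num_measure P _ mr)) -[fine _]p0.
have := countable_lebesgue_measure0 (sub_countable (subset_card_le sub) cH).
rewrite lebesgue_measure_itv/= lte_fin e0 sube0 => /eqP.
by rewrite eqe gt_eqF.
Qed.

(** The cells are the atoms of the algebra generated by a finite cover by balls of radius below e /
    2 whose spheres have null preimage. With [p] the identity this partitions X itself; with [p] the
    factor map it partitions Y into sets whose preimages are continuity sets for a measure on X. *)
Lemma small_continuity_partition {R : realType} (X Y : pmetricType R)
    (mu : probability (borel X) R) (p : X -> Y) (e : R) :
  compact [set: Y] -> continuous p -> 0 < e ->
  exists (I : finType) (g : borel Y -> I), [/\ finite_measurable g,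
    forall y y' : Y, g y = g y' -> mdist y y' < e &
    forall i, continuity_set mu (p @^-1` (cell g i))].
Proof.
move=> cY cp e0.
have H (y : Y) : exists r, [/\ 0 < r, r < e / 2 &
    mu ((mdist y \o p : borel X -> R) @^-1` [set r]) = 0%E].
  apply: null_level; last by rewrite divr_gt0.
  apply: borel_measurable_fun => x.
  by apply: continuous_comp; [exact: cp|exact: mdist_continuous].
have [r Hr] := choice H.
pose B y := [set z | mdist y z < r y].
have : compact [set: Y] by [].
rewrite compact_cover => /(_ Y setT B).
case=> [y _|y _|D _ DB]; first exact: open_mdist_lt.
  by exists y => //; rewrite /B/= mdistxx; case: (Hr y).
set s := finmap.enum_fset D.
pose g (y : borel Y) : {ffun 'I_(size s) -> bool} :=
  [ffun j : 'I_(size s) => mdist (nth point s j) y < r (nth point s j)].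
have mB y : measurable (B y : set (borel Y)).
  by apply: measurable_open; exact: open_mdist_lt.
have gE a : cell g a = \big[setI/setT]_(j < size s)
    (if a j then B (nth point s j) else ~` B (nth point s j)).
  rewrite -bigcap_seq; apply/seteqP; rewrite /cell; split=> y /=.
    by move=> <- j _; rewrite ffunE; case: ifPn => // /negP.
  move=> H1; apply/ffunP => j; have := H1 j (mem_index_enum j); rewrite ffunE.
  by case: ifPn => // _ nB; apply/negP.
exists {ffun 'I_(size s) -> bool}, g; split.
- move=> a; rewrite gE.
  have mI : forall (x y : set (borel Y)), measurable x -> measurable y -> measurable (x `&` y).
    by move=> x y; exact: measurableI.
  apply: (big_ind (fun A : set (borel Y) => measurable A)) => // j _.
  by case: ifP => _ //; exact: measurableC.
- move=> y y' gy.
  have [z zD zy] := DB y I.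
  have zs : (index z s < size s)%N by rewrite index_mem.
  have := congr1 (fun a : {ffun 'I_(size s) -> bool} => a (Ordinal zs)) gy.
  rewrite /g !ffunE/= nth_index//.
  rewrite /B/= in zy; rewrite zy => /esym zy'.
  have [_ re _] := Hr z.
  have := metric_triangle y z y'; rewrite (metric_sym y z); lra.
- move=> a.
  have cB y : continuity_set mu (p @^-1` B y).
    have [r0 re m0] := Hr y.
    exists (p @^-1` [set z | mdist y z <= r y]), (p @^-1` B y); split=> //.
    + by apply: closed_comp => [x _|]; [exact: cp|exact: closed_mdist_le].
    + by apply: open_comp => [x _|]; [exact: cp|exact: open_mdist_lt].
    + by move=> x /=; rewrite /B/=; exact: ltW.
    + rewrite -m0; congr (mu _); apply/seteqP; split=> x /=.
        by rewrite /B/= => -[le /negP]; rewrite -leNgt => ge; apply/eqP; rewrite eq_le le ge.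
      by rewrite /B/= => ->; rewrite lexx ltxx; split.
  rewrite gE (_ : _ @^-1` _ = \big[setI/setT]_(j < size s)
    (if a j then p @^-1` B (nth point s j) else ~` (p @^-1` B (nth point s j)))).
    apply: continuity_set_bigsetI => j; case: ifP => _ //.
    exact: continuity_setC.
  rewrite -!bigcap_seq preimage_bigcap; apply: eq_bigcapr => j _.
  by case: ifP.
Qed.

End null_levels.

(** * Invariance tested on open sets *)

Section invariance.
Set Implicit Arguments.
Unset Strict Implicit.
Context {R : realType} (X : pmetricType R) (mu : probability (borel X) R).
Local Open Scope ereal_scope.

(** Complements turn the hypothesis into the reverse inequality on closed sets, and exhausting an
    open set by closed ones gives equality on open, hence on closed sets. Inner regularity spreads
    one inequality to all Borel sets; applied to the complement it gives the other. *)
Lemma invariant_of_open (T : X -> X) : continuous T ->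
  (forall U : set X, open U -> mu U <= mu (T @^-1` U)) ->
  invariant_measure (T : borel X -> borel X) mu.
Proof.
move=> cT muU.
have mT (A : set (borel X)) : measurable A -> measurable (T @^-1` A : set (borel X)).
  by move=> mA; exact: borel_preimage.
have muC (A : set (borel X)) : measurable A -> mu (~` A) = 1 - mu A.
  by move=> mA; rewrite probability_setC.
have fin (A : set (borel X)) : measurable A -> mu A \is a fin_num.
  by move=> mA; exact: fin_num_measure.
have muK (K : set X) : closed K -> mu (T @^-1` K) <= mu K.
  move=> cK; have mK : measurable (K : set (borel X)) by exact: measurable_closed.
  have := muU (~` K) (closed_openC cK); rewrite -preimage_setC !muC//; last exact: mT.
  by rewrite leeD2lE// leeN2.
have muUge (U : set X) : open U -> mu (T @^-1` U) <= mu U.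
  move=> oU; have [K [cK ndK KU]] := open_bigcup_closed oU.
  have mK n : measurable (K n : set (borel X)) by exact: measurable_closed.
  have c1 : mu \o (fun n => T @^-1` (K n)) @ \oo --> mu (\bigcup_n (T @^-1` (K n))).
    apply: nondecreasing_cvg_mu; [by move=> n; exact: mT| |].
    - by apply: bigcupT_measurable => n; exact: mT.
    - by move=> n m nm; apply/subsetPset; apply: preimage_subset; exact: ndK.
  rewrite -preimage_bigcup KU in c1.
  have c2 : mu \o (fun n => K n : set (borel X)) @ \oo --> mu (\bigcup_n (K n : set (borel X))).
    apply: nondecreasing_cvg_mu => //; first exact: bigcupT_measurable.
    by move=> n m nm; apply/subsetPset; exact: ndK.
  rewrite KU in c2.
  by apply: (lee_cvg_to c1 c2); apply: nearW => n; exact: muK.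
have muUeq (U : set X) : open U -> mu (T @^-1` U) = mu U.
  by move=> oU; apply/eqP; rewrite eq_le muUge//= muU.
have muKeq (K : set X) : closed K -> mu (T @^-1` K) = mu K.
  move=> cK; have mK : measurable (K : set (borel X)) by exact: measurable_closed.
  rewrite -[K in LHS]setCK -preimage_setC muC; last first.
    by apply: mT; exact: measurableC.
  by rewrite muUeq ?muC//; [rewrite oppeB ?fin// addeA subee// add0e | exact: closed_openC].
have ge (A : set (borel X)) : measurable A -> mu A <= mu (T @^-1` A).
  move=> mA; apply/lee_addgt0Pr => e e0.
  have [K [cK KA le]] := closed_inner_regularity mu mA e0.
  have mK : measurable (K : set (borel X)) by exact: measurable_closed.
  rewrite (measureDI _ mA mK) setIidr// addeC.
  apply: leeD => //; apply: (@le_trans _ _ (mu (T @^-1` K))).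
    exact: (eq_ind_r (fun z => z <= mu (T @^-1` K)) (lexx _) (esym (muKeq K cK))).
  by apply: le_measure; rewrite ?inE; [exact: mT|exact: mT|exact: preimage_subset].
move=> A mA; rewrite /pushforward; apply/eqP; rewrite eq_le ge// andbT.
have := ge (~` A) (measurableC mA); rewrite -preimage_setC !muC//; last exact: mT.
by rewrite leeD2lE// leeN2.
Qed.

End invariance.

(** * Bowen metrics and pressure *)

Section compact_metric.
Set Implicit Arguments.
Unset Strict Implicit.
Context {R : realType}.
Local Open Scope ring_scope.

Lemma compact_finite_cover (X : pmetricType R) (B : X -> set X) : compact [set: X] ->
  (forall x, open (B x)) -> (forall x, B x x) ->
  exists s : seq X, forall z, exists2 x, x \in s & B x z.
Proof.
move=> cX oB Bx; have : compact [set: X] by [].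
rewrite compact_cover => /(_ X setT B).
case=> [x _|x _|D _ DB]; [exact: oB|by exists x|].
by exists (finmap.enum_fset D) => z; have [x xD xz] := DB z I; exists x.
Qed.

(** The Lebesgue number lemma for a relation that holds between any two points sufficiently close to
    a given one. It serves both for uniform continuity and for the positive distance between
    disjoint closed sets. *)
Lemma lebesgue_number (X : pmetricType R) (P : X -> X -> Prop) : compact [set: X] ->
  (forall x, exists2 r, 0 < r & forall y z, mdist x y < r -> mdist x z < r -> P y z) ->
  exists2 d, 0 < d & forall y z, mdist y z < d -> P y z.
Proof.
move=> cX HP; have [r /all_and2[r0 rP]] : exists r : X -> R, forall x, 0 < r x /\
    forall y z, mdist x y < r x -> mdist x z < r x -> P y z.
  suff /choice[r Hr] : forall x, exists r : R, 0 < r /\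
    forall y z, mdist x y < r -> mdist x z < r -> P y z by exists r.
  by move=> x; have [r r0 H] := HP x; exists r.
have h x : [set z | mdist x z < r x / 2] x by rewrite /= mdistxx divr_gt0.
have [s Hs] := compact_finite_cover (B := fun x => [set z | mdist x z < r x / 2]) cX
  (fun x => open_mdist_lt x _) h.
exists (\big[Num.min/1]_(x <- s) (r x / 2)).
  elim: (s) => [|x t IH]; first by rewrite big_nil ltr01.
  by rewrite big_cons lt_min IH andbT divr_gt0.
move=> y z yz; have [x xs xy] := Hs y.
have yzx : mdist y z < r x / 2.
  apply: (lt_le_trans yz); elim: (s) xs => // u t IH.
  by rewrite inE big_cons ge_min => /orP[/eqP ->|/IH ->]; rewrite ?lexx ?orbT.
apply: (rP x); move: xy; rewrite /= => xy.
- by have := r0 x; lra.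
- by have := metric_triangle x y z; lra.
Qed.

Lemma continuous_uniform (X Y : pmetricType R) (p : X -> Y) (e : R) :
  compact [set: X] -> continuous p -> 0 < e ->
  exists2 d, 0 < d & forall x y, mdist x y < d -> mdist (p x) (p y) < e.
Proof.
move=> cX cp e0; apply: lebesgue_number => // x.
have e2 : 0 < e / 2 by rewrite divr_gt0.
have : nbhs x (p @^-1` ball (p x) (e / 2)) by apply: cp; exact: nbhsx_ballx.
rewrite -nbhs_ballE => -[r /= r0 H]; exists r => // y z.
have B u : mdist x u < r -> mdist (p x) (p u) < e / 2.
  by move=> xu; have := H u; rewrite !ballEmdist/=; exact.
move=> /B xy /B xz; have := metric_triangle (p y) (p x) (p z).
rewrite (metric_sym (p y) (p x)); lra.
Qed.

Lemma continuous_uniform_real (X : pmetricType R) (f : X -> R) (e : R) :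
  compact [set: X] -> continuous f -> 0 < e ->
  exists2 d, 0 < d & forall x y, mdist x y < d -> `|f x - f y| <= e.
Proof.
move=> cX cf e0; apply: lebesgue_number => // x.
have e2 : 0 < e / 2 by rewrite divr_gt0.
have /cvgrPdist_lt /(_ _ e2) := cf x.
rewrite -nbhs_ballE => -[r /= r0 H]; exists r => // y z.
have B u : mdist x u < r -> `|f x - f u| < e / 2.
  by move=> xu; apply: H; rewrite ballEmdist.
move=> /B xy /B xz; have -> : f y - f z = (f x - f z) - (f x - f y) by ring.
apply: (le_trans (ler_normB _ _)); lra.
Qed.

Lemma continuous_bounded (X : pmetricType R) (f : X -> R) :
  compact [set: X] -> continuous f -> exists2 C, 0 <= C & forall x, `|f x| <= C.
Proof.
move=> cX cf.
have cn : continuous (fun x => `|f x|).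
  by move=> x; apply: cvg_norm; exact: cf.
have [|//||c _ H] := @compact_EVT_max X R (fun x => `|f x|) setT.
- by exists point.
- exact: continuous_subspaceT.
- by exists `|f c| => // x; apply: H; rewrite inE.
Qed.

(** Greedy selection: a point is kept exactly when no point kept so far is within [r] of it, so the
    result is both dense in [s] and separated. *)
Lemma separated_subseq (X : eqType) (D : X -> X -> R) (r : R) (s : seq X) :
  0 < r -> (forall x, D x x = 0) -> (forall x y, D x y = D y x) ->
  exists t : seq X, [/\ uniq t, {subset t <= s},
    (forall z, z \in s -> exists2 x, x \in t & D x z < r) &
    {in t &, forall x y, x != y -> r <= D x y}].
Proof.
move=> r0 Dxx Dsym; elim: s => [|a s [t [ut ts cov sep]]]; first by exists [::].
have [[x xt xa]|nx] := pselect (exists2 x, x \in t & D x a < r).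
  exists t; split=> //; first by move=> y /ts ys; rewrite inE ys orbT.
  by move=> z; rewrite inE => /orP[/eqP ->|/cov//]; exists x.
have far y : y \in t -> r <= D y a.
  by move=> yt; rewrite leNgt; apply/negP => ya; apply: nx; exists y.
exists (a :: t); split.
- rewrite /= ut andbT; apply/negP => /far; by rewrite Dxx leNgt r0.
- by move=> y; rewrite !inE => /orP[->//|/ts ->]; rewrite orbT.
- move=> z; rewrite inE => /orP[/eqP ->|/cov[x xt xz]].
    by exists a; rewrite ?mem_head// Dxx.
  by exists x => //; rewrite inE xt orbT.
- move=> x y; rewrite !inE => /orP[/eqP ->|xt] /orP[/eqP ->|yt].
  + by rewrite eqxx.
  + by move=> _; rewrite Dsym far.
  + by move=> _; rewrite far.
  + exact: sep.
Qed.

End compact_metric.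

Section bowen_metric.
Set Implicit Arguments.
Unset Strict Implicit.
Context {R : realType} (X : pmetricType R) (T : X -> X).
Local Open Scope ring_scope.

Lemma bowen_dist_ltP N x y e : 0 < e ->
  reflect (forall n, (n < N)%N -> mdist (iter n T x) (iter n T y) < e)
    (bowen_dist T N x y < e).
Proof.
move=> e0; apply: (iffP (bigmax_ltP _ _ _ _)) => [[_ H] n nN|H].
  exact: (H (Ordinal nN)).
by split=> // i _; exact: H.
Qed.

Lemma bowen_dist_leP N x y e : 0 <= e ->
  reflect (forall n, (n < N)%N -> mdist (iter n T x) (iter n T y) <= e)
    (bowen_dist T N x y <= e).
Proof.
move=> e0; apply: (iffP (bigmax_leP _ _ _ _)) => [[_ H] n nN|H].
  exact: (H (Ordinal nN)).
by split=> // i _; exact: H.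
Qed.

Lemma bowen_dist_ge0 N x y : 0 <= bowen_dist T N x y.
Proof.
apply: (big_ind (fun z => 0 <= z)) => [//|a b a0 b0|i _]; last exact: mdist_ge0.
by rewrite le_max a0.
Qed.

Lemma bowen_dist_ge N x y n : (n < N)%N ->
  mdist (iter n T x) (iter n T y) <= bowen_dist T N x y.
Proof.
by move=> nN; have /bowen_dist_leP := lexx (bowen_dist T N x y); apply => //; exact: bowen_dist_ge0.
Qed.

Lemma bowen_distxx N x : bowen_dist T N x x = 0.
Proof.
apply/eqP; rewrite eq_le bowen_dist_ge0 andbT; apply/bowen_dist_leP => // n _.
by rewrite mdistxx.
Qed.

Lemma bowen_dist_sym N x y : bowen_dist T N x y = bowen_dist T N y x.
Proof. by apply: eq_bigr => i _; exact: metric_sym. Qed.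

Lemma bowen_dist_triangle N x y z :
  bowen_dist T N x z <= bowen_dist T N x y + bowen_dist T N y z.
Proof.
apply/bowen_dist_leP => [|n nN]; first by rewrite addr_ge0// bowen_dist_ge0.
by apply: (le_trans (metric_triangle _ (iter n T y) _)); apply: lerD; exact: bowen_dist_ge.
Qed.

Lemma bowen_diam_lt N (U : set X) (e : \bar R) x y : (bowen_diam T N U < e)%E ->
  U x -> U y -> ((bowen_dist T N x y)%:E < e)%E.
Proof.
move=> Ue Ux Uy; apply: le_lt_trans Ue; apply: ereal_sup_ubound.
by exists x, y.
Qed.

Lemma bowen_diam_le N (U : set X) (e : \bar R) :
  (forall x y, U x -> U y -> ((bowen_dist T N x y)%:E <= e)%E) ->
  (bowen_diam T N U <= e)%E.
Proof. by move=> H; apply: ge_ereal_sup => _ [x [y [Ux Uy ->]]]; exact: H. Qed.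

Lemma birkhoff_sumD (f : X -> R) N M x :
  birkhoff_sum T f (N + M) x = birkhoff_sum T f N x + birkhoff_sum T f M (iter N T x).
Proof.
rewrite /birkhoff_sum big_split_ord/=; congr (_ + _).
by apply: eq_bigr => i _; rewrite -iterD addnC.
Qed.

Lemma birkhoff_sum_le (f g : X -> R) N x y (c : R) :
  (forall n, (n < N)%N -> f (iter n T x) <= g (iter n T y) + c) ->
  birkhoff_sum T f N x <= birkhoff_sum T g N y + N%:R * c.
Proof.
move=> H; rewrite mulr_natl -[X in _ *+ X]card_ord -sumr_const -big_split/=.
by apply: ler_sum => i _; exact: H.
Qed.

Context (cX : compact [set: X]) (cT : continuous T).

Lemma continuous_iter n : continuous (iter n T).
Proof.
elim: n => [|n IH] x; first exact: cvg_id.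
by apply: continuous_comp; [exact: IH|exact: cT].
Qed.

Lemma near_bowen_dist N x e : 0 < e -> \forall z \near x, bowen_dist T N x z < e.
Proof.
move=> e0.
suff : \forall z \near x, forall n, (n < N)%N -> mdist (iter n T x) (iter n T z) < e.
  by apply: filterS => z /bowen_dist_ltP; apply.
elim: N => [|N IH]; first exact: nearW.
have : nbhs x (iter N T @^-1` ball (iter N T x) e).
  by apply: (@continuous_iter N x); exact: nbhsx_ballx.
move: IH; apply: filterS2 => z H; rewrite ballEmdist/= => zN n.
by rewrite ltnS leq_eqVlt => /orP[/eqP ->//|/H].
Qed.

Lemma open_bowen_ball N x e : open [set z | bowen_dist T N x z < e].
Proof.
rewrite openE => z /= xz; have : 0 < e - bowen_dist T N x z by rewrite subr_gt0.
move=> /(near_bowen_dist N z); apply: filterS => y /= zy.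
by apply: (le_lt_trans (bowen_dist_triangle _ _ z _)); lra.
Qed.

Lemma bowen_net N (O : set X) (r : R) : 0 < r -> exists s : seq X,
  [/\ uniq s, (forall x, x \in s -> O x),
      forall z, O z -> exists2 x, x \in s & bowen_dist T N x z < r &
      {in s &, forall x y, x != y -> r / 2 <= bowen_dist T N x y}].
Proof.
(* A ball of radius r / 4 that meets [O] is represented by a point of [O], so the representatives
   are r / 2-dense in [O]; thinning them out at r / 2 keeps every point of [O] within [r]. *)
move=> r0; pose B x := [set z | bowen_dist T N x z < r / 4].
have Bx x : B x x by rewrite /B/= bowen_distxx divr_gt0.
have [s Hs] := compact_finite_cover cX (fun x => open_bowen_ball N x (r / 4)) Bx.
have [c Hc] : exists c : X -> X, forall x, (exists z, O z /\ B x z) -> O (c x) /\ B x (c x).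
  suff /choice[c Hc] : forall x, exists y, (exists z, O z /\ B x z) -> O y /\ B x y.
    by exists c.
  move=> x; have [[z Hz]|nz] := pselect (exists z, O z /\ B x z); first by exists z.
  by exists x.
pose u := [seq c x | x <- s & `[< exists z, O z /\ B x z >]].
have uO x : x \in u -> O x.
  by move=> /mapP[y]; rewrite mem_filter => /andP[/asboolP/Hc[Oc _] _] ->.
have r2 : 0 < r / 2 by rewrite divr_gt0.
have [t [ut tu cov sep]] := separated_subseq u r2 (bowen_distxx N) (bowen_dist_sym N).
exists t; split=> //; first by move=> x /tu/uO.
move=> z Oz; have [x xs xz] := Hs z.
have Hx : exists z, O z /\ B x z by exists z.
have [Oc cx] := Hc _ Hx.
have cu : c x \in u by apply: map_f; rewrite mem_filter xs andbT; apply/asboolP.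
have [y yt yc] := cov _ cu; exists y => //.
have := bowen_dist_triangle N y (c x) z; have := bowen_dist_triangle N (c x) x z.
move: cx xz; rewrite /B/= (bowen_dist_sym N (c x) x); lra.
Qed.

End bowen_metric.

(** * Cover pressure: estimates by nets and submultiplicativity *)

Section cover_pressure.
Set Implicit Arguments.
Unset Strict Implicit.
Context {R : realType} (X : pmetricType R) (T : X -> X) (f : X -> R).
Context (cX : compact [set: X]) (cT : continuous T) (cf : continuous f).
Local Open Scope ereal_scope.

Local Notation wt N U := (expeR (ereal_sup [set (birkhoff_sum T f N x)%:E | x in U])).

Lemma ereal_infM_ge (A B : set \bar R) (c : \bar R) :
  (forall s, A s -> 0 <= s) -> (forall s, B s -> 0 <= s) ->
  ereal_inf A \is a fin_num -> ereal_inf B \is a fin_num ->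
  (forall s t, A s -> B t -> c <= s * t) -> c <= ereal_inf A * ereal_inf B.
Proof.
move=> A0 B0 fA fB H.
have a0 : 0 <= ereal_inf A by apply: le_ereal_inf_tmp.
have b0 : 0 <= ereal_inf B by apply: le_ereal_inf_tmp.
apply/lee_addgt0Pr => e e0.
pose a := fine (ereal_inf A); pose b := fine (ereal_inf B).
have aE : ereal_inf A = a%:E by rewrite fineK.
have bE : ereal_inf B = b%:E by rewrite fineK.
have ra0 : (0 <= a)%R by rewrite fine_ge0.
have rb0 : (0 <= b)%R by rewrite fine_ge0.
have ab0 : (0 < a + b + 1)%R by lra.
(* Then (a + d)(b + d) <= a b + d (a + b + 1) <= a b + e, the first step because d <= 1. *)
pose d := Num.min 1%R (e / (a + b + 1))%R.
have d0 : (0 < d)%R by rewrite lt_min ltr01 divr_gt0.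
have d1 : (d <= 1)%R by rewrite ge_min lexx.
have de : (d * (a + b + 1) <= e)%R by rewrite -ler_pdivlMr// ge_min lexx orbT.
have [s As sa] := lb_ereal_inf_adherent d0 fA.
have [t Bt tb] := lb_ereal_inf_adherent d0 fB.
apply: (le_trans (H s t As Bt)).
apply: (@le_trans _ _ ((a + d)%:E * (b + d)%:E)).
  apply: lee_pmul; [exact: A0|exact: B0|..].
  - by rewrite EFinD -aE ltW.
  - by rewrite EFinD -bE ltW.
rewrite aE bE -!EFinM -EFinD lee_fin.
have : (d * d <= d * 1)%R by rewrite ler_pM2l.
nra.
Qed.

Lemma cover_pressure_le (I : finType) (U : I -> set X) (O : set X) N (e : R) :
  (forall i, open (U i)) -> O `<=` \bigcup_i U i ->
  (forall i, bowen_diam T N (U i) < e%:E) ->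
  cover_pressure T O f N e <= \sum_i wt N (U i).
Proof.
move=> oU OU dU.
have -> : \sum_i wt N (U i) = \sum_(k < #|I|) wt N (U (enum_val k)).
  by rewrite -(big_enum_val (fun i => wt N (U i))).
apply: ereal_inf_lbound; exists #|I|, (fun k => U (enum_val k)); split=> //.
split=> // x /OU [i _ Ui]; exists (enum_rank i) => //.
by rewrite enum_rankK.
Qed.

Lemma cover_pressure_ge0 O N e : 0 <= cover_pressure T O f N e.
Proof.
apply: le_ereal_inf_tmp => _ [n [U [_ ->]]]; apply: sume_ge0 => i _.
exact: expeR_ge0.
Qed.

Lemma cover_pressure_sub O O' N e : O `<=` O' ->
  cover_pressure T O f N e <= cover_pressure T O' f N e.
Proof.
move=> OO'; apply: le_ereal_inf => _ [n [U [[oU OU dU] ->]]].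
by exists n, U; split=> //; split=> // x /OO'/OU.
Qed.

Lemma cover_pressure_anti O N (e e' : R) : (e <= e')%R ->
  cover_pressure T O f N e' <= cover_pressure T O f N e.
Proof.
move=> ee'; apply: le_ereal_inf => _ [n [U [[oU OU dU] ->]]].
exists n, U; split=> //; split=> // k; apply: (lt_le_trans (dU k)).
by rewrite lee_fin.
Qed.

(** The Bowen balls around the net form an admissible cover, and on each of them the Birkhoff sum
    exceeds its value at the centre by at most N c. *)
Lemma cover_pressure_net (O : set X) N (s : seq X) (r e c : R) :
  (0 < r)%R -> (2 * r < e)%R ->
  (forall z, O z -> exists2 x, x \in s & (bowen_dist T N x z < r)%R) ->
  (forall x y, (mdist x y < r)%R -> (`|f x - f y| <= c)%R) ->
  cover_pressure T O f N e <=
  (expR (N%:R * c) * \sum_(x <- s) expR (birkhoff_sum T f N x))%:E.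
Proof.
move=> r0 re net fc.
pose U (i : 'I_(size s)) := [set z | (bowen_dist T N (nth point s i) z < r)%R].
apply: (@le_trans _ _ (\sum_i wt N (U i))).
  apply: cover_pressure_le.
  - by move=> i; exact: open_bowen_ball.
  - move=> z /net[x xs xz]; have xi : (index x s < size s)%N by rewrite index_mem.
    by exists (Ordinal xi) => //; rewrite /U/= nth_index.
  - move=> i; apply: (@le_lt_trans _ _ (2 * r)%:E); last by rewrite lte_fin.
    apply: bowen_diam_le => x y; rewrite /U/= => xi yi; rewrite lee_fin.
    have := bowen_dist_triangle T N x (nth point s i) y.
    rewrite (bowen_dist_sym T N x (nth point s i)); lra.
rewrite (big_nth point) big_mkord big_distrr/= -sumEFin; apply: lee_sum => i _.
rewrite -expRD; apply: (@le_trans _ _ (expeR (N%:R * c + birkhoff_sum T f N (nth point s i))%:E)); last by [].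
rewrite lee_expeR; apply: ge_ereal_sup => _ [z Uz <-]; rewrite lee_fin.
rewrite addrC; apply: birkhoff_sum_le => n nN.
have := bowen_dist_ge T (nth point s i) z nN; rewrite /U/= in Uz.
move=> /le_lt_trans/(_ Uz)/fc; rewrite ler_norml; lra.
Qed.

Lemma birkhoff_sum_bound (C : R) N x : (forall x, (`|f x| <= C)%R) ->
  (`|birkhoff_sum T f N x| <= N%:R * C)%R.
Proof.
move=> fC; apply: (le_trans (ler_norm_sum _ _ _)).
rewrite mulr_natl -[X in (_ *+ X)%R]card_ord -sumr_const.
by apply: ler_sum => i _; exact: fC.
Qed.

Lemma cover_pressure_lty O N (e : R) : (0 < e)%R -> cover_pressure T O f N e < +oo.
Proof.
move=> e0; have [C C0 fC] := continuous_bounded cX cf.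
have e4 : (0 < e / 4)%R by rewrite divr_gt0.
have [s [_ _ net _]] := bowen_net cX cT N setT e4.
apply: (le_lt_trans (cover_pressure_net (s := s) (r := (e / 4)%R) (c := (2 * C)%R) _ _ _ _)).
- by [].
- lra.
- by move=> z _; exact: net.
- move=> x y _; apply: (le_trans (ler_normB _ _)).
  by have := fC x; have := fC y; lra.
- exact: ltry.
Qed.

Lemma cover_pressure_fin O N (e : R) : (0 < e)%R ->
  cover_pressure T O f N e \is a fin_num.
Proof. by move=> e0; rewrite ge0_fin_numE ?cover_pressure_ge0// cover_pressure_lty. Qed.

Lemma cover_pressure_ge (O : set X) N (e C : R) : O !=set0 -> (forall x, (`|f x| <= C)%R) ->
  (expR (- (N%:R * C)))%:E <= cover_pressure T O f N e.
Proof.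
move=> [x Ox] fC; apply: le_ereal_inf_tmp => _ [n [U [[oU OU dU] ->]]].
have [k _ Uk] := OU x Ox.
rewrite (bigD1 k)//=; apply: (@le_trans _ _ (wt N (U k))).
  apply: (@le_trans _ _ (expeR (- (N%:R * C))%:E)); first by [].
  rewrite lee_expeR; apply: (@le_trans _ _ (birkhoff_sum T f N x)%:E).
    have := birkhoff_sum_bound N x fC; rewrite ler_norml lee_fin; lra.
  by apply: ereal_sup_ubound; exists x.
by rewrite leeDl//; apply: sume_ge0 => i _; exact: expeR_ge0.
Qed.

Lemma bowen_diamI N M (U V : set X) (e : \bar R) :
  bowen_diam T N U < e -> bowen_diam T M V < e ->
  bowen_diam T (N + M) (U `&` iter N T @^-1` V) < e.
Proof.
move=> Ue Ve; apply: (@le_lt_trans _ _ (maxe (bowen_diam T N U) (bowen_diam T M V))).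
  apply: bowen_diam_le => x y [Ux Vx] [Uy Vy].
  have h1 : (bowen_dist T N x y)%:E <= bowen_diam T N U.
    by apply: ereal_sup_ubound; exists x, y.
  have h2 : (bowen_dist T M (iter N T x) (iter N T y))%:E <= bowen_diam T M V.
    by apply: ereal_sup_ubound; exists (iter N T x), (iter N T y).
  have : (bowen_dist T (N + M) x y <=
      Num.max (bowen_dist T N x y) (bowen_dist T M (iter N T x) (iter N T y)))%R.
    apply/bowen_dist_leP => [|n nNM]; first by rewrite le_max bowen_dist_ge0.
    rewrite le_max; case: (ltnP n N) => nN; first by rewrite bowen_dist_ge.
    apply/orP; right; rewrite -(subnK nN) !iterD; apply: bowen_dist_ge.
    by rewrite ltn_subLR.
  rewrite -lee_fin => /le_trans; apply.
  rewrite EFin_max; by apply: le_max2.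
by rewrite gt_max Ue Ve.
Qed.

Lemma cover_pressure_submul (O O' : set X) N M (e : R) : (0 < e)%R ->
  cover_pressure T (O `&` iter N T @^-1` O') f (N + M) e <=
  cover_pressure T O f N e * cover_pressure T O' f M e.
Proof.
move=> e0; apply: ereal_infM_ge.
- by move=> _ [n [U [_ ->]]]; apply: sume_ge0 => i _; exact: expeR_ge0.
- by move=> _ [n [U [_ ->]]]; apply: sume_ge0 => i _; exact: expeR_ge0.
- exact: cover_pressure_fin.
- exact: cover_pressure_fin.
move=> _ _ [n [U [[oU OU dU] ->]]] [n' [U' [[oU' OU' dU'] ->]]].
pose W (ij : 'I_n * 'I_n') := U ij.1 `&` iter N T @^-1` U' ij.2.
apply: (@le_trans _ _ (\sum_ij wt (N + M) (W ij))).
  apply: cover_pressure_le.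
  - move=> [i j]; apply: openI; first exact: oU.
    by apply: open_comp => [x _|]; [exact: continuous_iter|exact: oU'].
  - by move=> x [/OU[i _ Ui] /OU'[j _ Uj]]; exists (i, j).
  - by move=> [i j]; exact: bowen_diamI.
rewrite ge0_sume_distrl; last by move=> i _; exact: expeR_ge0.
rewrite [leRHS](eq_bigr (fun i => \sum_j (wt N (U i) * wt M (U' j)))); last first.
  by move=> i _; rewrite ge0_sume_distrr// => j _; exact: expeR_ge0.
rewrite pair_big/=; apply: lee_sum => -[i j] _ /=.
rewrite -expeRD lee_expeR; apply: ge_ereal_sup => _ [x [/= Ux Vx] <-].
rewrite birkhoff_sumD EFinD; apply: leeD; apply: ereal_sup_ubound.
- by exists x.
- by exists (iter N T x).
Qed.

End cover_pressure.

Section weighted_cover_pressure.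
Set Implicit Arguments.
Unset Strict Implicit.
Context {R : realType} (X Y : pmetricType R) (T : X -> X) (S : Y -> Y).
Context (pi : X -> Y) (f : X -> R) (w : R).
Context (cX : compact [set: X]) (cT : continuous T) (cf : continuous f).
Context (cY : compact [set: Y]) (cS : continuous S).
Context (cpi : continuous pi) (spi : set_surj [set: X] [set: Y] pi).
Context (piT : pi \o T = S \o pi) (hw : (0 <= w <= 1)%R).
Local Open Scope ereal_scope.

Local Notation WP := (weighted_cover_pressure w pi T S f).
Local Notation P O N e := (cover_pressure T O f N e).

Lemma factor_iter n x : pi (iter n T x) = iter n S (pi x).
Proof. by elim: n => //= n <-; exact: (congr1 (@^~ (iter n T x)) piT). Qed.

Lemma poweR_le (a b : \bar R) : 0 <= a -> a <= b -> a `^ w <= b `^ w.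
Proof.
move=> a0 ab; have /andP[w0 _] := hw.
apply: gt0_ler_poweR => //; rewrite in_itv/= leey ?andbT//.
exact: le_trans ab.
Qed.

Lemma weighted_cover_pressure_le (I : finType) (V : I -> set Y) N (e : R) :
  (forall i, open (V i)) -> [set: Y] `<=` \bigcup_i V i ->
  (forall i, bowen_diam S N (V i) < e%:E) ->
  WP N e <= \sum_i P (pi @^-1` V i) N e `^ w.
Proof.
move=> oV YV dV.
have -> : \sum_i P (pi @^-1` V i) N e `^ w =
    \sum_(k < #|I|) P (pi @^-1` V (enum_val k)) N e `^ w.
  by rewrite -(big_enum_val (fun i => P (pi @^-1` V i) N e `^ w)).
apply: ereal_inf_lbound; exists #|I|, (fun k => V (enum_val k)); split=> //.
split=> // x /YV [i _ Vi]; exists (enum_rank i) => //.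
by rewrite enum_rankK.
Qed.

Lemma weighted_cover_pressure_anti N (e e' : R) : (0 < e)%R -> (e <= e')%R ->
  WP N e' <= WP N e.
Proof.
move=> e0 ee'; apply: le_ereal_inf_tmp => _ [n [V [[oV YV dV] ->]]].
apply: (@le_trans _ _ (\sum_k P (pi @^-1` V k) N e' `^ w)).
  apply: weighted_cover_pressure_le => // i; apply: (lt_le_trans (dV i)).
  by rewrite lee_fin.
apply: lee_sum => i _; apply: poweR_le; first exact: cover_pressure_ge0.
exact: cover_pressure_anti.
Qed.

Lemma weighted_cover_pressure_ge N (e C : R) : (0 < e)%R -> (0 <= C)%R ->
  (forall x, (`|f x| <= C)%R) -> (expR (- (N%:R * C)))%:E <= WP N e.
Proof.
move=> e0 C0 fC; have /andP[w0 w1] := hw.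
apply: le_ereal_inf_tmp => _ [n [V [[oV YV dV] ->]]].
have [k _ Vk] := YV point I.
have [x _ xp] := spi (I : [set: Y] point).
rewrite (bigD1 k)//=; apply: (@le_trans _ _ (P (pi @^-1` V k) N e `^ w)).
  apply: (@le_trans _ _ ((expR (- (N%:R * C)))%:E `^ w)).
    rewrite poweR_EFin lee_fin -expRM ler_expR.
    have NC : (0 <= N%:R * C)%R by rewrite mulr_ge0.
    by rewrite mulNr lerN2 ler_piMr.
  apply: poweR_le; first by rewrite lee_fin expR_ge0.
  by apply: cover_pressure_ge => //; exists x; rewrite /= xp.
by rewrite leeDl//; apply: sume_ge0 => i _; exact: poweR_ge0.
Qed.

Lemma weighted_cover_pressure_gt0 N (e : R) : (0 < e)%R -> 0 < WP N e.
Proof.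
move=> e0; have [C C0 fC] := continuous_bounded cX cf.
by apply: lt_le_trans (weighted_cover_pressure_ge N e0 C0 fC); rewrite lte_fin expR_gt0.
Qed.

Lemma weighted_cover_pressure_fin N (e : R) : (0 < e)%R -> WP N e \is a fin_num.
Proof.
move=> e0; rewrite ge0_fin_numE; last by rewrite ltW// weighted_cover_pressure_gt0.
have e4 : (0 < e / 4)%R by rewrite divr_gt0.
have [s [_ _ net _]] := bowen_net cY cS N setT e4.
pose V (i : 'I_(size s)) := [set z | (bowen_dist S N (nth point s i) z < e / 4)%R].
apply: (@le_lt_trans _ _ (\sum_i P (pi @^-1` V i) N e `^ w)).
  apply: weighted_cover_pressure_le.
  - by move=> i; exact: open_bowen_ball.
  - move=> z _; have [x xs xz] := net z I.
    have xi : (index x s < size s)%N by rewrite index_mem.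
    by exists (Ordinal xi) => //; rewrite /V/= nth_index.
  - move=> i; apply: (@le_lt_trans _ _ (e / 2)%:E); last first.
      by rewrite lte_fin ltr_pdivrMr// ltr_pMr// ltr1n.
    apply: bowen_diam_le => x y; rewrite /V/= => xi yi; rewrite lee_fin.
    have := bowen_dist_triangle S N x (nth point s i) y.
    rewrite (bowen_dist_sym S N x (nth point s i)); lra.
apply: lte_sum_pinfty => i _; apply: poweR_lty.
exact: cover_pressure_lty.
Qed.

Lemma weighted_cover_pressure_submul N M (e : R) : (0 < e)%R ->
  WP (N + M) e <= WP N e * WP M e.
Proof.
move=> e0; apply: ereal_infM_ge.
- by move=> _ [n [U [_ ->]]]; apply: sume_ge0 => i _; exact: poweR_ge0.
- by move=> _ [n [U [_ ->]]]; apply: sume_ge0 => i _; exact: poweR_ge0.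
- exact: weighted_cover_pressure_fin.
- exact: weighted_cover_pressure_fin.
move=> _ _ [n [U [[oU OU dU] ->]]] [n' [U' [[oU' OU' dU'] ->]]].
pose W (ij : 'I_n * 'I_n') := U ij.1 `&` iter N S @^-1` U' ij.2.
apply: (@le_trans _ _ (\sum_ij P (pi @^-1` (W ij)) (N + M) e `^ w)).
  apply: weighted_cover_pressure_le.
  - move=> [i j]; apply: openI; first exact: oU.
    by apply: open_comp => [x _|]; [exact: continuous_iter|exact: oU'].
  - move=> x _; have [i _ Ui] := OU x I; have [j _ Uj] := OU' (iter N S x) I.
    by exists (i, j).
  - by move=> [i j]; exact: bowen_diamI.
rewrite ge0_sume_distrl; last by move=> i _; exact: poweR_ge0.
rewrite [leRHS](eq_bigr (fun i => \sum_j (P (pi @^-1` U i) N e `^ w *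
    P (pi @^-1` U' j) M e `^ w))); last first.
  by move=> i _; rewrite ge0_sume_distrr// => j _; exact: poweR_ge0.
rewrite pair_big/=; apply: lee_sum => -[i j] _ /=.
rewrite -poweRM; [|exact: cover_pressure_ge0|exact: cover_pressure_ge0].
apply: poweR_le; first exact: cover_pressure_ge0.
apply: le_trans (cover_pressure_submul cX cT cf (pi @^-1` U i) (pi @^-1` U' j) N M e0).
apply: cover_pressure_sub => x [/= Ux Vx]; split=> //=.
by rewrite factor_iter.
Qed.

Definition log_weighted_cover_pressure N (e : R) : R := ln (fine (WP N e)).

Definition weighted_pressure_rate (e : R) : R :=
  limn (fun N => log_weighted_cover_pressure N e / N%:R)%R.

Lemma fine_weighted_cover_pressure_gt0 N (e : R) : (0 < e)%R -> (0 < fine (WP N e))%R.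
Proof.
move=> e0; rewrite fine_gt0// weighted_cover_pressure_gt0//=.
by rewrite ltey_eq weighted_cover_pressure_fin.
Qed.

Lemma lne_weighted_cover_pressure N (e : R) : (0 < e)%R ->
  lne (WP N e) = (log_weighted_cover_pressure N e)%:E.
Proof.
move=> e0; rewrite -{1}(fineK (weighted_cover_pressure_fin N e0)) lne_EFin//.
exact: fine_weighted_cover_pressure_gt0.
Qed.

Lemma expR_log_weighted_cover_pressure N (e : R) : (0 < e)%R ->
  (expR (log_weighted_cover_pressure N e))%:E = WP N e.
Proof.
move=> e0; rewrite lnK ?posrE ?fineK ?weighted_cover_pressure_fin//.
exact: fine_weighted_cover_pressure_gt0.
Qed.

Lemma weighted_pressure_rate_cvg (e : R) : (0 < e)%R ->
  (log_weighted_cover_pressure N e / N%:R)%R @[N --> \oo] --> weighted_pressure_rate e.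
Proof.
move=> e0; have [C C0 fC] := continuous_bounded cX cf.
have [a aE] : exists a : nat -> R, a = fun N => log_weighted_cover_pressure N e.
  by eexists.
have E n : (expR (a n))%:E = WP n e by rewrite aE expR_log_weighted_cover_pressure.
have [| |l cl _] := @fekete R a C.
- move=> i j; rewrite -ler_expR expRD -lee_fin EFinM.
  rewrite (E (i + j)%N) (E i) (E j).
  exact: weighted_cover_pressure_submul.
- move=> n; rewrite -ler_expR -lee_fin (E n).
  exact: weighted_cover_pressure_ge.
by rewrite aE in cl; rewrite /weighted_pressure_rate (cvg_lim _ cl).
Qed.

Lemma weighted_pressure_rate_anti (e e' : R) : (0 < e)%R -> (e <= e')%R ->
  (weighted_pressure_rate e' <= weighted_pressure_rate e)%R.
Proof.
move=> e0 ee'; have e0' : (0 < e')%R by exact: lt_le_trans ee'.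
apply: (ler_cvg_to (weighted_pressure_rate_cvg e0') (weighted_pressure_rate_cvg e0)).
apply: nearW => N; rewrite ler_wpM2r ?invr_ge0//.
have h := fine_weighted_cover_pressure_gt0 N e0.
have h' := fine_weighted_cover_pressure_gt0 N e0'.
rewrite /log_weighted_cover_pressure ler_ln ?posrE//.
apply: fine_le; [exact: weighted_cover_pressure_fin..|].
exact: weighted_cover_pressure_anti.
Qed.

(** The rate does not decrease as the scale shrinks, so the limit at 0 is a supremum and each
    inequality of the theorem can be treated one scale at a time. *)
Lemma weighted_pressureE : weighted_pressure w pi T S f =
  ereal_sup [set (weighted_pressure_rate e)%:E | e in [set e : R | (0 < e)%R]].
Proof.
pose F (e : R) : \bar R := (limn (fun N : nat =>
      lne (WP N e) * (N%:R^-1)%:E)).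
have FE (e : R) : (0 < e)%R -> F e = (weighted_pressure_rate e)%:E.
  move=> e0; apply/cvg_lim => //.
  under eq_fun do rewrite lne_weighted_cover_pressure// -EFinM.
  by apply: cvg_EFin; [exact: nearW|exact: weighted_pressure_rate_cvg].
rewrite /weighted_pressure -/F.
have c : F @ 0%R^'+ --> ereal_sup [set F x | x in [set` Interval (BRight 0%R) +oo%O]].
  apply: (@nonincreasing_at_right_cvge R F 0%R +oo%O); first by [].
  move=> e e'; rewrite !in_itv/= !andbT => e0 e0' ee'.
  change (F e' <= F e); rewrite (FE e e0) (FE e' e0') lee_fin.
  exact: weighted_pressure_rate_anti.
rewrite (cvg_lim _ c)//; congr ereal_sup; apply/seteqP; split=> _ [e He <-].
  by move: He; rewrite /= in_itv/= andbT => He; exists e => //; rewrite FE.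
by exists e; [rewrite /= in_itv/= andbT|rewrite FE].
Qed.

End weighted_cover_pressure.

(** * The variational principle: lower bound *)

Section borel_integrals.
Set Implicit Arguments.
Unset Strict Implicit.
Context {R : realType} (X : pmetricType R) (mu : probability (borel X) R).
Context (cX : compact [set: X]).
Local Open Scope ring_scope.

Lemma fap_probability (d : measure_display) (T : measurableType d) (P : probability T R) :
  finitely_additive_probability (fine \o P).
Proof.
split.
- by move=> A mA /=; rewrite fine_ge0.
- by rewrite /= probability_setT.
- move=> A B mA mB AB /=; rewrite measureU//.
  by rewrite fineD// fin_num_measure.
Qed.

Lemma continuous_integrable (D : set (borel X)) (F : X -> R) : measurable D ->
  continuous F -> mu.-integrable D (EFin \o F).
Proof.
move=> mD cF; have [C C0 FC] := continuous_bounded cX cF.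
apply: measurable_bounded_integrable => //.
- by rewrite (le_lt_trans (probability_le1 mu mD))// ltry.
- by apply: (measurable_funS (E := setT)) => //; exact: borel_measurable_fun.
- exists C; split; first by rewrite num_real.
  by move=> M CM x Dx; exact: (le_trans (FC x) (ltW CM)).
Qed.

Lemma continuous_integral_EFin (F : X -> R) : continuous F ->
  (\int[mu]_x (F x)%:E)%E = (\int[mu]_x F x)%:E.
Proof.
move=> cF; rewrite /Rintegral fineK//.
by apply: integrable_fin_num => //; exact: continuous_integrable.
Qed.

Lemma Rintegral_le_cells (I : finType) (g : borel X -> I) (F : X -> R) (c : I -> R) :
  finite_measurable g -> continuous F -> (forall x, F x <= c (g x)) ->
  \int[mu]_x F x <= \sum_i fine (mu (cell g i)) * c i.
Proof.
move=> mg cF Fc.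
have mI (D : set (borel X)) (mD : measurable D) := continuous_integrable mD cF.
have H (s : seq I) : uniq s ->
    \int[mu]_(x in [set x | g x \in s]) F x = \sum_(i <- s) \int[mu]_(x in cell g i) F x.
  elim: s => [_|i s IH /= /andP[si us]].
    rewrite big_nil (_ : [set x | _] = set0) ?Rintegral_set0//.
    by apply/seteqP; split.
  have ms : measurable [set x | g x \in s].
    exact: (@finite_measurable_preimage _ _ _ g (fun i => i \in s)).
  rewrite big_cons -IH// -Rintegral_setU//.
  - congr Rintegral; apply/seteqP; split=> x /=; rewrite inE.
      by case/orP => [/eqP|]; [left|right].
    by case=> [->|->]; rewrite ?eqxx ?orbT.
  - by apply: mI; exact: measurableU.
  - apply/disj_set2P; apply/seteqP; split => x //= [gi gs].
    by move: si; rewrite -gi gs.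
have -> : \int[mu]_x F x = \int[mu]_(x in [set x | g x \in index_enum I]) F x.
  by congr Rintegral; apply/seteqP; split=> x //= _; rewrite mem_index_enum.
rewrite H ?index_enum_uniq//; apply: ler_sum => i _.
rewrite mulrC -[X in _ <= _ * fine X]/(mu (cell g i)) -(Rintegral_cst mu (mg i)).
apply: le_Rintegral => //; first exact: mI.
- apply: continuous_integrable => //; exact: cst_continuous.
- by move=> x <-; exact: Fc.
Qed.

Section invariant.
Context (T : X -> X) (cT : continuous T).
Context (iT : forall A : set (borel X), measurable A -> mu (T @^-1` A) = mu A).

Lemma Rintegral_invariant (F : X -> R) : continuous F ->
  \int[mu]_x F (T x) = \int[mu]_x F x.
Proof.
move=> cF; congr fine.
have mT : measurable_fun [set: borel X] (T : borel X -> borel X).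
  by move=> _ A mA; rewrite setTI; exact: borel_preimage.
have cFT : continuous (F \o T).
  by move=> x; apply: continuous_comp; [exact: cT|exact: cF].
have := @integral_pushforward _ _ (borel X) (borel X) R T mT mu setT (EFin \o F).
rewrite preimage_setT => <-//.
- apply: eq_measure_integral => A mA _; exact: iT.
- apply/measurable_realfun.measurable_EFinP; exact: borel_measurable_fun.
- exact: (continuous_integrable measurableT cFT).
Qed.

Lemma birkhoff_sum_continuous (f : X -> R) n : continuous f ->
  continuous (birkhoff_sum T f n).
Proof.
move=> cf; rewrite /birkhoff_sum.
have -> : (fun x => \sum_(i < n) f (iter i T x)) = \sum_(i < n) (f \o iter i T).
  by apply/funext => x; rewrite fct_sumE.
apply: (big_ind (fun F : X -> R => continuous F)).
- exact: cst_continuous.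
- by move=> F G cF cG x; apply: cvgD; [exact: cF|exact: cG].
- move=> i _ x; apply: continuous_comp; [exact: continuous_iter|exact: cf].
Qed.

Lemma Rintegral_birkhoff_sum (f : X -> R) n : continuous f ->
  \int[mu]_x birkhoff_sum T f n x = n%:R * \int[mu]_x f x.
Proof.
move=> cf; elim: n => [|n IH].
  rewrite mul0r (_ : birkhoff_sum T f 0 = cst 0); last first.
    by apply/funext => x; rewrite /birkhoff_sum big_ord0.
  by rewrite Rintegral_cst// mul0r.
have E : birkhoff_sum T f n.+1 = fun x => f x + birkhoff_sum T f n (T x).
  apply/funext => x; rewrite -[n.+1]add1n birkhoff_sumD.
  by rewrite /birkhoff_sum big_ord_recl big_ord0 addr0.
rewrite E RintegralD//.
- rewrite (Rintegral_invariant (birkhoff_sum_continuous cf)) IH.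
  by rewrite -natr1; ring.
- exact: continuous_integrable.
- apply: (continuous_integrable measurableT (F := birkhoff_sum T f n \o T)).
  by move=> x; apply: continuous_comp; [exact: cT|exact: birkhoff_sum_continuous].
Qed.

End invariant.
End borel_integrals.

(** * Counting itineraries and the finite-time inequality *)

Section itinerary_count.
Set Implicit Arguments.
Unset Strict Implicit.
Context {R : realType} (X : pmetricType R) (T : X -> X).
Local Open Scope ring_scope.

(** A multiplicity bound at scale [e]. It is [q], and not the number of cells, that enters the
    constants of the lower bound. *)
Definition small_set_count (I : finType) (g : X -> I) (e : R) (q : nat) :=
  forall U : set X, (forall x y, U x -> U y -> mdist x y < e) ->
    exists2 A : {set I}, (#|A| <= q)%N & forall x, U x -> g x \in A.

Lemma itinerary_count (I : finType) (g : X -> I) (e : R) (q : nat) N (U : set X) :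
  0 < e -> small_set_count g e q ->
  (forall x y, U x -> U y -> bowen_dist T N x y < e) ->
  exists2 A : {set {ffun 'I_N -> I}}, (#|A| <= q ^ N)%N &
    forall x, U x -> [ffun n : 'I_N => g (iter n T x)] \in A.
Proof.
move=> e0 gq Ue.
have H (n : 'I_N) : exists A : {set I}, (#|A| <= q)%N /\
    forall x, U x -> g (iter n T x) \in A.
  have [|A Aq HA] := gq (iter n T @` U).
    move=> _ _ [x Ux <-] [y Uy <-].
    by have /bowen_dist_ltP := Ue x y Ux Uy; apply.
  by exists A; split=> // x Ux; apply: HA; exists x.
have [A HA] := choice H.
exists (finset (fun a : {ffun 'I_N -> I} => [forall n, a n \in A n])); last first.
  by move=> x Ux; rewrite inE; apply/forallP => n; rewrite ffunE; case: (HA n) => _; apply.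
have -> : #|finset (fun a : {ffun 'I_N -> I} => [forall n, a n \in A n])| =
    #|(family (fun n => mem (A n)) : simpl_pred {dffun forall n : 'I_N, I})|.
  by rewrite cardsE; apply: eq_card => a; rewrite !inE.
rewrite card_family.
have Hs (s : seq nat) : {in s, forall k, (k <= q)%N} ->
    (foldr muln 1 s <= q ^ size s)%N.
  elim: s => //= k s IH kq; rewrite expnS; apply: leq_mul; first exact/kq/mem_head.
  by apply: IH => j js; apply: kq; rewrite inE js orbT.
set s := [seq _ | _ : _]; have <- : size s = N by rewrite size_image card_ord.
apply: Hs => k /mapP[n _ ->].
by case: (HA n).
Qed.

End itinerary_count.

Section power_sums.
Set Implicit Arguments.
Unset Strict Implicit.
Context {R : realType}.
Local Open Scope ring_scope.

(** Subadditivity of t^w: the ratios [a i / S] sum to 1 and lie in [0, 1], where t <= t^w. *)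
Lemma powR_sum_le (I : finType) (P : pred I) (a : I -> R) (w : R) :
  0 <= w <= 1 -> (forall i, 0 <= a i) -> 0 < \sum_(i | P i) a i ->
  (\sum_(i | P i) a i) `^ w <= \sum_(i | P i) a i `^ w.
Proof.
move=> /andP[w0 w1] a0; set S := \sum_(i | P i) a i => S0.
have S1 : \sum_(i | P i) a i / S = 1 by rewrite -mulr_suml divff// gt_eqF.
rewrite -[leLHS]mul1r -S1 mulr_suml; apply: ler_sum => i Pi.
have [->|ai0] := eqVneq (a i) 0; first by rewrite !mul0r powR_ge0.
have ai : 0 < a i by rewrite lt_neqAle eq_sym ai0 a0.
have aS : a i / S <= 1.
  rewrite ler_pdivrMr// mul1r /S (bigD1 i)//= lerDl; exact: sumr_ge0.
have -> : a i `^ w = (a i / S) `^ w * S `^ w.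
  by rewrite -powRM ?divr_ge0 ?(ltW S0)// divfK// gt_eqF.
rewrite ler_wpM2r ?powR_ge0//.
have aS0 : 0 < a i / S by rewrite divr_gt0.
have l0 : ln (a i / S) <= 0 by exact: ln_le0.
rewrite -[X in X `^ w](lnK (x := a i / S)) ?posrE// -expRM.
by rewrite -[leLHS]lnK ?posrE// ler_expR; nra.
Qed.

End power_sums.

Section finite_time_bound.
Set Implicit Arguments.
Unset Strict Implicit.
Context {R : realType} (X Y : pmetricType R) (T : X -> X) (S : Y -> Y).
Context (pi : X -> Y) (f : X -> R) (w : R).
Context (cX : compact [set: X]) (cT : continuous T) (cf : continuous f).
Context (cY : compact [set: Y]) (cS : continuous S).
Context (cpi : continuous pi) (spi : set_surj [set: X] [set: Y] pi).
Context (piT : pi \o T = S \o pi) (hw : (0 <= w <= 1)%R).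
Context (mu : probability (borel X) R).
Context (iT : forall A : set (borel X), measurable A -> mu (T @^-1` A) = mu A).
Local Open Scope ring_scope.

(** Each representative lies in a member of the cover whose weight dominates its own, and a member
    of the cover meets at most q^N itineraries, so it is charged at most q^N times. *)
Lemma sum_cells_le_cover (J : finType) (g : X -> J) (e : R) (q N : nat) (O : set X)
    (P : pred {ffun 'I_N -> J}) (x : {ffun 'I_N -> J} -> X) :
  0 < e -> (0 < q)%N -> small_set_count g e q ->
  (forall i, P i -> [ffun n : 'I_N => g (iter n T (x i))] = i /\ O (x i)) ->
  \sum_(i | P i) expR (birkhoff_sum T f N (x i)) <=
    (q ^ N)%:R * fine (cover_pressure T O f N e).
Proof.
move=> e0 q0 gq HP.
have qN : 0 < (q ^ N)%:R :> R by rewrite ltr0n expn_gt0 q0.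
rewrite mulrC -ler_pdivrMr// -lee_fin fineK ?(cover_pressure_fin cX cT cf)//.
apply: le_ereal_inf_tmp => _ [n [U [[oU OU dU] ->]]].
set wt := fun l => expeR (ereal_sup [set (birkhoff_sum T f N x)%:E | x in U l]).
have wt0 l : (0 <= wt l)%E by exact: expeR_ge0.
pose h (i : {ffun 'I_N -> J}) (l : 'I_n) := `[< U l (x i) >].
have H1 : ((\sum_(i | P i) expR (birkhoff_sum T f N (x i)))%:E <=
    \sum_(i | P i) \sum_(l | h i l) wt l)%E.
  rewrite -sumEFin; apply: lee_sum => i Pi; have [_ Oi] := HP i Pi.
  have [l _ Ul] := OU _ Oi; have hl : h i l by apply/asboolP.
  rewrite (bigD1 l)//=; apply: (@le_trans _ _ (wt l)).
    rewrite -[leLHS]/(expeR (birkhoff_sum T f N (x i))%:E) lee_expeR.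
    by apply: ereal_sup_ubound; exists (x i).
  by rewrite leeDl//; apply: sume_ge0 => *; exact: wt0.
have H2 : (\sum_(i | P i) \sum_(l | h i l) wt l <= ((q ^ N)%:R)%:E * \sum_l wt l)%E.
  rewrite (exchange_big_dep xpredT)//= ge0_sume_distrr; last by move=> l _; exact: wt0.
  apply: lee_sum => l _.
  have [|A Aq HA] := @itinerary_count R X T J g e q N (U l) e0 gq.
    by move=> y z Uy Uz; have := bowen_diam_lt (dU l) Uy Uz; rewrite lte_fin.
  rewrite (eq_bigr (fun=> 1%:E * wt l)%E) => [|i _]; last by rewrite mul1e.
  rewrite -ge0_sume_distrl//; apply: lee_wpmul2r; first exact: wt0.
  rewrite sumEFin sumr_const lee_fin ler_nat; apply: leq_trans Aq; apply: subset_leq_card.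
  apply/fintype.subsetP => i; rewrite unfold_in => /andP[/HP[E _] /asboolP Ui].
  by rewrite -E; exact: HA.
rewrite EFinM muleC; apply: (@le_trans _ _ (((q ^ N)%:R^-1)%:E *
    (((q ^ N)%:R)%:E * \sum_l wt l))%E).
  apply: lee_wpmul2l; first by rewrite lee_fin invr_ge0 ltW.
  exact: le_trans H2.
by rewrite muleA -EFinM mulVf ?gt_eqF// mul1e.
Qed.

(** Cells need not be closed, so a supremum over a cell may not be attained; the slack 1 goes into
    the additive constant of the finite-time bound. *)
Lemma exists_near_max (A : set X) (F : X -> R) (C : R) : A !=set0 ->
  (forall x, `|F x| <= C) -> exists2 x, A x & forall y, A y -> F y <= F x + 1.
Proof.
move=> [a Aa] FC.
have hs : has_sup (F @` A).
  split; first by exists (F a), a.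
  by exists C => _ [x _ <-]; exact: le_trans (ler_norm _) (FC x).
have [_ [x Ax <-] Hx] := sup_adherent ltr01 hs.
exists x => // y Ay; have : F y <= sup (F @` A).
  by apply: sup_ubound; [case: hs|exists y].
lra.
Qed.

Local Notation m := (fine \o mu).

(* ln 8 = ln 4 + ln 2: the number of N-itineraries met by a small set is at most
   4^N in X and 2^N in Y. *)
Lemma finite_time_bound (K I : finType) (b : borel X -> K) (c : borel Y -> I) (e : R) N :
  0 < e -> finite_measurable b -> finite_measurable c ->
  small_set_count (fun x : X => (b x, c (pi x))) e 4 ->
  small_set_count (c : Y -> I) e 2 ->
  w * map_entropy m (itinerary (T : borel X -> borel X) (fun x => (b x, c (pi x))) N) +
    (1 - w) * map_entropy m (itinerary (T : borel X -> borel X) (c \o pi) N) +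
    w * (N%:R * \int[mu]_x f x) <=
  log_weighted_cover_pressure T S pi f w N e + 1 + N%:R * ln 8.
Proof.
move=> e0 mb mc g4 c2.
have /andP[w0 w1] := hw.
have hm := fap_probability mu.
pose g (x : borel X) := (b x, c (pi x)).
pose TB : borel X -> borel X := T.
have mT (A : set (borel X)) : measurable A -> measurable (TB @^-1` A).
  by move=> mA; exact: borel_preimage.
have mcp : finite_measurable (c \o pi : borel X -> I).
  by move=> i; exact: (borel_preimage cpi (mc i)).
have mg : finite_measurable g by exact: finite_measurable_pair.
pose G := itinerary TB g N.
have mG : finite_measurable G by exact: finite_measurable_itinerary.
pose phi (a : {ffun 'I_N -> K * I}) : {ffun 'I_N -> I} := [ffun n => (a n).2].
have phiG : itinerary TB (c \o pi) N = phi \o G.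
  by apply/funext => x; apply/ffunP => n /=; rewrite !ffunE.
pose p i := m (cell G i); pose q j := m (cell (itinerary TB (c \o pi) N) j).
have p0 i : 0 <= p i by case: hm => + _ _; apply.
have [C C0 fC] := continuous_bounded cX cf.
have [x Hx] : exists x : {ffun 'I_N -> K * I} -> X, forall i, cell G i !=set0 ->
    cell G i (x i) /\
    forall y, cell G i y -> birkhoff_sum T f N y <= birkhoff_sum T f N (x i) + 1.
  suff /choice[x Hx] : forall i, exists x, cell G i !=set0 -> cell G i x /\
    forall y, cell G i y -> birkhoff_sum T f N y <= birkhoff_sum T f N x + 1 by exists x.
  move=> i; have [ne|ne] := pselect (cell G i !=set0); last by exists point => /ne.
  have [x cx Hx] := exists_near_max ne (fun x => birkhoff_sum_bound T N x fC).
  by exists x.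
(* [P] and [Q] select the words that occur: only these have a representative point that can be
   charged to a cover. *)
pose P i := `[< cell G i !=set0 >].
pose Q j := `[< exists i, phi i = j /\ P i >].
pose cc i := birkhoff_sum T f N (x i) + 1.
pose Z j := \sum_(i | (phi i == j) && P i) expR (cc i).
have pP i : p i != 0 -> P i.
  move=> pi0; apply/asboolP; apply: contrapT => /set0P/negP/negPn/eqP ci.
  by move: pi0; rewrite /p ci /= measure0 eqxx.
have qE j : q j = \sum_(i | phi i == j) p i.
  by rewrite /q phiG (fap_image hm).
have qQ j : q j != 0 -> Q j.
  rewrite qE psumr_neq0// => /hasP[i _ /= /andP[/eqP ij pi0]]; apply/asboolP.
  by exists i; split => //; apply: pP; rewrite gt_eqF.
pose A := map_entropy m G; pose B := map_entropy m (itinerary TB (c \o pi) N).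
have gibbs : w * A + (1 - w) * B + w * \sum_i p i * cc i <= ln (\sum_(j | Q j) Z j `^ w) :=
  weighted_gibbs_inequality w0 p0 (fap_sum1 hm mG) pP qQ qE (fun j => erefl (Z j)).
have int : N%:R * \int[mu]_x f x <= \sum_i p i * cc i.
  rewrite -(Rintegral_birkhoff_sum cX cT iT)//.
  apply: (@Rintegral_le_cells R X mu cX _ G (birkhoff_sum T f N) cc mG).
    exact: birkhoff_sum_continuous.
  by move=> y; have [|_] := Hx (G y); [exists y|apply].
have wint := ler_wpM2l w0 int.
rewrite -[leLHS]/(w * A + (1 - w) * B + w * (N%:R * \int[mu]_x f x)).
suff main : \sum_(j | Q j) Z j `^ w <=
    expR (log_weighted_cover_pressure T S pi f w N e) * (expR 1 * (8 ^ N)%:R).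
  have ln_main : ln (\sum_(j | Q j) Z j `^ w) <=
      log_weighted_cover_pressure T S pi f w N e + 1 + N%:R * ln 8.
    have N8 : 0 < (8 ^ N)%:R :> R by rewrite ltr0n expn_gt0.
    have -> : log_weighted_cover_pressure T S pi f w N e + 1 + N%:R * ln 8 =
        ln (expR (log_weighted_cover_pressure T S pi f w N e) * (expR 1 * (8 ^ N)%:R)).
      rewrite !lnM ?posrE ?mulr_gt0 ?expR_gt0// !expRK natrX lnXn ?ltr0n//.
      by rewrite mulr_natl addrA.
    have [s0|s0] := ltP 0 (\sum_(j | Q j) Z j `^ w).
      by rewrite ler_ln ?posrE ?mulr_gt0 ?expR_gt0.
    have Qj : Q (phi (G point)).
      by apply/asboolP; exists (G point); split=> //; apply/asboolP; exists point.
    have PG : P (G point) by apply/asboolP; exists point.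
    have ZG : 0 < Z (phi (G point)).
      rewrite /Z (bigD1 (G point)) ?eqxx ?PG//= ltr_pwDl ?expR_gt0//.
      by apply: sumr_ge0 => *; exact: expR_ge0.
    move: s0; rewrite leNgt (bigD1 (phi (G point)))//= ltr_pwDl ?powR_gt0//.
    by apply: sumr_ge0 => *; exact: powR_ge0.
  apply: le_trans ln_main; apply: le_trans gibbs; by rewrite lerD2l.
have e8 : 0 < expR 1 * (8 ^ N)%:R :> R by rewrite mulr_gt0 ?expR_gt0// ltr0n expn_gt0.
rewrite -ler_pdivrMr// -lee_fin.
rewrite (expR_log_weighted_cover_pressure cX cT cf cY cS spi hw N e0).
apply: le_ereal_inf_tmp => _ [n [V [[oV YV dV] ->]]].
pose a k := fine (cover_pressure T (pi @^-1` V k) f N e).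
have aE k : cover_pressure T (pi @^-1` V k) f N e = (a k)%:E.
  by rewrite fineK// (cover_pressure_fin cX cT cf).
have a0 k : 0 <= a k by rewrite fine_ge0// cover_pressure_ge0.
rewrite (eq_bigr (fun k => (a k `^ w)%:E)) => [|k _]; last by rewrite aE poweR_EFin.
rewrite sumEFin lee_fin ler_pdivrMr//.
(* [r j k] says that [V k] meets the cell of Y with itinerary j. [Z j] is charged to these k only,
   and each k to at most 2^N words j. *)
pose r (j : {ffun 'I_N -> I}) k :=
  `[< exists2 y, V k y & [ffun n : 'I_N => c (iter n S y)] = j >].
have Zle j : Z j <= expR 1 * (4 ^ N)%:R * \sum_(k | r j k) a k.
  have -> : Z j = expR 1 * \sum_(i | (phi i == j) && P i) expR (birkhoff_sum T f N (x i)).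
    by rewrite big_distrr/=; apply: eq_bigr => i _; rewrite /cc expRD mulrC.
  rewrite -mulrA ler_wpM2l ?expR_ge0//.
  pose h (i : {ffun 'I_N -> K * I}) k := `[< V k (pi (x i)) >].
  have xG i : P i -> [ffun n : 'I_N => g (iter n T (x i))] = i.
    by move=> /asboolP/Hx[].
  have phix i : P i -> [ffun n : 'I_N => c (iter n S (pi (x i)))] = phi i.
    move=> Pi; rewrite -{2}(xG i Pi); apply/ffunP => l; rewrite !ffunE/=.
    by rewrite (factor_iter piT).
  apply: (@le_trans _ _ (\sum_(i | (phi i == j) && P i) \sum_(k | r j k && h i k)
      expR (birkhoff_sum T f N (x i)))).
    apply: ler_sum => i /andP[/eqP ij Pi].
    have [k _ Vk] := YV (pi (x i)) Logic.I.
    have rk : r j k && h i k.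
      apply/andP; split; apply/asboolP => //.
      by exists (pi (x i)) => //; rewrite phix.
    by rewrite (bigD1 k)//= lerDl; apply: sumr_ge0 => *; exact: expR_ge0.
  rewrite (exchange_big_dep (r j))/=; last by move=> i k _ /andP[].
  rewrite big_distrr/=; apply: ler_sum => k rk.
  apply: (@sum_cells_le_cover _ g e 4 N (pi @^-1` V k)) => // i.
  by move=> /and3P[/andP[_ Pi] _ /asboolP Vk]; rewrite xG.
(* The constant is at least 1 and w <= 1, so its w-th power is at most the constant itself. *)
have Zw j : Q j -> Z j `^ w <= expR 1 * (4 ^ N)%:R * \sum_(k | r j k) a k `^ w.
  move=> /asboolP[i [ij Pi]].
  have Z0 : 0 < Z j.
    by rewrite /Z (bigD1 i) ?ij ?eqxx//= ltr_pwDl ?expR_gt0// sumr_ge0// => *; exact: expR_ge0.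
  have E0 : 0 < expR 1 * (4 ^ N)%:R :> R by rewrite mulr_gt0 ?expR_gt0// ltr0n expn_gt0.
  have E1 : 1 <= expR 1 * (4 ^ N)%:R :> R.
    rewrite -[leLHS]mulr1; apply: ler_pM => //; last by rewrite ler1n expn_gt0.
    by have := @expR_ge1Dx R 1; lra.
  have S0 : 0 < \sum_(k | r j k) a k.
    by have := lt_le_trans Z0 (Zle j); rewrite pmulr_rgt0.
  apply: (@le_trans _ _ ((expR 1 * (4 ^ N)%:R * \sum_(k | r j k) a k) `^ w)).
    by apply: ge0_ler_powR; rewrite ?nnegrE ?Zle// ltW// mulr_gt0.
  rewrite powRM ?(ltW E0) ?(ltW S0)//; apply: ler_pM; rewrite ?powR_ge0//.
    by rewrite -[leRHS]powRr1 ?(ltW E0)// ler_powR.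
  exact: powR_sum_le.
apply: (@le_trans _ _ (\sum_(j | Q j) expR 1 * (4 ^ N)%:R * \sum_(k | r j k) a k `^ w)).
  exact: ler_sum.
rewrite -big_distrr/=.
have -> : expR 1 * (8 ^ N)%:R = expR 1 * (4 ^ N)%:R * (2 ^ N)%:R :> R.
  by rewrite -mulrA -natrM -expnMn.
rewrite [leRHS]mulrC -[leRHS]mulrA ler_wpM2l ?mulr_ge0 ?expR_ge0//.
apply: (@le_trans _ _ (\sum_j \sum_(k | r j k) a k `^ w)).
  rewrite [leRHS](bigID Q)/= lerDl; apply: sumr_ge0 => j _; apply: sumr_ge0 => k _.
  exact: powR_ge0.
rewrite (exchange_big_dep xpredT)//= big_distrr/=; apply: ler_sum => k _.
rewrite sumr_const -[leLHS]mulr_natl ler_wpM2r ?powR_ge0// ler_nat.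
have [|D Dq HD] := @itinerary_count R Y S I c e 2 N (V k) e0 c2.
  by move=> y z Vy Vz; have := bowen_diam_lt (dV k) Vy Vz; rewrite lte_fin.
apply: leq_trans Dq; apply: subset_leq_card.
by apply/fintype.subsetP => j; rewrite unfold_in => /asboolP[y Vy <-]; exact: HD.
Qed.

End finite_time_bound.

(** * Approximation of partitions by separated closed cells *)

Section closed_approximation.
Set Implicit Arguments.
Unset Strict Implicit.
Context {R : realType} (X : pmetricType R) (mu : probability (borel X) R).
Context (cX : compact [set: X]).
Local Open Scope ring_scope.
Local Notation m := (fine \o mu).

(* The cells of g are shrunk to closed subsets, which are at positive distance
   from each other; None collects the small remainder. *)
Lemma closed_approximation (I : finType) (g : borel X -> I) : finite_measurable g ->
  exists g' : borel X -> option I, [/\ finite_measurable g',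
    map_entropy m (fun x => (g x, g' x)) - map_entropy m g' <= 1 &
    exists2 e : R, 0 < e & small_set_count (g' : X -> option I) e 2].
Proof.
move=> mg; have hm := fap_probability mu.
have I0 : (0 < #|I|)%N by apply/card_gt0P; exists (g point).
(* Each lost piece may contribute 1/#|I| to the entropy, hence 1 in total. *)
have [d d0 Hd] := @entropy_term_small R (#|I|%:R^-1) ltac:(by rewrite invr_gt0 ltr0n).
have /choice[K HK] : forall i, exists K : set X, [/\ closed K, K `<=` cell g i &
    (mu (cell g i `\` K) <= d%:E)%E].
  by move=> i; exact: (closed_inner_regularity mu (mg i) d0).
have mK i : measurable (K i : set (borel X)).
  by apply: measurable_closed; case: (HK i).
pose k (x : borel X) := `[< K (g x) x >].
have kP x : reflect (K (g x) x) (k x) by exact: asboolP.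
pose g' (x : borel X) := if k x then Some (g x) else None.
have cSome i : cell g' (Some i) = K i.
  apply/seteqP; split=> x; rewrite /cell /g' /=.
    by case: kP => // Kx [<-].
  move=> Kx; have gx : g x = i by case: (HK i) => _ /(_ x Kx).
  by case: kP => [_|]; rewrite gx.
have mg' : finite_measurable g'.
  case=> [i|]; first by rewrite cSome.
  rewrite (_ : cell g' None = ~` \bigcup_(i in [set: I]) K i).
    by apply: measurableC; apply: fin_bigcup_measurable => //; exact: finite_finset.
  apply/seteqP; split=> x; rewrite /cell /g' /=.
    case: kP => // nK _ [i _ Kx]; apply: nK.
    by have -> : g x = i by case: (HK i) => _ /(_ x Kx).
  by case: kP => // Kx nK; exfalso; apply: nK; exists (g x).
have mk : finite_measurable k.
  have -> : k = (fun o : option I => if o is Some _ then true else false) \o g'.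
    by apply/funext => x /=; rewrite /g'; case: (k x).
  exact: finite_measurable_comp.
have c1 i : cell (fun x => (g x, k x)) (i, true) = K i.
  rewrite -cSome; apply/seteqP; split=> x; rewrite /cell /g'/=.
    by move=> [<- ->].
  by case: (k x) => // -[<-].
have c2 i : cell (fun x => (g x, k x)) (i, false) = cell g i `\` K i.
  apply/seteqP; split=> x; rewrite /cell/=.
    by case=> <-; case: kP.
  by case=> gi nK; congr (_, _) => //; case: kP => //; rewrite gi.
exists g'; split => //.
(* The pair ([g], [k]) determines ([g], [g']), and its cells are the [K i] and the lost pieces. The
   [K i] are also cells of [g'], so only the lost pieces contribute to the difference of
   entropies. *)
- have mgk : finite_measurable (fun x => (g x, k x)) by exact: finite_measurable_pair.
  have le1 : map_entropy m (fun x => (g x, g' x)) <= map_entropy m (fun x => (g x, k x)).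
    by apply: map_entropy_le => // x y [gxy kxy]; rewrite /g' gxy kxy.
  have eq1 : map_entropy m (fun x => (g x, k x)) =
      \sum_i - (m (K i) * ln (m (K i))) +
      \sum_i - (m (cell g i `\` K i) * ln (m (cell g i `\` K i))).
    have split (F : I * bool -> R) : \sum_p F p = \sum_i (F (i, true) + F (i, false)).
      rewrite (eq_bigr (fun p => F (p.1, p.2))) => [|[]//].
      rewrite -(pair_bigA _ (fun i b => F (i, b)))/=.
      by apply: eq_bigr => i _; rewrite big_bool.
    rewrite /map_entropy -sumrN split -big_split/=.
    by apply: eq_bigr => i _; rewrite c1 c2.
  have ge1 : \sum_i - (m (K i) * ln (m (K i))) <= map_entropy m g'.
    rewrite /map_entropy -sumrN (bigID (fun o : option I => o))/=.
    rewrite -[leLHS]addr0; apply: lerD; last first.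
      apply: sumr_ge0 => o _; apply: entropy_term_ge0.
      by rewrite fine_ge0//= (fap_le1 hm).
    rewrite (reindex_omap Some id) => [|[]//].
    rewrite [leRHS](eq_bigl xpredT) => [|i]; last by rewrite /= eqxx.
    by apply: ler_sum => i _; rewrite cSome.
  have le2 : \sum_i - (m (cell g i `\` K i) * ln (m (cell g i `\` K i))) <= 1.
    apply: (@le_trans _ _ (\sum_(i : I) #|I|%:R^-1)).
      apply: ler_sum => i _; apply: Hd; rewrite fine_ge0//=.
      have [cK _ le] := HK i.
      have mD : measurable (cell g i `\` K i : set (borel X)) by exact: measurableD.
      by rewrite -lee_fin fineK// fin_num_measure.
    by rewrite sumr_const -[leLHS]mulr_natl divff// pnatr_eq0 -lt0n.
  lra.
(* Near x only those closed cells occur that contain x, and they are disjoint. By the Lebesgue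
   number, a small set meets at most one closed cell besides the remainder [None], which is the
   multiplicity 2. *)
- pose Pr (y z : X) := forall i j, K i y -> K j z -> i = j.
  have [|e e0 He] := @lebesgue_number R X Pr cX.
    move=> x.
    have oU : open (~` \bigcup_(i in [set i | ~ K i x]) K i).
      apply: closed_openC; apply: closed_bigcup; first exact: finite_finset.
      by move=> i _; case: (HK i).
    have Ux : (~` \bigcup_(i in [set i | ~ K i x]) K i) x by move=> [i /= nK /nK].
    have : nbhs x (~` \bigcup_(i in [set i | ~ K i x]) K i).
      by move: oU; rewrite openE; exact.
    rewrite -nbhs_ballE => -[r /= r0 Hr]; exists r => // y z xy xz i j Ky Kz.
    have Kx l u : mdist x u < r -> K l u -> K l x.
      move=> xu Ku; apply: contrapT => nK.
      have := Hr u; rewrite ballEmdist/= => /(_ xu); apply.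
      by exists l.
    have gl l : K l x -> g x = l by case: (HK l) => _ H _; exact: H.
    by rewrite -(gl i (Kx i y xy Ky)) (gl j (Kx j z xz Kz)).
  exists e => // U HU.
  have [[x [Ux kx]]|nx] := pselect (exists x, U x /\ k x).
    exists [set None; Some (g x)]%SET; first by rewrite cards2; case: eqP.
    move=> y Uy; rewrite !inE /g'; case: ifPn => ky; last by rewrite eqxx.
    apply/orP; right; apply/eqP; congr Some.
    by apply: (He y x (HU y x Uy Ux)); apply/asboolP.
  exists [set None]%SET; first by rewrite cards1.
  move=> y Uy; rewrite inE /g'; case: ifPn => // ky.
  by exfalso; apply: nx; exists y.
Qed.

End closed_approximation.

(** * Passing to iterates *)

Section power_systems.
Set Implicit Arguments.
Unset Strict Implicit.
Context {R : realType}.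
Local Open Scope ring_scope.

Lemma iter_iter (X : Type) (T : X -> X) n i x : iter i (iter n T) x = iter (i * n) T x.
Proof. by elim: i => //= i ->; rewrite mulSn iterD. Qed.

Lemma birkhoff_sum_iter (X : pmetricType R) (T : X -> X) (f : X -> R) n N x :
  birkhoff_sum (iter n T) (birkhoff_sum T f n) N x = birkhoff_sum T f (N * n) x.
Proof.
elim: N => [|N IH]; first by rewrite /birkhoff_sum !big_ord0.
by rewrite -addn1 mulnDl mul1n !birkhoff_sumD IH iter_iter {2}/birkhoff_sum big_ord1.
Qed.

Lemma bowen_diam_iter (X : pmetricType R) (T : X -> X) n N (U : set X) : (0 < n)%N ->
  (bowen_diam (iter n T) N U <= bowen_diam T (N * n) U)%E.
Proof.
move=> n0; apply: ub_ereal_sup => _ [x [y [Ux Uy ->]]].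
apply: (@le_trans _ _ (bowen_dist T (N * n) x y)%:E).
  rewrite lee_fin; apply/bowen_dist_leP => [|i iN]; first exact: bowen_dist_ge0.
  by rewrite !iter_iter; apply: bowen_dist_ge; rewrite ltn_pmul2r.
by apply: ereal_sup_ubound; exists x, y.
Qed.

(** The Bowen metric of the iterate samples fewer times, so a cover admissible for [T] at time N n
    stays admissible for the iterate at time N, with the same weights. *)
Lemma cover_pressure_iter (X : pmetricType R) (T : X -> X) (f : X -> R) n O N e :
  (0 < n)%N -> (cover_pressure (iter n T) O (birkhoff_sum T f n) N e <=
    cover_pressure T O f (N * n) e)%E.
Proof.
move=> n0; apply: le_ereal_inf => _ [k [U [[oU OU dU] ->]]].
exists k, U; split.
  by split=> // i; exact: (le_lt_trans (bowen_diam_iter T N (U i) n0)).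
apply: eq_bigr => i _; congr (expeR (ereal_sup _)).
by apply/seteqP; split=> _ [x Ux <-]; exists x => //; rewrite birkhoff_sum_iter.
Qed.

Lemma weighted_cover_pressure_iter (X Y : pmetricType R) (T : X -> X) (S : Y -> Y)
    (pi : X -> Y) (f : X -> R) (w e : R) n N : 0 <= w <= 1 -> (0 < n)%N ->
  (weighted_cover_pressure w pi (iter n T) (iter n S) (birkhoff_sum T f n) N e <=
   weighted_cover_pressure w pi T S f (N * n) e)%E.
Proof.
move=> hw n0; apply: le_ereal_inf_tmp => _ [k [V [[oV YV dV] ->]]].
apply: (@le_trans _ _ (\sum_(i < k) (cover_pressure (iter n T) (pi @^-1` V i)
    (birkhoff_sum T f n) N e) `^ w)%E).
  apply: ereal_inf_lbound; exists k, V; split=> //; split=> // i.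
  exact: (le_lt_trans (bowen_diam_iter S N (V i) n0)).
apply: lee_sum => i _; apply: poweR_le => //; first exact: cover_pressure_ge0.
exact: cover_pressure_iter.
Qed.

End power_systems.

Section variational_lower_bound.
Set Implicit Arguments.
Unset Strict Implicit.
Context {R : realType} (X Y : pmetricType R).
Context (pi : X -> Y) (w : R).
Context (cX : compact [set: X]) (cY : compact [set: Y]).
Context (cpi : continuous pi) (spi : set_surj [set: X] [set: Y] pi).
Context (hw : (0 <= w <= 1)%R) (mu : probability (borel X) R).
Local Open Scope ring_scope.
Local Notation m := (fine \o mu).

Let mpi : measurable_fun [set: borel X] (pi : borel X -> borel Y).
Proof. by move=> _ A mA; rewrite setTI; exact: borel_preimage. Qed.

Lemma pushforward_probability :
  exists nu : probability (borel Y) R, forall A, nu A = mu (pi @^-1` A).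
Proof.
pose H : {mfun borel X >-> borel Y} :=
  HB.pack_for {mfun borel X >-> borel Y} pi
    (@isMeasurableFun.Build _ _ (borel X) (borel Y) pi mpi).
by exists (distribution mu H).
Qed.

Section one_system.
Context (T : X -> X) (S : Y -> Y) (f : X -> R).
Context (cT : continuous T) (cf : continuous f) (cS : continuous S).
Context (piT : pi \o T = S \o pi).
Context (iT : forall A : set (borel X), measurable A -> mu (T @^-1` A) = mu A).

Let TB : borel X -> borel X := T.
Let mT (A : set (borel X)) : measurable A -> measurable (TB @^-1` A).
Proof. by move=> mA; exact: borel_preimage. Qed.
Let imT (A : set (borel X)) : measurable A -> m (TB @^-1` A) = m A.
Proof. by move=> mA; rewrite /= iT. Qed.

(** The term [ln 8] is the counting loss per unit of time. The 1 is w + (1 - w), the cost of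
    replacing [b] and [c] by closed approximations; the additive 1 of the finite-time bound vanishes
    after division by N. *)
Lemma entropy_le_pressure_rate (I J : finType) (b : borel X -> I) (c : borel Y -> J) :
  finite_measurable b -> finite_measurable c ->
  exists2 e : R, 0 < e &
    w * entropy_rate m TB b + (1 - w) * entropy_rate m TB (c \o pi) + w * \int[mu]_x f x <=
    weighted_pressure_rate T S pi f w e + ln 8 + 1.
Proof.
move=> mb mc; have hm := fap_probability mu; have /andP[w0 w1] := hw.
have [nu nuE] := pushforward_probability.
have [b' [mb' Hb [eb eb0 kb]]] := closed_approximation mu cX mb.
have [c' [mc' Hc [ec ec0 kc]]] := closed_approximation nu cY mc.
have [d d0 Hd] := continuous_uniform cX cpi ec0.
pose e := Num.min (Num.min eb d) ec.
have e0 : 0 < e by rewrite !lt_min eb0 d0 ec0.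
exists e => //.
have mp (K : finType) (h : borel Y -> K) : finite_measurable h ->
    finite_measurable (h \o pi : borel X -> K).
  by move=> mh i; exact: (borel_preimage cpi (mh i)).
pose g (x : borel X) := (b' x, c' (pi x)).
have mg : finite_measurable g by apply: finite_measurable_pair => //; exact: mp.
have kg : small_set_count (fun x : X => (b' x, c' (pi x))) e 4.
  move=> U HU.
  have [|A A2 HA] := kb U.
    by move=> x y Ux Uy; apply: (lt_le_trans (HU x y Ux Uy)); rewrite /e !ge_min lexx.
  have [|B B2 HB] := kc (pi @` U).
    move=> _ _ [x Ux <-] [y Uy <-]; apply: Hd.
    by apply: (lt_le_trans (HU x y Ux Uy)); rewrite /e !ge_min lexx orbT.
  exists (finset.setX A B); first by rewrite cardsX (leq_mul A2 B2).
  by move=> x Ux; rewrite finset.in_setX HA// HB//; exists x.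
have kc' : small_set_count (c' : Y -> _) e 2.
  by move=> U HU; apply: kc => x y Ux Uy; apply: (lt_le_trans (HU x y Ux Uy));
    rewrite /e ge_min lexx orbT.
have rb : entropy_rate m TB b <= entropy_rate m TB g + 1.
  apply: le_trans (entropy_rate_le_cond mT hm imT mb mg) _; rewrite lerD2l.
  (* Conditioning on more lowers entropy: H(b | b', c' o pi) <= H(b | b') <= 1. *)
  have := map_entropy_submodular hm mb (mp _ _ mc') mb'.
  have -> : map_entropy m (fun x => (b x, g x)) =
      map_entropy m (fun x => ((b x, (c' \o pi) x), b' x)).
    apply: (map_entropy_eq hm); try by repeat apply: finite_measurable_pair => //; exact: mp.
    by move=> x y; rewrite /g /=; split => -[-> -> ->].
  have -> : map_entropy m g = map_entropy m (fun x => ((c' \o pi) x, b' x)).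
    apply: (map_entropy_eq hm); try by repeat apply: finite_measurable_pair => //; exact: mp.
    by move=> x y; rewrite /g /=; split => -[-> ->].
  move: Hb; lra.
have rc : entropy_rate m TB (c \o pi) <= entropy_rate m TB (c' \o pi) + 1.
  apply: le_trans (entropy_rate_le_cond mT hm imT (mp _ _ mc) (mp _ _ mc')) _.
  rewrite lerD2l; apply: le_trans Hc.
  have nuH (K : finType) (h : borel Y -> K) :
      map_entropy (fine \o nu) h = map_entropy m (h \o pi).
    by rewrite /map_entropy; congr (- _); apply: eq_bigr => i _; rewrite /= nuE.
  by rewrite !nuH.
have lim1 := entropy_rate_cvg mT hm imT mg.
have lim2 := entropy_rate_cvg mT hm imT (mp _ _ mc').
have lim3 := weighted_pressure_rate_cvg cX cT cf cY cS spi piT hw e0.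
set F := weighted_pressure_rate T S pi f w e in lim3 *.
have key : w * entropy_rate m TB g + (1 - w) * entropy_rate m TB (c' \o pi) +
    w * \int[mu]_x f x <= F + 0 + ln 8.
  apply: (ler_cvg_to (a := \oo) (f := fun N : nat =>
      w * (map_entropy m (itinerary TB g N) / N%:R) +
      (1 - w) * (map_entropy m (itinerary TB (c' \o pi) N) / N%:R) + w * \int[mu]_x f x)
    (g := fun N : nat => log_weighted_cover_pressure T S pi f w N e / N%:R + N%:R^-1 + ln 8)).
  - apply: cvgD; last exact: cvg_cst.
    by apply: cvgD; apply: cvgM => //; exact: cvg_cst.
  - apply: cvgD; last exact: cvg_cst.
    apply: cvgD => //; apply/gtr0_cvgV0; last exact: cvgr_idn.
    by near=> N; rewrite ltr0n; near: N; exact: nbhs_infty_gt.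
  - near=> N; have N0 : (0 < N)%N by near: N; exact: nbhs_infty_gt.
    have NR : 0 < N%:R :> R by rewrite ltr0n.
    have := finite_time_bound cX cT cf cY cS cpi spi piT hw iT N e0 mb' mc' kg kc'.
    rewrite -(ler_pM2l (x := N%:R^-1)) ?invr_gt0// => H.
    set A := map_entropy m (itinerary TB g N) in H *.
    set B := map_entropy m (itinerary TB (c' \o pi) N) in H *.
    set L := log_weighted_cover_pressure T S pi f w N e in H *.
    have N1 : N%:R * (N%:R)^-1 = 1 :> R by rewrite divff// gt_eqF.
    set D := \int[mu]_x f x in H *.
    have E1 : N%:R^-1 * (w * A + (1 - w) * B + w * (N%:R * D)) =
        w * (A / N%:R) + (1 - w) * (B / N%:R) + w * D.
      by field; rewrite gt_eqF.
    have E2 : N%:R^-1 * (L + 1 + N%:R * ln 8) = L / N%:R + N%:R^-1 + ln 8.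
      by field; rewrite gt_eqF.
    by rewrite -E1 -E2.
have := ler_wpM2l w0 rb.
have : (1 - w) * entropy_rate m TB (c \o pi) <= (1 - w) * (entropy_rate m TB (c' \o pi) + 1).
  by rewrite ler_wpM2l// subr_ge0.
move: key; clear; move: (\int[mu]_x f x) (entropy_rate m TB b) (entropy_rate m TB g)
  (entropy_rate m TB (c \o pi)) (entropy_rate m TB (c' \o pi)) F (ln 8).
by move=> *; lra.
Unshelve. all: by end_near.
Qed.

End one_system.

Section sup.
Context (T : X -> X) (S : Y -> Y) (f : X -> R).
Context (cT : continuous T) (cf : continuous f) (cS : continuous S).
Context (piT : pi \o T = S \o pi).
Context (iT : forall A : set (borel X), measurable A -> mu (T @^-1` A) = mu A).

Let TB : borel X -> borel X := T.
Let mT (A : set (borel X)) : measurable A -> measurable (TB @^-1` A).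
Proof. by move=> mA; exact: borel_preimage. Qed.
Let imT (A : set (borel X)) : measurable A -> m (TB @^-1` A) = m A.
Proof. by move=> mA; rewrite /= iT. Qed.

Lemma weighted_pressure_rate_iter n (e : R) : (0 < n)%N -> 0 < e ->
  weighted_pressure_rate (iter n T) (iter n S) pi (birkhoff_sum T f n) w e <=
  n%:R * weighted_pressure_rate T S pi f w e.
Proof.
move=> n0 e0; have cTn : continuous (iter n T) by exact: continuous_iter.
  have cSn : continuous (iter n S) by exact: continuous_iter.
have cfn : continuous (birkhoff_sum T f n) by exact: birkhoff_sum_continuous.
have piTn : pi \o iter n T = iter n S \o pi.
  by apply/funext => x /=; rewrite (factor_iter piT).
have lim1 := weighted_pressure_rate_cvg cX cTn cfn cY cSn spi piTn hw e0.
have lim2 := weighted_pressure_rate_cvg cX cT cf cY cS spi piT hw e0.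
have sub : (fun N => N * n)%N @ \oo --> \oo.
  by apply: cvg_mulnr.
have := cvg_comp _ _ sub lim2 => lim3.
have lim4 : n%:R * (log_weighted_cover_pressure T S pi f w (N * n) e / (N * n)%:R)
    @[N --> \oo] --> n%:R * weighted_pressure_rate T S pi f w e.
  by apply: cvgM; [exact: cvg_cst|exact: lim3].
apply: (ler_cvg_to lim1 lim4).
near=> N; have N0 : (0 < N)%N by near: N; exact: nbhs_infty_gt.
have E : n%:R * (log_weighted_cover_pressure T S pi f w (N * n) e / (N * n)%:R) =
    log_weighted_cover_pressure T S pi f w (N * n) e / N%:R.
  by rewrite natrM; field; rewrite !pnatr_eq0 -!lt0n N0.
rewrite /= E ler_wpM2r// ler_ln ?posrE.
- apply: fine_le; last exact: weighted_cover_pressure_iter.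
  + exact: (weighted_cover_pressure_fin cX cTn cfn cY cSn).
  + exact: (weighted_cover_pressure_fin cX cT cf cY cS).
- exact: (fine_weighted_cover_pressure_gt0 cX cTn cfn cY cSn).
- exact: (fine_weighted_cover_pressure_gt0 cX cT cf cY cS).
Unshelve. all: by end_near.
Qed.

(** The n-th iterates are taken with the n-step itineraries of [b] and [c], so entropies and
    integral scale by n while the error stays [ln 8 + 1]. The scale [e] obtained depends on n, which
    is why [p] has to bound the rates at all scales. *)
Lemma entropy_le_pressure (I J : finType) (b : borel X -> I) (c : borel Y -> J) (p : R) :
  finite_measurable b -> finite_measurable c ->
  (forall e, 0 < e -> weighted_pressure_rate T S pi f w e <= p) ->
  w * entropy_rate m TB b + (1 - w) * entropy_rate m TB (c \o pi) + w * \int[mu]_x f x <= p.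
Proof.
move=> mb mc Fp; set E := (X in X <= _).
have H n : (0 < n)%N -> n%:R * E <= n%:R * p + (ln 8 + 1).
  move=> n0; have cTn : continuous (iter n T) by exact: continuous_iter.
  have cSn : continuous (iter n S) by exact: continuous_iter.
  have cfn : continuous (birkhoff_sum T f n) by exact: birkhoff_sum_continuous.
  have piTn : pi \o iter n T = iter n S \o pi.
    by apply/funext => x /=; rewrite (factor_iter piT).
  have iTn (A : set (borel X)) : measurable A -> mu (iter n T @^-1` A) = mu A.
    move=> mA; have mTA := measurable_preimage_iter mT n mA.
    rewrite -[LHS]fineK ?fin_num_measure// -[RHS]fineK ?fin_num_measure//; congr EFin.
    exact: (invariant_iter mT imT n mA).
  have mSB (A : set (borel Y)) : measurable A -> measurable (S @^-1` A : set (borel Y)).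
    by move=> mA; exact: borel_preimage.
  have mbn : finite_measurable (itinerary TB b n) by exact: finite_measurable_itinerary.
  have mcn : finite_measurable (itinerary (S : borel Y -> borel Y) c n).
    exact: finite_measurable_itinerary.
  have [e e0 He] := entropy_le_pressure_rate cTn cfn cSn piTn iTn mbn mcn.
  have mcp : finite_measurable (c \o pi : borel X -> J).
    by move=> i; exact: (borel_preimage cpi (mc i)).
  have icn : itinerary (S : borel Y -> borel Y) c n \o pi = itinerary TB (c \o pi) n.
    by apply/funext => x; apply/ffunP => i; rewrite !ffunE/= (factor_iter piT).
  have hm := fap_probability mu.
  move: He; rewrite icn (entropy_rate_iter mT hm imT n0 mb) (entropy_rate_iter mT hm imT n0 mcp).
  rewrite (Rintegral_birkhoff_sum cX cT iT)//.
  have := weighted_pressure_rate_iter n0 e0.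
  have : n%:R * weighted_pressure_rate T S pi f w e <= n%:R * p.
    by rewrite ler_wpM2l// Fp.
  rewrite /E; move: (weighted_pressure_rate _ _ _ _ _ _) (weighted_pressure_rate _ _ _ _ _ _).
  move=> F1 F2; clear; move: (\int[mu]_x f x) (entropy_rate m TB b)
     (entropy_rate m TB (c \o pi)) (ln 8) (n%:R) => *; lra.
apply/ler_addgt0Pr => d d0.
have C0 : 0 <= ln 8 + 1 :> R by rewrite addr_ge0// ln_ge0// ler1n.
pose n := (Num.bound ((ln 8 + 1) / d : R)).+1.
have n0 : 0 < n%:R :> R by rewrite ltr0n.
have nd : ln 8 + 1 <= n%:R * d :> R.
  rewrite -ler_pdivrMr//; apply: ltW; apply: lt_le_trans (archi_boundP _) _.
    by rewrite divr_ge0// ltW.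
  by rewrite ler_nat.
suff : n%:R * E <= n%:R * (p + d) by rewrite ler_pM2l.
by rewrite [leRHS]mulrDr (le_trans (H n isT))// lerD2l.
Qed.

End sup.
End variational_lower_bound.

(** * The variational principle: upper bound *)

Section equilibrium_weights.
Set Implicit Arguments.
Unset Strict Implicit.
Context {R : realType}.
Local Open Scope ring_scope.

(** A label i is drawn with probability Z_i^w / G, then s in its fibre with probability e^(u s) /
    Z_i. Both of the Gibbs inequalities behind the weighted one then become equalities. *)
Lemma weighted_gibbs_equality (A I : finType) (lab : A -> I) (u : A -> R) (w : R) (a0 : A) :
  (forall i, exists s, lab s = i) -> exists p : A -> R,
  [/\ forall s, 0 <= p s, \sum_s p s = 1 &
    w * (- \sum_s p s * ln (p s)) +
    (1 - w) * (- \sum_i (\sum_(s | lab s == i) p s) * ln (\sum_(s | lab s == i) p s)) +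
    w * \sum_s p s * u s = ln (\sum_i (\sum_(s | lab s == i) expR (u s)) `^ w)].
Proof.
move=> sl; pose Z i := \sum_(s | lab s == i) expR (u s).
have Z0 i : 0 < Z i.
  have [s si] := sl i; rewrite /Z (bigD1 s) ?si//= ltr_pwDl ?expR_gt0//.
  by apply: sumr_ge0 => *; exact: expR_ge0.
pose L i := ln (Z i); have LE i : expR (L i) = Z i by rewrite lnK ?posrE.
have Zw i : Z i `^ w = expR (w * L i) by rewrite -LE -expRM mulrC.
pose G := \sum_i Z i `^ w.
have G0 : 0 < G.
  by rewrite /G (bigD1 (lab a0))//= ltr_pwDl ?powR_gt0// sumr_ge0// => *; exact: powR_ge0.
(* p s = Z(lab s)^(w-1) e^(u s) / G *)
pose p s := expR (u s - L (lab s) + (w * L (lab s) - ln G)).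
have qE i : \sum_(s | lab s == i) p s = expR (w * L i - ln G).
  rewrite (eq_bigr (fun s => expR (u s) * expR (- L i + (w * L i - ln G)))).
    by rewrite -mulr_suml -/(Z i) -LE -expRD; congr expR; ring.
  by move=> s /eqP si; rewrite /p si -expRD; congr expR; ring.
have sp : \sum_s p s = 1.
  rewrite (partition_big lab xpredT)//= (eq_bigr (fun i => Z i `^ w / G)).
    by rewrite -mulr_suml divff// gt_eqF.
  by move=> i _; rewrite qE expRB Zw lnK.
exists p; split=> // [s|]; first exact: expR_ge0.
have -> : \sum_i (\sum_(s | lab s == i) p s) * ln (\sum_(s | lab s == i) p s) =
    \sum_s p s * (w * L (lab s) - ln G).
  rewrite [RHS](partition_big lab xpredT)//=; apply: eq_bigr => i _.
  rewrite {2}qE expRK mulr_suml; apply: eq_bigr => s /eqP <-//.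
transitivity (\sum_s p s * ln G); last by rewrite -mulr_suml sp mul1r.
rewrite -!sumrN !mulr_sumr -!big_split/=.
by apply: eq_bigr => s _; rewrite {2}/p expRK; ring.
Qed.

(** If each of the J steps lost more than a factor e^d, together they would lose more than
    e^(Jd). *)
Lemma exists_flat_scale (a : nat -> R) (d : R) (J : nat) : (0 < J)%N ->
  (forall j, 0 < a j) -> a 0 <= expR (J%:R * d) * a J ->
  exists2 j, (j < J)%N & a j <= expR d * a j.+1.
Proof.
case: J => // J _ a0 aJ; apply: contrapT => H.
have lt j : (j < J.+1)%N -> expR d * a j.+1 < a j.
  by move=> jJ; rewrite ltNge; apply/negP => le; apply: H; exists j.
have le k : (k <= J)%N -> expR (k%:R * d) * a k <= a 0.
  elim: k => [|k IH] kJ; first by rewrite mul0r expR0 mul1r.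
  apply: le_trans (IH (ltnW kJ)); rewrite -natr1 mulrDl mul1r expRD -mulrA.
  by rewrite ler_wpM2l ?expR_ge0// ltW// lt// (leq_trans kJ).
have := lt J (ltnSn J); rewrite -(ltr_pM2l (expR_gt0 (J%:R * d))) mulrA -expRD.
rewrite -[X in expR (_ + X)]mul1r -mulrDl natr1 ltNge => /negP; apply.
exact: le_trans (le J (leqnn J)) aJ.
Qed.

End equilibrium_weights.

(** * Atomic measures almost realizing the pressure at time N *)

Section atomic_measures.
Set Implicit Arguments.
Unset Strict Implicit.
Context {R : realType} (X : pmetricType R) (A : finType) (p : A -> R) (x : A -> X).
Context (p0 : forall s, (0 <= p s)%R) (p1 : (\sum_s p s = 1)%R).
Local Open Scope ring_scope.

Definition atomic (B : set X) : R := \sum_(s | `[< B (x s) >]) p s.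

Lemma atomic_ge0 B : 0 <= atomic B.
Proof. exact: sumr_ge0. Qed.

Lemma atomicT : atomic setT = 1.
Proof. by rewrite /atomic -[RHS]p1; apply: eq_bigl => s; apply/asboolP. Qed.

Lemma atomicU B B' : B `&` B' = set0 -> atomic (B `|` B') = atomic B + atomic B'.
Proof.
move=> BB'; rewrite /atomic (bigID (fun s => `[< B (x s) >]))/=.
congr (_ + _); apply: eq_bigl => s; apply/andP/asboolP.
- by case=> _ /asboolP.
- by move=> Bs; split; apply/asboolP => //; left.
- by case=> /asboolP[Bs|//] /asboolP nB.
- move=> Bs; split; apply/asboolP; first by right.
  move=> Bs'; suff : (B `&` B') (x s) by rewrite BB'.
  by split.
Qed.

Lemma atomic_fap : finitely_additive_probability (atomic : set (borel X) -> R).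
Proof.
split=> [B _||B B' _ _]; [exact: atomic_ge0|exact: atomicT|exact: atomicU].
Qed.

Lemma atomic_entropy_ge (K I : finType) (g : borel X -> K) (lab : A -> I) :
  finite_measurable g -> (forall s s', g (x s) = g (x s') -> lab s = lab s') ->
  - \sum_i (\sum_(s | lab s == i) p s) * ln (\sum_(s | lab s == i) p s) <=
    map_entropy (atomic : set (borel X) -> R) g.
Proof.
(* [phi k] reads the label off any atom in the cell [k]; cells without atoms go to [None], which has
   mass 0. *)
move=> mg gl; pose phi k := omap lab [pick s | g (x s) == k].
have phig s : phi (g (x s)) = Some (lab s).
  rewrite /phi; case: pickP => [s' /eqP/gl /= ->//|/(_ s)].
  by rewrite eqxx.
apply: le_trans (map_entropy_comp_le atomic_fap phi mg).
rewrite /map_entropy lerN2 (bigD1 None)//=.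
have -> : atomic (cell (phi \o g) None) = 0.
  by rewrite /atomic big_pred0// => s; apply/asboolP; rewrite /cell/= phig.
rewrite mul0r add0r (reindex_omap Some id) => [|[]//].
rewrite [leLHS](eq_bigl xpredT) => [|i]; last by rewrite /= eqxx.
rewrite le_eqVlt; apply/orP; left; apply/eqP/eq_bigr => i _; suff -> : atomic (cell (phi \o g) (Some i)) =
  \sum_(s | lab s == i) p s by [].
apply: eq_bigl => s; apply/asboolP/eqP; rewrite /cell/= phig; first by case.
by move=> ->.
Qed.

End atomic_measures.

Section maximizing_atoms.
Set Implicit Arguments.
Unset Strict Implicit.
Context {R : realType} (X Y : pmetricType R) (T : X -> X) (S : Y -> Y).
Context (pi : X -> Y) (f : X -> R) (w : R).
Context (cX : compact [set: X]) (cT : continuous T) (cf : continuous f).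
Context (cY : compact [set: Y]) (cS : continuous S).
Context (cpi : continuous pi) (spi : set_surj [set: X] [set: Y] pi).
Context (piT : pi \o T = S \o pi) (hw : (0 <= w <= 1)%R).
Local Open Scope ring_scope.

Lemma cover_pressure_growth (e : R) : 0 < e -> exists2 K : R, 0 <= K &
  forall N, (0 < N)%N -> fine (cover_pressure T setT f N e) <= expR (N%:R * K).
Proof.
move=> e0; set P := fun N => fine (cover_pressure T setT f N e).
have fin N : cover_pressure T setT f N e \is a fin_num by exact: (cover_pressure_fin cX cT cf).
have P0 N : 0 <= P N by rewrite fine_ge0// cover_pressure_ge0.
have E : expR (ln (P 1%N + 1)) = P 1%N + 1 by rewrite lnK// posrE ltr_wpDl.
(* Adding 1 makes the logarithm defined and nonnegative. *)
exists (ln (P 1%N + 1)); first by rewrite ln_ge0// lerDr.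
elim=> // -[_ _|N IH _]; first by rewrite mul1r E lerDl.
have : P (N.+1 + 1)%N <= P N.+1 * P 1%N.
  rewrite -lee_fin EFinM !fineK//.
  have := cover_pressure_submul cX cT cf setT setT N.+1 1 e0.
  by rewrite preimage_setT setIT.
rewrite addn1 => /le_trans; apply; rewrite -natr1 mulrDl mul1r expRD E.
apply: ler_pM => //; first exact: IH.
by rewrite lerDl.
Qed.

Lemma weighted_cover_pressure_le_balls (I : finType) (y : I -> Y) (v r : I -> R) N (e : R) :
  0 < e -> (forall i, 0 < r i /\ 2 * r i < e) ->
  (forall z, exists i, bowen_dist S N (y i) z < r i) ->
  (forall i, fine (cover_pressure T (pi @^-1` [set z | bowen_dist S N (y i) z < r i]) f N e) <= v i) ->
  fine (weighted_cover_pressure w pi T S f N e) <= \sum_i v i `^ w.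
Proof.
move=> e0 re cov av; have /andP[w0 w1] := hw.
rewrite -lee_fin fineK ?(weighted_cover_pressure_fin cX cT cf cY cS)//.
apply: le_trans (weighted_cover_pressure_le (V := fun i => [set z | bowen_dist S N (y i) z < r i]) _ _ _ _ _ _ _) _.
- by move=> i; exact: open_bowen_ball.
- by move=> z _; have [i yz] := cov z; exists i.
- move=> i; have [r0 r2] := re i; apply: (@le_lt_trans _ _ (2 * r i)%:E); last by rewrite lte_fin.
  apply: bowen_diam_le => z z' /= zi zi'; rewrite lee_fin.
  apply: (le_trans (bowen_dist_triangle S N z (y i) z')); rewrite bowen_dist_sym.
  by move: (ltW zi) (ltW zi'); lra.
- rewrite -sumEFin; apply: lee_sum => i _; rewrite -poweR_EFin; apply: poweR_le => //.
    exact: cover_pressure_ge0.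
  by rewrite -[leLHS]fineK ?lee_fin ?(cover_pressure_fin cX cT cf).
Qed.

Local Notation a N e y r :=
  (fine (cover_pressure T (pi @^-1` [set z | bowen_dist S N y z < r]) f N e)).

(* The radius 8 r at which the fibre pressure is compared with radius r depends
   on the centre; pigeonhole over J scales yields it, and the heaviest scale is
   kept. *)
Lemma single_scale_bound (e d : R) : 0 < e -> 0 < d ->
  exists (J : nat) (r0 : R), [/\ (0 < J)%N, 0 < r0 & forall N, (0 < N)%N ->
    exists (r : R) (s : seq Y), [/\ r0 <= r, uniq s,
      {in s &, forall y y', y != y' -> 4 * r <= bowen_dist S N y y'} &
      fine (weighted_cover_pressure w pi T S f N e) <=
        J%:R * \sum_(y <- s) (expR (N%:R * d) * a N e y r) `^ w]].
Proof.
move=> e0 d0; have [C C0 fC] := continuous_bounded cX cf.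
have [K K0 HK] := cover_pressure_growth e0.
(* A nonempty fibre has pressure at least e^(-NC) and at most e^(NK), so over J steps it loses at
   most e^(N(C + K)) <= e^(JNd), whatever N is. *)
pose J := (Num.bound ((C + K) / d : R)).+1.
have JC : C + K <= J%:R * d.
  rewrite -ler_pdivrMr//; apply: ltW; apply: lt_le_trans (archi_boundP _) _.
    by rewrite divr_ge0 ?addr_ge0// ltW.
  by rewrite ler_nat.
(* The factor e / 3 keeps the diameter of the balls below [e]. The ratio 8 is 2 times 4: a net of
   radius [r j] is separated by [r j / 2], which is [4 * r j.+1]. *)
pose r j : R := e / 3 * 8^-1 ^+ j.
have r_gt0 j : 0 < r j by rewrite mulr_gt0 ?divr_gt0// exprn_gt0// invr_gt0.
have rS j : r j = 8 * r j.+1 by rewrite /r exprS; field.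
have r_anti j k : (j <= k)%N -> r k <= r j.
  by move=> jk; rewrite ler_wpM2l ?divr_ge0 ?(ltW e0)// ler_wiXn2l// ?invr_ge0// invf_le1// ler1n.
have r_lt j : 2 * r j < e.
  by have := r_anti 0 j isT; rewrite /r expr0 mulr1 => H; apply: (@le_lt_trans _ _ (2 * (e / 3))); lra.
exists J, (r J); split=> // N N0.
have fin O : cover_pressure T O f N e \is a fin_num by exact: (cover_pressure_fin cX cT cf).
have a_ge y j : expR (- (N%:R * C)) <= a N e y (r j).
  rewrite -lee_fin fineK//; apply: cover_pressure_ge => //.
  have [x _ xy] := @spi y Logic.I; exists x.
  by rewrite /= xy bowen_distxx.
have a_gt0 y j : 0 < a N e y (r j) by exact: lt_le_trans (expR_gt0 _) (a_ge y j).
have a_le y j : a N e y (r j) <= expR (N%:R * K).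
  apply: le_trans (HK N N0); apply: fine_le => //; exact: cover_pressure_sub.
have /choice[jj jjP] : forall y, exists j, (j < J)%N /\
    a N e y (r j) <= expR (N%:R * d) * a N e y (r j.+1).
  move=> y; have [||j jJ Hj] := @exists_flat_scale R (fun j => a N e y (r j)) (N%:R * d) J isT.
  - exact: a_gt0.
  - apply: le_trans (a_le y 0) _.
    apply: (@le_trans _ _ (expR (J%:R * (N%:R * d)) * expR (- (N%:R * C)))); last first.
      by rewrite ler_wpM2l ?expR_ge0.
    rewrite -expRD ler_expR mulrCA -mulrN -mulrDr ler_wpM2l//.
    by move: JC; lra.
  - by exists j.
(* The centres of flat scale j get a net at the large radius [r j]; the balls of these radii, over
   all j, cover Y. The atoms will sit in the smaller balls of radius [r j.+1]. *)
have /choice[E EP] := fun j => bowen_net cY cS N [set y | jj y = j] (r_gt0 j).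
pose v y := expR (N%:R * d) * a N e y (r (jj y).+1).
pose A := {j : 'I_J & 'I_(size (E j))}.
have bound : fine (weighted_cover_pressure w pi T S f N e) <=
    \sum_(j < J) \sum_(y <- E j) v y `^ w.
  pose y (s : A) := nth point (E (tag s)) (tagged s).
  have yE (s : A) : y s \in E (tag s) by exact: mem_nth.
  have jy (s : A) : jj (y s) = tag s.
    by have [_ H _ _] := EP (tag s); exact: (H _ (yE s)).
  have -> : \sum_(j < J) \sum_(y <- E j) v y `^ w = \sum_(s : A) v (y s) `^ w.
    rewrite (eq_bigr (fun j : 'I_J => \sum_(k < size (E j)) v (nth point (E j) k) `^ w)).
      by rewrite sig_big_dep.
    by move=> j _; rewrite (big_nth point) big_mkord.
  apply: (@weighted_cover_pressure_le_balls _ y (v \o y) (r \o jj \o y)) => //.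
  - by move=> s /=; split; [exact: r_gt0|exact: r_lt].
  - move=> z; have [jJ _] := jjP z; have [_ _ cov _] := EP (jj z).
    have [x xE xz] := cov z erefl.
    have kE : (index x (E (Ordinal jJ)) < size (E (Ordinal jJ)))%N by rewrite index_mem.
    exists (Tagged (fun j : 'I_J => 'I_(size (E j))) (Ordinal kE)).
    rewrite /= jy /y /= nth_index//.
  - by move=> s /=; have [_] := jjP (y s).
have J0 : 'I_J by exact: ord0.
pose W (j : 'I_J) := \sum_(y <- E j) v y `^ w.
have [j Hj] : exists j, forall i, W i <= W j.
  by exists [arg max_(i > J0) W i]%O; case: arg_maxP => // i _ H k; exact: H.
exists (r j.+1), (E j); have [uE EO _ sE] := EP j; split => //.
- exact: r_anti.
- by move=> y y' yE yE' yy; apply: le_trans (sE y y' yE yE' yy); rewrite (rS j); lra.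
- apply: le_trans bound _; rewrite mulr_natl -[X in _ *+ X]card_ord -sumr_const.
  apply: ler_sum => i _; apply: le_trans (Hj i) _.
  rewrite /W big_seq [leRHS]big_seq; apply: ler_sum => y yE.
  by rewrite /v (EO y yE).
Qed.

(** [D] and [t] do not depend on N, and the estimate holds for every pair of partitions finer than
    [t], because the partitions are chosen later, with boundaries null for a limit measure built
    from these atoms. *)
Lemma maximizing_atoms (e d : R) : 0 < e -> 0 < d ->
  exists (D t : R), 0 < t /\ forall N, (0 < N)%N ->
    exists (A : finType) (p : A -> R) (x : A -> X),
    [/\ forall s, 0 <= p s, \sum_s p s = 1 &
      forall (K L : finType) (b : borel X -> K) (c : borel Y -> L),
      finite_measurable b -> finite_measurable c ->
      (forall z z' : X, b z = b z' -> mdist z z' < t) ->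
      (forall z z' : Y, c z = c z' -> mdist z z' < t) ->
      log_weighted_cover_pressure T S pi f w N e <=
        w * map_entropy (atomic p x : set (borel X) -> R)
          (itinerary (T : borel X -> borel X) b N) +
        (1 - w) * map_entropy (atomic p x : set (borel X) -> R)
          (itinerary (T : borel X -> borel X) (c \o pi) N) +
        w * (\sum_s p s * birkhoff_sum T f N (x s)) + (D + 2 * (N%:R * d))].
Proof.
move=> e0 d0; have /andP[w0 w1] := hw.
have [J [r0 [J0 r00 HJ]]] := single_scale_bound e0 d0.
have [d1 d10 Hd1] := continuous_uniform_real cX cf d0.
have [d2 d20 Hd2] := continuous_uniform cX cpi r00.
(* The radius of the nets in the fibres: e / 3 keeps their balls admissible at scale [e], and [d1]
   limits the oscillation of [f] on them to [d]. *)
pose q := Num.min (e / 3) d1.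
have q0 : 0 < q by rewrite lt_min d10 divr_gt0.
have qe : 2 * q < e.
  apply: (@le_lt_trans _ _ (2 * (e / 3))); last lra.
  by rewrite ler_wpM2l// ge_min lexx.
(* Atoms over one centre are separated by q / 2, [r0] lies below every radius [r] that can occur,
   and [d2] transfers closeness from X to Y. *)
pose t := Num.min (Num.min (q / 2) r0) d2.
have t0 : 0 < t by rewrite !lt_min r00 d20 divr_gt0.
exists (ln J%:R), t; split=> // N N0.
have [r [E [r0r uE sE WE]]] := HJ N N0.
have r_gt0 : 0 < r by exact: lt_le_trans r0r.
have /choice[F FP] := fun y => bowen_net cX cT N
  (pi @^-1` [set z | bowen_dist S N y z < r]) q0.
have Fne y : (0 < size (F y))%N.
  have [_ _ cov _] := FP y; have [x _ xy] := @spi y Logic.I.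
  have [|x' x'F _] := cov x; first by rewrite /= xy bowen_distxx.
  by case: (F y) x'F.
pose Z y := \sum_(x <- F y) expR (birkhoff_sum T f N x).
have aZ y : a N e y r <= expR (N%:R * d) * Z y.
  rewrite -lee_fin fineK ?(cover_pressure_fin cX cT cf)//.
  have [_ _ cov _] := FP y; apply: (cover_pressure_net cT q0 qe cov) => x x' xx'.
  by apply: Hd1; apply: lt_le_trans xx' _; rewrite ge_min lexx orbT.
have En : (0 < size E)%N.
  have := fine_weighted_cover_pressure_gt0 cX cT cf cY cS spi hw N e0.
  move=> /lt_le_trans/(_ WE); case: (E) => //.
  by rewrite big_nil mulr0 ltxx.
pose A := {i : 'I_(size E) & 'I_(size (F (nth point E i)))}.
pose y (i : 'I_(size E)) := nth point E i.
pose x (s : A) := nth point (F (y (tag s))) (tagged s).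
have yE i : y i \in E by exact: mem_nth.
have xF (s : A) : x s \in F (y (tag s)) by exact: mem_nth.
have xy (s : A) : bowen_dist S N (y (tag s)) (pi (x s)) < r.
  by have [_ H _ _] := FP (y (tag s)); exact: (H _ (xF s)).
have tag_onto (i : 'I_(size E)) : exists s : A, tag s = i.
  by exists (Tagged (fun i : 'I_(size E) => 'I_(size (F (y i)))) (Ordinal (Fne (y i)))).
have [a0 _] := tag_onto (Ordinal En).
have [p [p0 p1 pE]] := weighted_gibbs_equality (fun s => birkhoff_sum T f N (x s)) w a0 tag_onto.
exists A, p, x; split=> // K L b c mb mc bt ct.
have mTB (B : set (borel X)) : measurable B -> measurable (T @^-1` B : set (borel X)).
  by move=> mB; exact: borel_preimage.
have mcp : finite_measurable (c \o pi : borel X -> L).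
  by move=> i; exact: (borel_preimage cpi (mc i)).
have ZE i : \sum_(s : A | tag s == i) expR (birkhoff_sum T f N (x s)) = Z (y i).
  transitivity (\sum_(j | j == i) \sum_(k < size (F (y j)))
      expR (birkhoff_sum T f N (nth point (F (y j)) k))).
    by rewrite sig_big_dep/=; apply: eq_bigl => s; rewrite andbT.
  by rewrite big_pred1_eq /Z (big_nth point) big_mkord.
(* If the images of two atoms stay within [r0 <= r] up to time N, their centres are closer than r +
   r0 + r <= 3 r, whereas distinct centres are at distance at least 4 r. *)
have tags (s s' : A) : (forall n, (n < N)%N ->
    mdist (pi (iter n T (x s))) (pi (iter n T (x s'))) < r0) -> tag s = tag s'.
  move=> H; apply/val_inj/eqP; rewrite -(nth_uniq point (ltn_ord _) (ltn_ord _) uE).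
  apply/negPn/negP => ne; have := sE _ _ (yE (tag s)) (yE (tag s')) ne.
  apply/negP; rewrite -ltNge.
  have H' : bowen_dist S N (pi (x s)) (pi (x s')) < r0.
    by apply/bowen_dist_ltP => // n /H; rewrite !(factor_iter piT).
  apply: le_lt_trans (bowen_dist_triangle S N _ (pi (x s)) _) _.
  apply: (@lt_trans _ _ (r + bowen_dist S N (pi (x s)) (y (tag s')))).
    by rewrite ltrD2r.
  have := bowen_dist_triangle S N (pi (x s)) (pi (x s')) (y (tag s')).
  have := xy s'; rewrite bowen_dist_sym; move: H' r0r r_gt0.
  by move: (bowen_dist _ _ _ _) (bowen_dist _ _ _ _) (bowen_dist _ _ _ _) => *; lra.
have seps (s s' : A) : (forall n, (n < N)%N ->
    mdist (iter n T (x s)) (iter n T (x s')) < t) -> s = s'.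
  move=> H; have ts : tag s = tag s'.
    apply: tags => n nN; apply: Hd2; apply: lt_le_trans (H n nN) _.
    by rewrite ge_min lexx orbT.
  have xx : x s = x s'.
    apply/eqP/negPn/negP => ne; have [_ _ _ sep] := FP (y (tag s)).
    have := sep _ _ (xF s); rewrite {1}ts => /(_ _ (xF s') ne).
    apply/negP; rewrite -ltNge; apply/bowen_dist_ltP => [|n /H]; first by rewrite divr_gt0.
    by move=> /lt_le_trans; apply; rewrite /t !ge_min lexx.
  case: s s' ts xx {H} => i k [i' k'] /= ii; subst i' => /eqP.
  have [uF _ _ _] := FP (y i).
  by rewrite /x /= nth_uniq// => /eqP/val_inj ->.
have Hc := @atomic_entropy_ge R X A p x p0 p1 _ _ _ (fun s : A => tag s)
  (finite_measurable_itinerary mTB (n := N) mcp) _.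
have Hb := @atomic_entropy_ge R X A p x p0 p1 _ _ _ id
  (finite_measurable_itinerary mTB (n := N) mb) _.
have {}Hc : - \sum_i (\sum_(s : A | tag s == i) p s) * ln (\sum_(s : A | tag s == i) p s) <=
    map_entropy (atomic p x : set (borel X) -> R)
      (itinerary (T : borel X -> borel X) (c \o pi) N).
  apply: Hc => s s' /itinerary_eq H; apply: tags => n /H/= /ct.
  by move=> /lt_le_trans; apply; rewrite /t !ge_min lexx orbT.
have {}Hb : - \sum_s p s * ln (p s) <=
    map_entropy (atomic p x : set (borel X) -> R)
      (itinerary (T : borel X -> borel X) b N).
  rewrite (eq_bigr (fun s => (\sum_(s' : A | s' == s) p s') *
     ln (\sum_(s' : A | s' == s) p s'))); last by move=> s _; rewrite big_pred1_eq.
  by apply: Hb => s s' /itinerary_eq H; apply: seps => n /H/bt.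
have H1 := ler_wpM2l w0 Hb.
have w1' : 0 <= 1 - w by rewrite subr_ge0.
have H2 := ler_wpM2l w1' Hc.
apply: (@le_trans _ _ (ln (\sum_i (\sum_(s : A | tag s == i)
    expR (birkhoff_sum T f N (x s))) `^ w) + (ln J%:R + 2 * (N%:R * d)))); last first.
  rewrite -pE lerD2r lerD2r; exact: lerD.
rewrite (eq_bigr (fun i => Z (y i) `^ w)); last by move=> i _; rewrite ZE.
have Z0 z : 0 < Z z.
  rewrite /Z; case: (F z) (Fne z) => // z' l _.
  by rewrite big_cons ltr_pwDl ?expR_gt0// sumr_ge0// => *; exact: expR_ge0.
have SZ : 0 < \sum_i Z (y i) `^ w.
  rewrite (bigD1 (Ordinal En))//= ltr_pwDl ?powR_gt0//.
  by apply: sumr_ge0 => *; exact: powR_ge0.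
have JR : 0 < J%:R :> R by rewrite ltr0n.
rewrite -[2 * _]expRK -!lnM ?posrE ?mulr_gt0 ?expR_gt0//.
rewrite ler_ln ?posrE ?mulr_gt0 ?expR_gt0//; last first.
  exact: (fine_weighted_cover_pressure_gt0 cX cT cf cY cS).
apply: (le_trans WE); rewrite [leRHS]mulrC -mulrA ler_wpM2l//.
rewrite mulr_sumr (big_nth point) big_mkord; apply: ler_sum => i _.
(* One factor e^(Nd) comes from the change of radius, the other from the oscillation of [f]; since w
   <= 1 and the exponent is nonnegative, their product can be taken out of the power. *)
apply: (@le_trans _ _ ((expR (2 * (N%:R * d)) * Z (y i)) `^ w)).
  apply: ge0_ler_powR; rewrite ?nnegrE//.
  - by rewrite mulr_ge0 ?expR_ge0// fine_ge0// cover_pressure_ge0.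
  - by rewrite mulr_ge0 ?expR_ge0// ltW.
  - have -> : 2 * (N%:R * d) = N%:R * d + N%:R * d by ring.
    by rewrite expRD -mulrA ler_wpM2l ?expR_ge0// aZ.
rewrite powRM ?expR_ge0 ?(ltW (Z0 _))// ler_wpM2r ?powR_ge0//.
rewrite -[leRHS]powRr1 ?expR_ge0// ler_powR//.
by rewrite -expR0 ler_expR !mulr_ge0// ltW.
Qed.

End maximizing_atoms.

(** * Orbit averages and their invariant limit *)

Section limit_measure.
Set Implicit Arguments.
Unset Strict Implicit.
Context {R : realType} (X Y : pmetricType R) (T : X -> X) (S : Y -> Y).
Context (pi : X -> Y) (f : X -> R) (w : R).
Context (cX : compact [set: X]) (cT : continuous T) (cf : continuous f).
Context (cY : compact [set: Y]) (cS : continuous S).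
Context (cpi : continuous pi) (spi : set_surj [set: X] [set: Y] pi).
Context (piT : pi \o T = S \o pi) (hw : (0 <= w <= 1)%R).
Local Open Scope ring_scope.

(** The atoms are forgotten and [f] is replaced by an upper bound on each cell of [b], so that only
    values of the charge on cells and their preimages remain; such an estimate can pass to a limit
    of set functions. *)
Lemma maximizing_charge (e d : R) : 0 < e -> 0 < d ->
  exists (D t : R), 0 < t /\ forall N, (0 < N)%N ->
    exists m : set X -> R,
    [/\ forall B, 0 <= m B, m setT = 1,
      forall B B', B `&` B' = set0 -> m (B `|` B') = m B + m B' &
      forall (K L : finType) (b : borel X -> K) (c : borel Y -> L) (v : K -> R),
      finite_measurable b -> finite_measurable c ->
      (forall z z' : X, b z = b z' -> mdist z z' < t) ->
      (forall z z' : Y, c z = c z' -> mdist z z' < t) ->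
      (forall z, f z <= v (b z)) ->
      log_weighted_cover_pressure T S pi f w N e <=
        w * map_entropy (m : set (borel X) -> R)
          (itinerary (T : borel X -> borel X) b N) +
        (1 - w) * map_entropy (m : set (borel X) -> R)
          (itinerary (T : borel X -> borel X) (c \o pi) N) +
        w * (\sum_(n < N) \sum_k m (iter n T @^-1` cell b k) * v k) +
        (D + 2 * (N%:R * d))].
Proof.
move=> e0 d0; have /andP[w0 w1] := hw.
have [D [t [t0 H]]] := maximizing_atoms cX cT cf cY cS cpi spi piT hw e0 d0.
exists D, t; split=> // N N0; have [A [p [x [p0 p1 HA]]]] := H N N0.
exists (atomic p x); split.
- exact: atomic_ge0.
- exact: atomicT.
- exact: atomicU.
move=> K L b c v mb mc bt ct fv; apply: le_trans (HA K L b c mb mc bt ct) _.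
rewrite lerD2r lerD2l ler_wpM2l//.
rewrite (eq_bigr (fun s => \sum_(n < N) p s * f (iter n T (x s)))); last first.
  by move=> s _; rewrite mulr_sumr.
rewrite exchange_big/=; apply: ler_sum => n _.
apply: (@le_trans _ _ (\sum_s p s * v (b (iter n T (x s))))).
  by apply: ler_sum => s _; rewrite ler_wpM2l.
rewrite (partition_big (fun s => b (iter n T (x s))) xpredT)//=.
rewrite le_eqVlt; apply/orP; left; apply/eqP; apply: eq_bigr => k _.
rewrite /atomic mulr_suml; apply: eq_big => [s|s /eqP ->//].
by apply/eqP/asboolP.
Qed.

Section averages.
Context (m : nat -> set X -> R).
Context (m0 : forall N B, 0 <= m N B) (mT : forall N, (0 < N)%N -> m N setT = 1).
Context (mU : forall N, (0 < N)%N -> forall B B', B `&` B' = set0 ->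
  m N (B `|` B') = m N B + m N B').

Definition orbit_average N (B : set X) : R :=
  (\sum_(n < N) m N (iter n T @^-1` B)) / N%:R.

Let m_fap N : (0 < N)%N -> finitely_additive_probability (m N : set (borel X) -> R).
Proof. by move=> N0; split=> [B _||B B' _ _]; [exact: m0|exact: mT|exact: mU]. Qed.

Lemma charge_le1 N B : (0 < N)%N -> m N B <= 1.
Proof.
by move=> N0; rewrite -(mT N0) -(setvU B) setUC mU ?setICr// lerDl.
Qed.

Lemma orbit_average_ge0 N B : 0 <= orbit_average N B.
Proof. by rewrite divr_ge0// sumr_ge0. Qed.

Lemma orbit_averageU N B B' : (0 < N)%N -> B `&` B' = set0 ->
  orbit_average N (B `|` B') = orbit_average N B + orbit_average N B'.
Proof.
move=> N0 BB'; rewrite /orbit_average -mulrDl -big_split/=; congr (_ / _).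
by apply: eq_bigr => n _; rewrite preimage_setU mU// -preimage_setI BB' preimage_set0.
Qed.

Lemma orbit_averageT N : (0 < N)%N -> orbit_average N setT = 1.
Proof.
move=> N0; rewrite /orbit_average (eq_bigr (fun=> 1)) => [|n _].
  by rewrite sumr_const card_ord divff// pnatr_eq0 -lt0n.
by rewrite preimage_setT mT.
Qed.

Lemma orbit_average_le1 N B : orbit_average N B <= 1.
Proof.
case: N => [|N]; first by rewrite /orbit_average big_ord0 mul0r.
by rewrite -(@orbit_averageT N.+1)// -(setvU B) setUC orbit_averageU ?setICr// lerDl orbit_average_ge0.
Qed.

Lemma orbit_average_preimage N B : (0 < N)%N ->
  `|orbit_average N (T @^-1` B) - orbit_average N B| <= N%:R^-1.
Proof.
move=> N0; rewrite -mulrBl normrM [X in _ * X]ger0_norm// -[leRHS]mul1r ler_wpM2r//.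
have -> : \sum_(n < N) m N (iter n T @^-1` (T @^-1` B)) =
    \sum_(n < N) m N (iter n.+1 T @^-1` B).
  by [].
case: N N0 => // N N0; rewrite big_ord_recr big_ord_recl/= [X in _ - X]addrC.
set s := (X in `|X + _ - _|); rewrite -[X in _ - (X + _)]/s.
rewrite [X in `|X|](_ : _ = m N.+1 (iter N.+1 T @^-1` B) - m N.+1 B); last by rewrite /=; ring.
by rewrite ler_norml; have := charge_le1 (iter N.+1 T @^-1` B) N0; have := charge_le1 B N0;
  have := m0 N.+1 (iter N.+1 T @^-1` B); have := m0 N.+1 B => /=; lra.
Qed.

Let orbit_average_fap N : (0 < N)%N ->
  finitely_additive_probability (orbit_average N : set (borel X) -> R).
Proof.
move=> N0; split=> [B _||B B' _ _]; first exact: orbit_average_ge0.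
  exact: orbit_averageT.
exact: orbit_averageU.
Qed.

(** The block inequality for the charge at time N, followed by concavity to move the average over
    shifts inside the entropy. The error vanishes as N grows with M fixed. *)
Lemma entropy_orbit_average (K : finType) (g : borel X -> K) M N :
  (0 < M)%N -> (0 < N)%N -> finite_measurable g ->
  map_entropy (m N : set (borel X) -> R) (itinerary (T : borel X -> borel X) g N) / N%:R <=
  map_entropy (orbit_average N : set (borel X) -> R)
     (itinerary (T : borel X -> borel X) g M) / M%:R + M%:R * ln #|K|%:R / N%:R.
Proof.
move=> M0 N0 mg; have MR : 0 < M%:R :> R by rewrite ltr0n.
have NR : 0 < N%:R :> R by rewrite ltr0n.
have mTB (B : set (borel X)) : measurable B -> measurable (T @^-1` B : set (borel X)).
  by move=> mB; exact: borel_preimage.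
have H1 := map_entropy_block mTB (m_fap N0) N mg M0.
have H2 := map_entropy_concave (orbit_average_fap N0) N0
  (mn := fun n B => m N (iter n T @^-1` B)) (fun n B _ => m0 N (iter n T @^-1` B))
  (fun B _ => erefl) (finite_measurable_itinerary mTB (n := M) mg).
have H3 := le_trans H1 (lerD H2 (lexx _)).
rewrite ler_pdivrMr// mulrDl divfK ?gt_eqF// -(ler_pM2l MR); apply: le_trans H3 _.
rewrite mulrDr lerD2r [X in _ <= _ * X]mulrC !mulrA.
by rewrite [M%:R * N%:R]mulrC -!mulrA [M%:R * (_ / _)]mulrC divfK ?gt_eqF.
Qed.

Lemma orbit_average_limit (U : set_system nat) : UltraFilter U -> \oo `<=` U ->
  exists2 mu : probability (borel X) R, invariant_measure (T : borel X -> borel X) mu &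
    forall A : set (borel X), measurable A -> continuity_set mu A ->
      orbit_average N A @[N --> U] --> fine (mu A).
Proof.
move=> uU ooU; have N0U : \forall N \near U, (0 < N)%N by apply: ooU; exact: nbhs_infty_gt.
have H (A : set X) : exists l : R, orbit_average N A @[N --> U] --> l.
  apply: (@ultrafilter_bounded_cvg _ _ _ uU _ 0 1) => N.
  by rewrite orbit_average_ge0 orbit_average_le1.
have [nu nuP] := choice H.
have cvg_eq (g : nat -> R) (a b : R) : g @ U --> a -> g @ U --> b -> a = b.
  by move=> ga gb; rewrite -(cvg_lim _ ga)// -(cvg_lim _ gb).
have nu0 A : 0 <= nu A.
  by apply: (ler_cvg_to (cvg_cst 0) (nuP A)); apply: nearW => N; exact: orbit_average_ge0.
have nuT : nu setT = 1.
  apply: (cvg_eq _ _ _ (nuP setT)); apply: cvg_near_cst.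
  by apply: filterS N0U => N; exact: orbit_averageT.
have nuU A B : A `&` B = set0 -> nu (A `|` B) = nu A + nu B.
  move=> AB; apply: (cvg_eq _ _ _ (nuP _)).
  apply: cvg_trans (cvgD (nuP A) (nuP B)); apply: near_eq_cvg.
  by apply: filterS N0U => N N0; rewrite orbit_averageU.
have inf0 : (N%:R^-1 : R) @[N --> U] --> (0 : R).
  suff H0 : (N%:R^-1 : R) @[N --> \oo] --> (0 : R) by move=> A /H0/ooU.
  apply/gtr0_cvgV0; last exact: cvgr_idn.
  by near=> N; rewrite ltr0n; near: N; exact: nbhs_infty_gt.
have nu_inv A : nu (T @^-1` A) = nu A.
  apply: (cvg_eq _ _ _ (nuP _)).
  suff : orbit_average N (T @^-1` A) - orbit_average N A @[N --> U] --> (0 : R).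
    move=> /cvgD/(_ (nuP A)); rewrite add0r; apply: cvg_trans.
    by apply: near_eq_cvg; apply: nearW => N /=; rewrite subrK.
  apply/cvgr0Pnorm_le => r r0; move/cvgr0Pnorm_le: inf0 => /(_ r r0).
  apply: filterS2 N0U => N N0 Nr; apply: le_trans (orbit_average_preimage _ N0) _.
  by apply: le_trans Nr; exact: ler_norm.
have nu_le A B : A `<=` B -> nu A <= nu B.
  move=> AB; rewrite -(setDUK AB) nuU ?lerDl//.
  by rewrite setDE setICA setICr setI0.
have [mu [muK muU muS]] := regular_borel_extension cX nu0 nuT nuU.
exists mu.
  (* The limit charge is exactly invariant, but this reaches [mu] only as an inequality: for closed
     [K] inside [V], [nu K] is the charge of the preimage of [K], hence at most [mu] of the preimage
     of [V]. *)
  apply: invariant_of_open => // V oV; rewrite muS//.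
  apply: ub_ereal_sup => _ [K [cK KV] <-]; rewrite -nu_inv.
  apply: (@le_trans _ _ (mu (T @^-1` K))).
    by apply: muK; apply: closed_comp => // x _; exact: cT.
  apply: le_measure; rewrite ?inE.
  - by apply: measurable_closed; apply: closed_comp => // x _; exact: cT.
  - by apply: measurable_open; apply: open_comp => // x _; exact: cT.
  - exact: preimage_subset.
move=> A mA cA; rewrite -(continuity_set_eq nu_le muK muU mA cA); exact: nuP.
Unshelve. all: by end_near.
Qed.

End averages.
End limit_measure.

Section variational_upper_bound.
Set Implicit Arguments.
Unset Strict Implicit.
Context {R : realType} (X Y : pmetricType R) (T : X -> X) (S : Y -> Y).
Context (pi : X -> Y) (f : X -> R) (w : R).
Context (cX : compact [set: X]) (cT : continuous T) (cf : continuous f).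
Context (cY : compact [set: Y]) (cS : continuous S).
Context (cpi : continuous pi) (spi : set_surj [set: X] [set: Y] pi).
Context (piT : pi \o T = S \o pi) (hw : (0 <= w <= 1)%R).
Local Open Scope ring_scope.
Local Notation TB := (T : borel X -> borel X).

(** Of the error, [2 * d] comes from the estimate at finite times and at most [2 * d] from replacing
    [f] by values on cells. One invariant measure and one pair of partitions serve for the given
    [e], so no semicontinuity of entropy is involved. *)
Lemma near_equilibrium (e d : R) : 0 < e -> 0 < d ->
  exists2 mu : probability (borel X) R, invariant_measure TB mu &
    exists (K L : finType) (b : borel X -> K) (c : borel Y -> L),
    [/\ finite_measurable b, finite_measurable c &
      weighted_pressure_rate T S pi f w e <=
        w * entropy_rate (fine \o mu) TB b +
        (1 - w) * entropy_rate (fine \o mu) TB (c \o pi) +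
        w * \int[mu]_x f x + 4 * d].
Proof.
move=> e0 d0; have /andP[w0 w1] := hw; have w1' : 0 <= 1 - w by rewrite subr_ge0.
have [D [t [t0 Ht]]] := maximizing_charge cX cT cf cY cS cpi spi piT hw e0 d0.
have [d1 d10 Hd1] := continuous_uniform_real cX cf d0.
have /choice[m mP] : forall N, exists m : set X -> R, (forall B, 0 <= m B) /\
    ((0 < N)%N -> [/\ m setT = 1,
      forall B B', B `&` B' = set0 -> m (B `|` B') = m B + m B' &
      forall (K L : finType) (b : borel X -> K) (c : borel Y -> L) (v : K -> R),
      finite_measurable b -> finite_measurable c ->
      (forall z z' : X, b z = b z' -> mdist z z' < t) ->
      (forall z z' : Y, c z = c z' -> mdist z z' < t) ->
      (forall z, f z <= v (b z)) ->
      log_weighted_cover_pressure T S pi f w N e <=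
        w * map_entropy (m : set (borel X) -> R) (itinerary TB b N) +
        (1 - w) * map_entropy (m : set (borel X) -> R) (itinerary TB (c \o pi) N) +
        w * (\sum_(n < N) \sum_k m (iter n T @^-1` cell b k) * v k) +
        (D + 2 * (N%:R * d))]).
  move=> [|N]; first by exists (cst 0).
  by have [m [? ? ? ?]] := Ht N.+1 isT; exists m.
have m0 N : forall B, 0 <= m N B by case: (mP N).
have mT N : (0 < N)%N -> m N setT = 1 by move=> N0; case: (mP N) => _ /(_ N0)[].
have mU N : (0 < N)%N -> forall B B', B `&` B' = set0 -> m N (B `|` B') = m N B + m N B'.
  by move=> N0; case: (mP N) => _ /(_ N0)[].
have [U [uU ooU]] := @ultraFilterLemma nat \oo _.
have [mu imu mu_lim] := orbit_average_limit cX cT m0 mT mU uU ooU.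
have iT (A : set (borel X)) : measurable A -> mu (T @^-1` A) = mu A by exact: imu.
(* The cells of [b] must resolve the atoms and also make [f] vary by at most [d]. *)
have min0 : 0 < Num.min t d1 by rewrite lt_min t0.
have cid : continuous (id : X -> X) by move=> x; exact: cvg_id.
have [K [b [mb bt cb]]] := small_continuity_partition mu cX cid min0.
have [L [c [mc ct cc]]] := small_continuity_partition mu cY cpi t0.
exists mu => //; exists K, L, b, c; split=> //.
have mTB (B : set (borel X)) : measurable B -> measurable (T @^-1` B : set (borel X)).
  by move=> mB; exact: borel_preimage.
have mcp : finite_measurable (c \o pi : borel X -> L).
  by move=> i; exact: (borel_preimage cpi (mc i)).
have hm := fap_probability mu.
have im (A : set (borel X)) : measurable A -> (fine \o mu) (T @^-1` A) = (fine \o mu) A.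
  by move=> mA; rewrite /= iT.
(* The value of [f] at a chosen point of the cell, raised by [d]: an upper bound for [f] there which
   exceeds it by at most [2 * d]. *)
pose v k := f (xget point (cell b k)) + d.
have fv z : `|f z - f (xget point (cell b (b z)))| <= d.
  apply: Hd1; have : cell b (b z) (xget point (cell b (b z))) by apply: xgetI; exact: erefl.
  move=> bz; have := bt z (xget point (cell b (b z))).
  by rewrite bz => /(_ erefl)/lt_le_trans; apply; rewrite ge_min lexx orbT.
have fv1 z : f z <= v (b z) by have := fv z; rewrite ler_norml /v; lra.
have fv2 z : v (b z) <= f z + 2 * d by have := fv z; rewrite ler_norml /v; lra.
have intv : \sum_k fine (mu (cell b k)) * v k <= \int[mu]_x f x + 2 * d.
  have cNf : continuous (fun x => - f x) by move=> x; apply: cvgN; exact: cf.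
  have fv3 z : - f z <= - v (b z) + 2 * d by have := fv2 z; lra.
  have := Rintegral_le_cells mu cX (c := fun k => - v k + 2 * d) mb cNf fv3.
  have -> : \int[mu]_x - f x = - \int[mu]_x f x.
    under eq_Rintegral do rewrite -mulN1r.
    by rewrite RintegralZl ?mulN1r//; exact: continuous_integrable.
  have -> : \sum_k fine (mu (cell b k)) * (- v k + 2 * d) =
      2 * d - \sum_k fine (mu (cell b k)) * v k.
    rewrite -[X in X - _]mulr1 -(fap_sum1 hm mb) mulr_sumr -sumrB.
    by apply: eq_bigr => k _; rewrite /=; ring.
  by lra.
have ooU0 (g : nat -> R) (l : R) : g @ \oo --> l -> g @ U --> l by move=> gl A /gl/ooU.
have inf0 : (N%:R^-1 : R) @[N --> U] --> (0 : R).
  apply: ooU0; apply/gtr0_cvgV0; last exact: cvgr_idn.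
  by near=> N; rewrite ltr0n; near: N; exact: nbhs_infty_gt.
set F := weighted_pressure_rate T S pi f w e.
have Fcvg : log_weighted_cover_pressure T S pi f w N e / N%:R @[N --> U] --> F.
  apply: ooU0; exact: weighted_pressure_rate_cvg.
have Hcvg (J : finType) (g : borel X -> J) M : finite_measurable g ->
    (forall j, continuity_set mu (cell g j)) ->
    map_entropy (orbit_average T m N : set (borel X) -> R) (itinerary TB g M) @[N --> U] -->
    map_entropy (fine \o mu) (itinerary TB g M).
  move=> mg cg; apply: cvg_map_entropy => [N i|i]; first exact: orbit_average_ge0.
  apply: mu_lim; first exact: finite_measurable_itinerary.
  exact: continuity_set_itinerary.
(* The word length M stays fixed while N runs along the ultrafilter; M tends to infinity only
   afterwards, once the entropies are those of [mu]. *)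
have key M : (0 < M)%N -> F <=
    w * (map_entropy (fine \o mu) (itinerary TB b M) / M%:R) +
    (1 - w) * (map_entropy (fine \o mu) (itinerary TB (c \o pi) M) / M%:R) +
    w * (\int[mu]_x f x + 2 * d) + 2 * d.
  move=> M0.
  (* All contributions of order 1/N for fixed M: the block errors of the two partitions and the
     constant [D]. *)
  pose rest := w * (M%:R * ln #|K|%:R) + (1 - w) * (M%:R * ln #|L|%:R) + D.
  have Sv : \sum_k orbit_average T m N (cell b k) * v k @[N --> U] -->
      \sum_k fine (mu (cell b k)) * v k.
    apply: cvg_bigsum => k; apply: cvgM; last exact: cvg_cst.
    by apply: mu_lim; [exact: mb|exact: cb].
  apply: (@le_trans _ _ (w * (map_entropy (fine \o mu) (itinerary TB b M) / M%:R) +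
      (1 - w) * (map_entropy (fine \o mu) (itinerary TB (c \o pi) M) / M%:R) +
      w * (\sum_k fine (mu (cell b k)) * v k) + (2 * d + rest * 0))); last first.
    by rewrite mulr0 addr0 lerD2r lerD2l ler_wpM2l.
  apply: (ler_cvg_to Fcvg (g := fun N =>
      w * (map_entropy (orbit_average T m N : set (borel X) -> R) (itinerary TB b M) / M%:R) +
      (1 - w) * (map_entropy (orbit_average T m N : set (borel X) -> R)
        (itinerary TB (c \o pi) M) / M%:R) +
      w * (\sum_k orbit_average T m N (cell b k) * v k) + (2 * d + rest * N%:R^-1))).
    apply: cvgD; last by apply: cvgD; [exact: cvg_cst|apply: cvgM => //; exact: cvg_cst].
    apply: cvgD; last by apply: cvgM => //; exact: cvg_cst.
    by apply: cvgD; (apply: cvgM; first exact: cvg_cst);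
      (apply: cvgM; last exact: cvg_cst); exact: Hcvg.
  have : \forall N \near U, (0 < N)%N by apply: ooU; exact: nbhs_infty_gt.
  apply: filterS => N N0; have NR : 0 < N%:R :> R by rewrite ltr0n.
  have bt' (z z' : X) : b z = b z' -> mdist z z' < t.
    by move=> /bt/lt_le_trans; apply; rewrite ge_min lexx.
  case: (mP N) => _ /(_ N0)[_ _ /(_ K L b c v mb mc bt' ct fv1)].
  have Eb := entropy_orbit_average cT m0 mT mU M0 N0 mb.
  have Ec := entropy_orbit_average cT m0 mT mU M0 N0 mcp.
  have -> : \sum_(n < N) \sum_k m N (iter n T @^-1` cell b k) * v k =
      N%:R * \sum_k orbit_average T m N (cell b k) * v k.
    rewrite exchange_big mulr_sumr/=; apply: eq_bigr => k _.
    by rewrite -mulr_suml /orbit_average; field; rewrite gt_eqF.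
  have {}Eb := ler_wpM2l w0 Eb; have {}Ec := ler_wpM2l w1' Ec.
  rewrite ler_pdivrMr//.
  move=> H; apply: le_trans H _; move: Eb Ec; clear -NR; rewrite /rest.
  move: (map_entropy _ _) (map_entropy _ _) (map_entropy _ _) (map_entropy _ _)
    (\sum_k _) (ln _) (ln _) => oc hc ob hb sv lL lK Eb Ec.
  have -> : w * hb + (1 - w) * hc + w * (N%:R * sv) + (D + 2 * (N%:R * d)) =
      (w * (hb / N%:R) + (1 - w) * (hc / N%:R) + w * sv + (D / N%:R + 2 * d)) * N%:R.
    by field; rewrite gt_eqF.
  rewrite ler_wpM2r ?(ltW NR)//; apply: le_trans (_ : _ <=
    w * (ob / M%:R + M%:R * lK / N%:R) + (1 - w) * (oc / M%:R + M%:R * lL / N%:R) +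
    w * sv + (D / N%:R + 2 * d)) _.
    by rewrite !lerD2r lerD.
  by rewrite le_eqVlt; apply/orP; left; apply/eqP; ring.
have l1 := entropy_rate_cvg mTB hm im mb.
have l2 := entropy_rate_cvg mTB hm im mcp.
have : F <= w * entropy_rate (fine \o mu) TB b +
    (1 - w) * entropy_rate (fine \o mu) TB (c \o pi) + w * (\int[mu]_x f x + 2 * d) + 2 * d.
  apply: (ler_cvg_to (a := \oo) (cvg_cst F)); last first.
    by near=> M; apply: key; near: M; exact: nbhs_infty_gt.
  apply: cvgD; last exact: cvg_cst.
  apply: cvgD; last exact: cvg_cst.
  by apply: cvgD; apply: cvgM => //; exact: cvg_cst.
have : w * d <= d by rewrite ler_piMl// ltW.
move: (\int[mu]_x f x) (entropy_rate _ _ b)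
  (entropy_rate (fine \o mu) TB (c \o pi : borel X -> L)); clear => *.
by lra.
Unshelve. all: by end_near.
Qed.

End variational_upper_bound.

(** * Entropy of the factor and passage to suprema *)

Section factor_entropy.
Set Implicit Arguments.
Unset Strict Implicit.
Context {R : realType} (X Y : pmetricType R) (T : X -> X) (S : Y -> Y) (pi : X -> Y).
Context (cpi : continuous pi) (piT : pi \o T = S \o pi).
Context (mu : probability (borel X) R).
Local Notation nu := (pushforward mu (pi : borel X -> borel Y)).
Local Notation TB := (T : borel X -> borel X).
Local Notation SB := (S : borel Y -> borel Y).

Lemma pushforward_fap : finitely_additive_probability (fine \o nu).
Proof.
have [P PE] := pushforward_probability cpi mu.
rewrite (_ : nu = P); first exact: fap_probability.
by apply/funext => A; rewrite PE.
Qed.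

Lemma entropy_rate_factor (J : finType) (c : borel Y -> J) :
  entropy_rate (fine \o nu) SB c = entropy_rate (fine \o mu) TB (c \o pi).
Proof.
rewrite /entropy_rate; f_equal; f_equal; apply/funext => n; congr (_ / _)%R.
have -> : itinerary TB (c \o pi) n = itinerary SB c n \o pi.
  by apply/funext => x; apply/ffunP => i; rewrite !ffunE/= (factor_iter piT).
by [].
Qed.

End factor_entropy.

Section ereal_suprema.
Set Implicit Arguments.
Unset Strict Implicit.
Context {R : realType}.
Local Open Scope ereal_scope.

(** The supremum of a set of reals, possibly infinite, described by its real upper bounds, so that
    an inequality with a real right-hand side can be checked on the elements alone. *)
Definition least_bound (A : set R) (k : \bar R) :=
  (forall a, A a -> a%:E <= k) /\
  (forall c : R, (forall a, A a -> (a <= c)%R) -> k <= c%:E).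

Lemma least_boundMl (A : set R) (k : \bar R) (w x : R) : A !=set0 -> least_bound A k ->
  (0 <= w)%R -> (forall a, A a -> (w * a <= x)%R) -> w%:E * k <= x%:E.
Proof.
(* For [w = 0] the product is 0 even if [k] is infinite, and an element of [A] gives [0 <= x]. *)
move=> [a Aa] [_ kc]; rewrite le_eqVlt => /orP[/eqP <- /(_ a Aa)|w0 H].
  by rewrite mul0e mul0r lee_fin.
rewrite -(@lee_pdivlMl _ w) -?EFinM//; apply: kc => b Ab.
by rewrite mulrC ler_pdivlMr// mulrC H.
Qed.

(** The elements [a] and [b] vary independently. A fixed [b] bounds, and so makes finite, the first
    term; this term can then be moved to the other side while [b] varies. *)
Lemma least_boundD (A B : set R) (k h : \bar R) (w c : R) :
  A !=set0 -> B !=set0 -> least_bound A k -> least_bound B h -> (0 <= w <= 1)%R ->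
  (forall a b, A a -> B b -> (w * a + (1 - w) * b <= c)%R) ->
  w%:E * k + (1 - w)%:E * h <= c%:E.
Proof.
move=> A0 B0 lk lh /andP[w0 w1] H; have [[a Aa] [b Bb]] := (A0, B0).
have kfin : w%:E * k \is a fin_num.
  rewrite fin_real//; apply/andP; split.
    by apply: (@lt_le_trans _ _ (w * a)%:E); rewrite ?ltNyr// EFinM lee_wpmul2l// (lk.1 a Aa).
  apply: (@le_lt_trans _ _ (c - (1 - w) * b)%:E); last exact: ltry.
  by apply: (least_boundMl A0 lk) => // a' Aa'; rewrite lerBrDr H.
rewrite -(fineK kfin) -leeBrDl// -EFinB.
apply: (least_boundMl B0 lh) => [|b' Bb']; first by rewrite subr_ge0.
rewrite lerBrDl -lerBrDr -lee_fin fineK//.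
by apply: (least_boundMl A0 lk) => // a' Aa'; rewrite lerBrDr H.
Qed.

End ereal_suprema.

Section ks_entropy_suprema.
Set Implicit Arguments.
Unset Strict Implicit.
Context {d : measure_display} {T : measurableType d} {R : realType}.
Context (f : T -> T) (mf : forall A, measurable A -> measurable (f @^-1` A)).
Context (mu : set T -> \bar R) (hm : finitely_additive_probability (fine \o mu)).

Definition entropy_rates : set R := [set r | exists k (g : T -> 'I_k),
  finite_measurable g /\ r = entropy_rate (fine \o mu) f g].

Lemma entropy_rates_nonempty : entropy_rates !=set0.
Proof.
exists (entropy_rate (fine \o mu) f (fun=> ord0 : 'I_1)), 1%N, (fun=> ord0); split=> // i.
by rewrite (_ : cell _ _ = setT)//; apply/seteqP; split=> x // _; rewrite /cell/= [i]ord1.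
Qed.

Lemma ks_entropy_least_bound : least_bound entropy_rates (ks_entropy mu f).
Proof.
split=> [_ [k [g [mg ->]]]|c H]; first exact: entropy_rate_le_ks_entropy.
by apply: ks_entropy_le => // k g mg; rewrite lee_fin; apply: H; exists k, g.
Qed.

End ks_entropy_suprema.

Theorem theorem2p1 (R : realType) (X Y : pmetricType R)
    (T : X -> X) (S : Y -> Y) (pi : X -> Y) (f : X -> R) (w : R)
    (hT : dynamical_system T) (hS : dynamical_system S)
    (hpi : factor_map T S pi) (hf : continuous f)
    (hw : (0 <= w <= 1)%R) :
  weighted_pressure w pi T S f =
  ereal_sup [set w%:E * ks_entropy mu (T : borel X -> borel X)
               + (1 - w)%:E * ks_entropy
                   (pushforward mu (pi : borel X -> borel Y))
                   (S : borel Y -> borel Y)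
               + w%:E * \int[mu]_x (f x)%:E
            | mu in [set mu : probability (borel X) R
                    | invariant_measure (T : borel X -> borel X) mu]].
Proof.
have [cX cT] := hT; have [cY cS] := hS; have [cpi spi piT] := hpi.
have /andP[w0 w1] := hw; have w1' : (0 <= 1 - w)%R by rewrite subr_ge0.
have mT (A : set (borel X)) : measurable A -> measurable (T @^-1` A : set (borel X)).
  by move=> mA; exact: borel_preimage.
have mS (A : set (borel Y)) : measurable A -> measurable (S @^-1` A : set (borel Y)).
  by move=> mA; exact: borel_preimage.
rewrite (weighted_pressureE cX cT hf cY cS spi piT hw).
apply/eqP; rewrite eq_le; apply/andP; split.
- apply: ub_ereal_sup => _ [e /= e0 <-]; apply/lee_addgt0Pr => r r0.
  (* [near_equilibrium] loses four times its parameter. *)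
  have r4 : (0 < r / 4)%R by rewrite divr_gt0.
  have [mu imu [K [L [b [c [mb mc H]]]]]] :=
    near_equilibrium cX cT hf cY cS cpi spi piT hw e0 r4.
  set term := w%:E * ks_entropy mu (T : borel X -> borel X)
               + (1 - w)%:E * ks_entropy
                   (pushforward mu (pi : borel X -> borel Y))
                   (S : borel Y -> borel Y)
               + w%:E * \int[mu]_x (f x)%:E.
  apply: (@le_trans _ _ (term + r%:E)); last first.
    by rewrite leeD2r//; apply: ereal_sup_ubound; exists mu.
  rewrite (_ : r = 4 * (r / 4))%R; last by field.
  apply: le_trans (_ : _ <= _%:E) _; first by rewrite lee_fin; exact: H.
  rewrite EFinD leeD2r// /term (continuous_integral_EFin mu cX hf).
  rewrite 2!EFinD !EFinM leeD2r//; apply: leeD; apply: lee_wpmul2l => //.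
    exact: (entropy_rate_le_ks_entropy mT (fap_probability mu) mb).
  rewrite -(entropy_rate_factor piT).
  exact: (entropy_rate_le_ks_entropy mS (pushforward_fap cpi mu) mc).
- apply: ub_ereal_sup => _ [mu imu <-].
  have iT (A : set (borel X)) : measurable A -> mu (T @^-1` A) = mu A by exact: imu.
  set P := ereal_sup _.
  have Pge e : (0 < e)%R -> (weighted_pressure_rate T S pi f w e)%:E <= P.
    by move=> e0; apply: ereal_sup_ubound; exists e.
  (* A single scale excludes -oo, and for +oo there is nothing to prove, so the pressure may be
     taken real; both entropies are then tested on finite partitions by [least_boundD]. *)
  have : P != -oo by rewrite -ltNye (lt_le_trans _ (Pge 1%R ltr01))// ltNyr.
  move: Pge; case: P => [p Pge _|_ _|//]; last exact: leey.
  rewrite (continuous_integral_EFin mu cX hf) -EFinM -leeBrDr// -EFinB.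
  apply: (least_boundD (entropy_rates_nonempty _ _) (entropy_rates_nonempty _ _)
    (ks_entropy_least_bound mT (fap_probability mu))
    (ks_entropy_least_bound mS (pushforward_fap cpi mu)) hw).
  move=> _ _ [k [b [mb ->]]] [l [c [mc ->]]]; rewrite lerBrDr (entropy_rate_factor piT).
  apply: (entropy_le_pressure cX cY cpi spi hw cT hf cS piT iT mb mc) => e e0.
  by rewrite -lee_fin; exact: Pge.
Qed.
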